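(* Let $(\eta_i,\mathcal F_i)_{i\ge1}$ be a sequence of martingale differences (with $\mathcal F_0=\{\emptyset,\Omega\}$) such that, for positive constants $K,L,M$, \[ \mathbf E[|\eta_i|^3e^{K|\eta_i|}\mid\mathcal F_{i-1}]\le L\,\mathbf E[\eta_i^2\mid\mathcal F_{i-1}]\quad (i\ge1),\qquad \Big|\sum_{i=1}^n\mathbf E[\eta_i^2\mid\mathcal F_{i-1}]-n\Big|\le M\ \text{a.s. for all } n\ge1. \] For each $n$, let $F_n$ be the distribution function of $\sum_{i=1}^n\eta_i/\sqrt n$, let $H_n(s)=\inf\{x:F_n(x)\ge s\}$, $s\in(0,1)$, be its quantile function, let $Z$ be a standard normal random variable, and define $W_n=H_n(\Phi(Z))$ (so that $W_n$ has the same distribution as $\sum_{i=1}^n\eta_i/\sqrt n$). Then there exist constants $\alpha>0$, $D>0$ and an integer $n_0$ such that whenever $n\ge n_0$ and $|W_n|\le\alpha\sqrt n$, we have \[ \sqrt n\,|W_n-Z|/\ln n\le 2D\,(W_n^2+1)\quad\text{a.s.} \] Furthermore, there exist positive constants $C$ and $\lambda$ such that for all $n\ge n_0$ and all $x\ge0$, \[ \mathbf P\big(\sqrt n\,|W_n-Z|/\ln n>x\big)\le C\exp\{-\lambda x\}. \]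
   Context: $\Phi$ denotes the standard normal distribution function. A sequence $(\eta_i,\mathcal F_i)_{i\ge1}$ of martingale differences means $\eta_i$ is $\mathcal F_i$-measurable, integrable, and $\mathbf E[\eta_i\mid\mathcal F_{i-1}]=0$ for an increasing filtration $(\mathcal F_i)_{i\ge0}$. The constants $\alpha,D,n_0,C,\lambda$ may depend on $K,L,M$ but not on $n$ or $x$. *)

(* Defs.v *)
From HB Require Import structures.
From mathcomp Require Import all_boot all_order all_algebra.
From mathcomp Require Import all_classical all_reals all_analysis measurable_realfun.
Set Implicit Arguments. Unset Strict Implicit. Unset Printing Implicit Defensive.
Import Order.TTheory GRing.Theory Num.Theory.
Local Open Scope classical_set_scope.
Local Open Scope ring_scope.

Definition Phi {R : realType} (x : R) : R := fine (normal_prob 0 1 `]-oo, x]).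

Section defs.
Context {d : measure_display} {T : measurableType d} {R : realType}.

Definition sub_measurable (G : set (set T)) (f : T -> R) :=
  forall B : set R, measurable B -> G (f @^-1` B).
Definition sub_emeasurable (G : set (set T)) (f : T -> \bar R) :=
  forall B : set (\bar R), measurable B -> G (f @^-1` B).

Definition filtration (F : nat -> set (set T)) :=
  (forall i, sigma_algebra setT (F i)) /\
  (forall i, F i `<=` measurable) /\
  (forall i j, (i <= j)%N -> F i `<=` F j) /\
  F 0%N = [set set0; setT].

(* g is a version of E[X | G] for a nonnegative (extended) variable X *)
Definition is_cond_exp (mu : probability T R) (G : set (set T))
  (X g : T -> \bar R) :=
  sub_emeasurable G g /\ (forall w, (0 <= g w)%E) /\
  (forall A, G A -> (\int[mu]_(w in A) g w = \int[mu]_(w in A) X w)%E).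

Definition martingale_diff (mu : probability T R) (F : nat -> set (set T))
  (eta : nat -> T -> R) :=
  forall i, (0 < i)%N ->
    sub_measurable (F i) (eta i) /\
    mu.-integrable setT (EFin \o eta i) /\
    (forall A, F i.-1 A -> (\int[mu]_(w in A) (eta i w)%:E = 0)%E).

Definition distr_fn (mu : probability T R) (eta : nat -> T -> R) (n : nat)
  (x : R) : R :=
  fine (mu [set w | (\sum_(1 <= i < n.+1) eta i w) / Num.sqrt (n%:R) <= x]).

Definition quantile (Fn : R -> R) (s : R) : R := inf [set x | s <= Fn x].

Definition W (mu : probability T R) (eta : nat -> T -> R) (Z : T -> R)
  (n : nat) (w : T) : R :=
  quantile (distr_fn mu eta n) (Phi (Z w)).
End defs.

(* Main.v *)
Require Import Defs.
From HB Require Import structures.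
From mathcomp Require Import all_boot all_order all_algebra.
From mathcomp Require Import all_classical all_reals all_analysis measurable_realfun.
From mathcomp Require Import ring lra.
Import Order.TTheory GRing.Theory Num.Theory.
Import numFieldNormedType.Exports.
Local Open Scope classical_set_scope.
Local Open Scope ring_scope.

(** Everything rests on a two-sided comparison: for [|y| <= alpha sqrt n] and
    [delta = D (y^2 + 1) ln n / sqrt n], the distribution function [F_n] of the
    normalized sum satisfies [Phi (y - delta) <= F_n y <= Phi (y + delta)]; it says that
    the quantile coupling moves a point by at most about [delta].

    For [|y|^3] small with respect to [sqrt n] it follows from a Lindeberg expansion along the
    heat flow: with [N = n + m], [f (s, y) = Phi (y / sqrt s)] and [V_k] the predictable
    quadratic variation, the increments of [f (N - V_k, S_k - a)] have no first or
    second order conditional drift, because [f] solves the heat equation, and the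
    remainder is controlled by third derivatives of [f], i.e. by an exponentially
    tilted local weight of [S_k] around a point.  That weight is estimated by the
    concentration of [S_k] under the tilt, which is proved by the same expansion
    applied to the heat kernel and by strong induction on [n].  The result is
    [|P (S_n > w sqrt n) - Phi (- w)| <= C exp (- w^2 / 2) (w^2 + ln n) / sqrt n].

    For larger [w] a loss of [exp (C w^3 ln n / sqrt n)] is affordable.  The upper
    bound is Chernoff's; the lower bound cuts [0, n] into blocks whose length is of order
    [(sqrt n / w)^3], applies the first regime to each block conditionally on the past,
    and pays a factor polynomial in [n] per block.

    The exponential tail then follows from the pointwise bound when [|W_n| <= alpha sqrt n],
    and from Chernoff and Gaussian tails otherwise. *)

(** * The Gaussian distribution function *)

Section gauss.
Context {R : realType}.
Implicit Types x y s : R.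

Lemma mvt_le (f df : R -> R) (a b : R) : a <= b ->
  (forall x, a <= x -> x <= b -> is_derive x 1 f (df x)) ->
  exists c, [/\ a <= c, c <= b & f b - f a = df c * (b - a)].
Proof.
move=> ab hd.
have hc : {within `[a, b], continuous f}.
  apply: derivable_within_continuous => x; rewrite in_itv /= => /andP[ax xb].
  by case: (hd x ax xb).
have hd' x : x \in `]a, b[ -> is_derive x 1 f (df x).
  by rewrite in_itv /= => /andP[/ltW ax /ltW xb]; exact: hd.
have [c] := MVT_segment ab hd' hc.
by rewrite in_itv /= => /andP[ac cb] e; exists c.
Qed.

Definition gpdf x : R := normal_peak 1 * expR (- x ^+ 2 / 2).

Lemma gpdfE : normal_pdf 0 1 = gpdf.
Proof.
rewrite normal_pdfE ?oner_neq0//; apply/funext => x.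
by rewrite /gpdf /normal_fun subr0 expr1n.
Qed.

Lemma peak_gt0 : 0 < normal_peak 1 :> R.
Proof. by rewrite normal_peak_gt0 ?oner_neq0. Qed.

Lemma gpdf_gt0 x : 0 < gpdf x.
Proof. by rewrite mulr_gt0 ?peak_gt0 ?expR_gt0. Qed.

Lemma PhiE x : Phi x = (\int[lebesgue_measure]_(t in `]-oo, x]) gpdf t)%R.
Proof. by rewrite /Phi /normal_prob gpdfE. Qed.

Lemma is_derive_Phi x : is_derive x 1 Phi (gpdf x).
Proof.
have e : Phi = (fun z : R => \int[lebesgue_measure]_(t in `]-oo, z]) gpdf t)%R.
  by apply/funext => z; rewrite PhiE.
have h := @continuous_FTC1 R gpdf -oo%O x (x + 1) _ _ _ _.
have [h1 h2] : derivable (Phi : R -> R) x 1 /\ (derive1 (Phi : R -> R) x = gpdf x).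
  rewrite e; apply: h.
  - by rewrite ltrDl.
  - apply: (integrableS _ _ (subsetT _)) => //.
    by have := @integrable_normal_pdf R 0 1; rewrite gpdfE.
  - by rewrite ltNyr.
  - rewrite -gpdfE; exact: (@continuous_normal_pdf R 0 1 (oner_neq0 _) x).
by apply: DeriveDef; [exact: h1 | rewrite -derive1E; exact: h2].
Qed.

Lemma Phi_ge0 x : 0 <= Phi x.
Proof. by rewrite /Phi fine_ge0. Qed.

Lemma Phi_mvt x y : x <= y -> exists c, [/\ x <= c, c <= y & Phi y - Phi x = gpdf c * (y - x)].
Proof. by move=> xy; apply: mvt_le => // z _ _; exact: is_derive_Phi. Qed.

Lemma Phi_lt x y : x < y -> Phi x < Phi y.
Proof.
move=> xy; have [c [_ _ h]] := Phi_mvt x y (ltW xy).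
by rewrite -subr_gt0 h mulr_gt0 ?gpdf_gt0 ?subr_gt0.
Qed.

Lemma Phi_le x y : x <= y -> Phi x <= Phi y.
Proof. by rewrite le_eqVlt => /predU1P[->//|/Phi_lt/ltW]. Qed.

Lemma Phi_gt0 x : 0 < Phi x.
Proof. by apply: le_lt_trans (Phi_ge0 (x - 1)) _; apply: Phi_lt; lra. Qed.

Lemma gauss_halfline (A : set R) (b : R) : measurable A ->
  (forall y, A y -> b ^+ 2 <= y * b) -> fine (normal_prob 0 1 A) <= expR (- b ^+ 2 / 2).
Proof.
move=> mA hA.
have mpdf m : measurable_fun setT (EFin \o normal_pdf m (1:R)).
  by apply/measurable_EFinP; exact: measurable_normal_pdf.
have h : (normal_prob 0 (1:R) A <= (expR (- b ^+ 2 / 2))%:E * normal_prob b 1 A)%E.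
  rewrite /normal_prob -ge0_integralZl//; last 2 first.
  - exact: measurable_funTS (mpdf _).
  - by move=> y _; rewrite lee_fin normal_pdf_ge0.
  apply: ge0_le_integral => //.
  - by move=> y _; rewrite lee_fin normal_pdf_ge0.
  - exact: measurable_funTS (mpdf _).
  - by apply: measurable_funeM; exact: measurable_funTS (mpdf _).
  move=> y /hA yb.
  rewrite -EFinM lee_fin !normal_pdfE ?oner_neq0//.
  rewrite mulrCA ler_pM2l ?peak_gt0// /normal_fun -expRD ler_expR expr1n.
  nra.
have h1 : (normal_prob b (1:R) A <= 1)%E by exact: probability_le1.
have h2 : (normal_prob 0 (1:R) A <= (expR (- b ^+ 2 / 2))%:E)%E.
  apply: le_trans h _; rewrite -[leRHS]mule1; apply: lee_wpmul2l => //.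
rewrite -lee_fin fineK//; exact: fin_num_measure.
Qed.

Lemma Phi_tail x : 0 <= x -> Phi (- x) <= expR (- x ^+ 2 / 2).
Proof.
move=> x0; rewrite -(sqrrN x); apply: gauss_halfline => // y /=.
by rewrite in_itv /=; nra.
Qed.

Lemma Phi_tail1 x : 0 <= x -> 1 - expR (- x ^+ 2 / 2) <= Phi x.
Proof.
move=> x0; rewrite lerBlDr -lerBlDl.
have <- : fine (normal_prob (0:R) 1 `]x, +oo[) = 1 - Phi x.
  rewrite /Phi -[`]x, +oo[%classic]setCK.
  rewrite (_ : ~` `]x, +oo[ = `]-oo, x])%classic; last by rewrite setCitvr.
  rewrite [in LHS]probability_setC// fineB//.
  exact: fin_num_measure.
apply: gauss_halfline => // y /=.
by rewrite in_itv /= andbT; nra.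
Qed.

Lemma Phi_le1 x : Phi x <= 1.
Proof.
rewrite /Phi -lee_fin fineK; last exact: fin_num_measure.
exact: probability_le1.
Qed.

Lemma Phi_sym_deriv x : is_derive x 1 (fun x => Phi x + Phi (- x)) 0.
Proof.
have h1 := is_derive_Phi x.
have h2 : is_derive (- x) 1 Phi (gpdf (- x)) := is_derive_Phi (- x).
have h3 : is_derive x 1 (Phi \o (-%R : R -> R)) (gpdf (- x) * - 1).
  apply: is_derive1_comp.
apply: is_derive_eq.
by rewrite /gpdf sqrrN; ring.
Qed.

Lemma Phi_sym x : Phi (- x) = 1 - Phi x.
Proof.
have c y : Phi y + Phi (- y) = Phi 0 + Phi (- 0) :> R.
  by apply: (@is_derive_0_is_cst R (fun x => Phi x + Phi (- x))) => z; exact: Phi_sym_deriv.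
have h y : 0 <= y -> `|Phi x + Phi (- x) - 1| <= expR (- y ^+ 2 / 2).
  move=> y0; rewrite c -(c y) ler_norml.
  have := Phi_tail _ y0; have := Phi_tail1 _ y0; have := Phi_le1 y.
  by have := Phi_ge0 (- y); lra.
apply/eqP; rewrite -subr_eq0 opprB addrA -normr_eq0 [Phi (- x) + _]addrC.
set r := `| _ |; rewrite -/r in h; apply: contraT => r0.
have {}r0 : 0 < r by rewrite lt_neqAle eq_sym r0 normr_ge0.
have := h (Num.sqrt (2 / r)) (sqrtr_ge0 _).
have -> : - Num.sqrt (2 / r) ^+ 2 / 2 = - r^-1.
  by rewrite sqr_sqrtr ?divr_ge0 ?ltW//; field; rewrite gt_eqF.
rewrite expRN leNgt => /negP[].
rewrite -[X in _ < X]invrK ltf_pV2 ?posrE ?expR_gt0 ?invr_gt0//.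
by rewrite (lt_le_trans _ (expR_ge1Dx _))// ltrDr.
Qed.

Lemma gpdf_near (w z : R) : 0 <= w -> `|z - w| <= (1 + w)^-1 ->
  normal_peak 1 * expR (- (3 / 2)) * expR (- w ^+ 2 / 2) <= gpdf z.
Proof.
move=> w0; set d := (1 + w)^-1 => hz.
have d0 : 0 < d by rewrite invr_gt0; lra.
have e : (1 + w) * d = 1 by rewrite divff//; lra.
rewrite /gpdf -mulrA ler_pM2l ?peak_gt0// -expRD ler_expR.
move: hz; rewrite ler_norml => /andP[h1 h2].
nra.
Qed.

Lemma Phi_incr : exists2 c : R, 0 < c & forall w d, 0 <= w -> 0 <= d -> d <= (1 + w)^-1 ->
  c * d * expR (- w ^+ 2 / 2) <= Phi (- w) - Phi (- (w + d)) /\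
  c * d * expR (- w ^+ 2 / 2) <= Phi (- (w - d)) - Phi (- w).
Proof.
exists (normal_peak 1 * expR (- (3 / 2))); first by rewrite mulr_gt0 ?peak_gt0 ?expR_gt0.
move=> w d w0 d0 dw; rewrite mulrAC; split.
  have [|c [c1 c2 ->]] := Phi_mvt (- (w + d)) (- w); first lra.
  rewrite (_ : - w - - (w + d) = d); last by ring.
  rewrite ler_wpM2r// (_ : gpdf c = gpdf (- c)); last by rewrite /gpdf sqrrN.
  by apply: gpdf_near => //; rewrite ler_norml; lra.
have [|c [c1 c2 ->]] := Phi_mvt (- w) (- (w - d)); first lra.
rewrite (_ : - (w - d) - - w = d); last by ring.
rewrite ler_wpM2r// (_ : gpdf c = gpdf (- c)); last by rewrite /gpdf sqrrN.
by apply: gpdf_near => //; rewrite ler_norml; lra.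
Qed.

Lemma Phi_lower : exists2 c : R, 0 < c & forall w, 0 <= w ->
  c * expR (- w ^+ 2 / 2) / (1 + w) <= Phi (- w).
Proof.
have [c c0 h] := Phi_incr; exists c => // w w0.
have d0 : 0 < (1 + w)^-1 by rewrite invr_gt0; lra.
have [h1 _] := h w _ w0 (ltW d0) (lexx _).
rewrite mulrAC; apply: le_trans h1 _.
by rewrite lerBlDr lerDl Phi_ge0.
Qed.

Lemma Phi_diff_upper (v w : R) : 0 <= v -> v <= w ->
  Phi (- v) - Phi (- w) <= (w - v) * (normal_peak 1 * expR (- v ^+ 2 / 2)).
Proof.
move=> v0 vw; have [|c [c1 c2 ->]] := Phi_mvt (- w) (- v); first lra.
rewrite (_ : - v - - w = w - v); last by ring.
rewrite mulrC ler_wpM2l; [by []|lra|].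
by rewrite /gpdf ler_pM2l ?peak_gt0// ler_expR; nra.
Qed.

End gauss.

Section taylor.
Context {R : realType}.

Lemma mvt_abs (f df : R -> R) (a h B : R) :
  (forall x, `|x - a| <= `|h| -> is_derive x 1 f (df x)) ->
  (forall x, `|x - a| <= `|h| -> `|df x| <= B) -> `|f (a + h) - f a| <= B * `|h|.
Proof.
move=> hd hB; have [h0|/ltW h0] := leP 0 h.
  have [|x x1 x2|c [c1 c2 ->]] := @mvt_le R f df a (a + h); first lra.
    by apply: hd; rewrite (ger0_norm h0) ler_norml; lra.
  rewrite normrM (_ : a + h - a = h); last by ring.
  by rewrite ler_wpM2r// hB// (ger0_norm h0) ler_norml; lra.
have [|x x1 x2|c [c1 c2]] := @mvt_le R f df (a + h) a; first lra.
  by apply: hd; rewrite (ler0_norm h0) ler_norml; lra.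
rewrite distrC => ->.
rewrite normrM (_ : a - (a + h) = - h) ?normrN; last by ring.
by rewrite ler_wpM2r// hB// (ler0_norm h0) ler_norml; lra.
Qed.

Lemma taylor3 (f f1 f2 f3 : R -> R) (a h B : R) :
  (forall x : R, is_derive x 1 f (f1 x)) -> (forall x : R, is_derive x 1 f1 (f2 x)) ->
  (forall x : R, is_derive x 1 f2 (f3 x)) ->
  (forall x, `|x - a| <= `|h| -> `|f3 x| <= B) ->
  `|f (a + h) - f a - f1 a * h - f2 a * h ^+ 2 / 2| <= B * `|h| ^+ 3.
Proof.
move=> d1 d2 d3 hB.
have B0 : 0 <= B.
  by apply: le_trans (hB a _); rewrite ?normr_ge0// subrr normr0.
have b2 x : `|x| <= `|h| -> `|f2 (a + x) - f2 a| <= B * `|h|.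
  move=> xh; apply: le_trans (_ : B * `|x| <= _); last exact: ler_wpM2l.
  by apply: (mvt_abs _ f3 _ _ _ (fun y _ => d3 y)) => y yx; apply: hB; apply: le_trans yx xh.
have b1 x : `|x| <= `|h| -> `|f1 (a + x) - f1 a - f2 a * x| <= B * `|h| ^+ 2.
  move=> xh; pose g y := f1 (a + y) - f2 a * y.
  have -> : f1 (a + x) - f1 a - f2 a * x = g (0 + x) - g 0.
    by rewrite /g add0r addr0 mulr0; ring.
  apply: le_trans (_ : (B * `|h|) * `|x| <= _); last first.
    by rewrite expr2 mulrA; apply: ler_wpM2l => //; exact: mulr_ge0.
  have dg (y : R) : is_derive y 1 g (f2 (a + y) - f2 a).
    have h1 : is_derive (a + y) 1 f1 (f2 (a + y)) := d2 _.
    have h2 : is_derive y 1 (f1 \o (fun y => a + y)) (f2 (a + y) * (0 + 1)).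
      exact: is_derive1_comp.
    apply: is_derive_eq; rewrite /GRing.scale /=.
    by ring.
  apply: (mvt_abs _ (fun y => f2 (a + y) - f2 a) _ _ _ (fun y _ => dg y)) => y yx.
  by apply: b2; rewrite subr0 in yx; apply: le_trans yx xh.
pose g y := f (a + y) - f1 a * y - f2 a * y ^+ 2 / 2.
have -> : f (a + h) - f a - f1 a * h - f2 a * h ^+ 2 / 2 = g (0 + h) - g 0.
  by rewrite /g add0r addr0 mulr0 expr0n/= mulr0; ring.
rewrite exprSr mulrA.
have dg (y : R) : is_derive y 1 g (f1 (a + y) - f1 a - f2 a * y).
  have h1 : is_derive (a + y) 1 f (f1 (a + y)) := d1 _.
  have h2 : is_derive y 1 (f \o (fun y => a + y)) (f1 (a + y) * (0 + 1)).
    exact: is_derive1_comp.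
  apply: is_derive_eq; rewrite /GRing.scale /=.
  by field.
apply: (mvt_abs _ (fun y => f1 (a + y) - f1 a - f2 a * y) _ _ _ (fun y _ => dg y)) => y yx.
by apply: b1; rewrite subr0 in yx.
Qed.

End taylor.

(** * The heat flow *)

Section heat.
Context {R : realType}.
Implicit Types s y v h : R.

(* [f1], [f2], [f3] are space derivatives of [f] and [f4] is the second space
   derivative of [f2]; the last two conditions are the heat equation for [f] and [f2]. *)
Definition heat_family (f f1 f2 f3 f4 : R -> R -> R) :=
  [/\ forall s y, 0 < s -> is_derive y (1 : R) (f s) (f1 s y),
      forall s y, 0 < s -> is_derive y (1 : R) (f1 s) (f2 s y),
      forall s y, 0 < s -> is_derive y (1 : R) (f2 s) (f3 s y),
      forall s y, 0 < s -> is_derive s (1 : R) (f ^~ y) (f2 s y / 2) &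
      forall s y, 0 < s -> is_derive s (1 : R) (f2 ^~ y) (f4 s y / 2)].

Lemma heat_onestep f f1 f2 f3 f4 s y v h (B3 B4 : R) : heat_family f f1 f2 f3 f4 ->
  0 <= v -> 0 < s - v ->
  (forall z, `|z - y| <= `|h| -> `|f3 s z| <= B3) ->
  (forall s', s - v <= s' -> s' <= s -> `|f4 s' (y + h)| <= B4) ->
  `|f (s - v) (y + h) - f s y - f1 s y * h - f2 s y * (h ^+ 2 - v) / 2|
    <= B3 * (`|h| ^+ 3 + v * `|h|) + B4 * v ^+ 2.
Proof.
move=> [d1 d2 d3 e1 e2] v0 sv0 h3 h4.
have s0 : 0 < s by lra.
have t1 := taylor3 (f s) (f1 s) (f2 s) (f3 s) y h B3 (fun x => d1 s x s0)
  (fun x => d2 s x s0) (fun x => d3 s x s0) h3.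
have t2 := mvt_abs (f2 s) (f3 s) y h B3 (fun x _ => d3 s x s0) h3.
have [|x x1 _|c [c1 c2 ec]] := mvt_le (f ^~ (y + h)) (fun s => f2 s (y + h) / 2) (s - v) s.
- by lra.
- by apply: e1; lra.
have [x x1 _|b [b1 b2 eb]] := mvt_le (f2 ^~ (y + h)) (fun s => f4 s (y + h) / 2) c s c2.
  by apply: e2; lra.
have B40 : 0 <= B4 by apply: le_trans (h4 s _ (lexx _)); rewrite ?normr_ge0//; lra.
have t3 : `|f2 s (y + h) - f2 c (y + h)| <= B4 * v.
  rewrite eb; apply: (@le_trans _ _ (B4 / 2 * (s - c))).
    rewrite normrM (ger0_norm (_ : 0 <= s - c)); last by lra.
    rewrite ler_wpM2r//; first by lra.
    rewrite normrM (ger0_norm (_ : 0 <= 2^-1)); last by lra.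
    by rewrite ler_wpM2r//; apply: h4; lra.
  by nra.
have -> : f (s - v) (y + h) - f s y - f1 s y * h - f2 s y * (h ^+ 2 - v) / 2 =
  (f s (y + h) - f s y - f1 s y * h - f2 s y * h ^+ 2 / 2) +
  v / 2 * ((f2 s (y + h) - f2 c (y + h)) - (f2 s (y + h) - f2 s y)).
  have : f (s - v) (y + h) = f s (y + h) - f2 c (y + h) / 2 * v.
    by move: ec; rewrite /= (_ : s - (s - v) = v); [lra|ring].
  by move=> ->; field.
apply: le_trans (ler_normD _ _) _.
have t4 : `|v / 2 * (f2 s (y + h) - f2 c (y + h) - (f2 s (y + h) - f2 s y))| <=
    v / 2 * (B4 * v + B3 * `|h|).
  rewrite normrM (ger0_norm (_ : 0 <= v / 2)); last by lra.
  rewrite ler_wpM2l//; first by lra.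
  by apply: le_trans (ler_normB _ _) _; exact: lerD.
have B30 : 0 <= B3 by apply: le_trans (h3 y _); rewrite ?normr_ge0// subrr normr0.
have := mulr_ge0 (mulr_ge0 B30 (normr_ge0 h)) v0.
have := mulr_ge0 (mulr_ge0 B40 v0) v0.
have := lerD t1 t4.
move: (`|_| + _) => X; nra.
Qed.

Definition gk s y : R := normal_peak 1 * (Num.sqrt s)^-1 * expR (- y ^+ 2 / (2 * s)).
Definition gk1 s y : R := - (y / s) * gk s y.
Definition gk2 s y : R := (y ^+ 2 / s ^+ 2 - s^-1) * gk s y.
Definition gk3 s y : R := (3 * y / s ^+ 2 - y ^+ 3 / s ^+ 3) * gk s y.
Definition gk4 s y : R := (y ^+ 4 / s ^+ 4 - 6 * y ^+ 2 / s ^+ 3 + 3 / s ^+ 2) * gk s y.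
Definition gPhi s y : R := Phi (y / Num.sqrt s).

Lemma gkE s y : 0 < s -> gk s y = gpdf (y / Num.sqrt s) / Num.sqrt s.
Proof.
move=> s0; rewrite /gk /gpdf mulrAC; congr (_ * expR _ * _).
rewrite exprMn exprVn sqr_sqrtr ?ltW//; field; lra.
Qed.

Lemma gk_gt0 s y : 0 < s -> 0 < gk s y.
Proof. by move=> s0; rewrite gkE// divr_gt0 ?gpdf_gt0 ?sqrtr_gt0. Qed.

Lemma gk_dy s y : 0 < s -> is_derive y (1 : R) (gk s) (gk1 s y).
Proof.
move=> s0; rewrite /gk.
have h1 : is_derive y (1 : R) (fun y => - y ^+ 2 / (2 * s)) (- (y / s)).
  apply: is_derive_eq; rewrite /GRing.scale /=; field; lra.
apply: is_derive_eq; rewrite /gk1 /gk /GRing.scale /=; ring.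
Qed.

Lemma gk1_dy s y : 0 < s -> is_derive y (1 : R) (gk1 s) (gk2 s y).
Proof.
move=> s0; rewrite /gk1; have := gk_dy s y s0 => h.
apply: is_derive_eq; rewrite /gk2 /gk1 /GRing.scale /=; field; lra.
Qed.

Lemma gk2_dy s y : 0 < s -> is_derive y (1 : R) (gk2 s) (gk3 s y).
Proof.
move=> s0; rewrite /gk2; have := gk_dy s y s0 => h.
apply: is_derive_eq; rewrite /gk3 /gk1 /GRing.scale /=; field; lra.
Qed.

Lemma gk_ds s y : 0 < s -> is_derive s (1 : R) (gk ^~ y) (gk2 s y / 2).
Proof.
move=> s0; rewrite /gk.
have hs := @is_derive1_sqrt R s s0.
have q0 : 0 < Num.sqrt s by rewrite sqrtr_gt0.
have hm : is_derive s (1 : R) (fun s => 2 * s) 2.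
  by apply: is_derive_eq; rewrite /GRing.scale /=; ring.
have hV : is_derive s (1 : R) (fun s => (2 * s)^-1) (- (2 * s) ^- 2 *: 2).
  by apply: is_deriveV; rewrite mulf_neq0// gt_eqF.
have hW : is_derive s (1 : R) (fun s => (Num.sqrt s)^-1)
    (- (Num.sqrt s) ^- 2 *: (2 * Num.sqrt s)^-1).
  by apply: is_deriveV; rewrite gt_eqF.
have h1 : is_derive s (1 : R) (fun s => - y ^+ 2 / (2 * s)) (y ^+ 2 / (2 * s ^+ 2)).
  by apply: is_derive_eq; rewrite /GRing.scale /=; field; lra.
apply: is_derive_eq.
rewrite /gk2 /gk /GRing.scale /= (_ : Num.sqrt s ^- 2 = s^-1); last by rewrite sqr_sqrtr ?ltW.
by field; rewrite !gt_eqF.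
Qed.

Lemma gk1_ds s y : 0 < s -> is_derive s (1 : R) (gk1 ^~ y) (gk3 s y / 2).
Proof.
move=> s0; rewrite /gk1; have h := gk_ds s y s0.
have hV : is_derive s (1 : R) (fun s => s^-1) (- s ^- 2 *: 1).
  by apply: is_deriveV; rewrite gt_eqF.
apply: is_derive_eq.
by rewrite /gk3 /gk2 /GRing.scale /=; field; rewrite gt_eqF.
Qed.

Lemma gk2_ds s y : 0 < s -> is_derive s (1 : R) (gk2 ^~ y) (gk4 s y / 2).
Proof.
move=> s0; rewrite /gk2; have h := gk_ds s y s0.
have hV : is_derive s (1 : R) (fun s => s^-1) (- s ^- 2 *: 1).
  by apply: is_deriveV; rewrite gt_eqF.
have hW : is_derive s (1 : R) (fun s => (s ^+ 2)^-1) (- (s ^+ 2) ^- 2 *: (2 * s)).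
  have hq : is_derive s (1 : R) (fun s => s ^+ 2) (2 * s).
    by apply: is_derive_eq; rewrite /GRing.scale /=; ring.
  by apply: is_deriveV; rewrite gt_eqF// exprn_gt0.
apply: is_derive_eq.
by rewrite /gk4 /gk2 /GRing.scale /=; field; rewrite gt_eqF.
Qed.

Lemma gPhi_dy s y : 0 < s -> is_derive y (1 : R) (gPhi s) (gk s y).
Proof.
move=> s0; rewrite /gPhi.
have h := is_derive_Phi (y / Num.sqrt s).
have h2 : is_derive y (1 : R) (fun y => y / Num.sqrt s) (Num.sqrt s)^-1.
  by apply: is_derive_eq; rewrite /GRing.scale /=; ring.
have h3 : is_derive y (1 : R) (Phi \o (fun y => y / Num.sqrt s))
  (gpdf (y / Num.sqrt s) * (Num.sqrt s)^-1) by exact: is_derive1_comp.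
by rewrite gkE.
Qed.

Lemma gPhi_ds s y : 0 < s -> is_derive s (1 : R) (gPhi ^~ y) (gk1 s y / 2).
Proof.
move=> s0; rewrite /gPhi.
have h := is_derive_Phi (y / Num.sqrt s).
have hs := @is_derive1_sqrt R s s0.
have q0 : 0 < Num.sqrt s by rewrite sqrtr_gt0.
have hW : is_derive s (1 : R) (fun s => (Num.sqrt s)^-1)
    (- (Num.sqrt s) ^- 2 *: (2 * Num.sqrt s)^-1).
  by apply: is_deriveV; rewrite gt_eqF.
have h2 : is_derive s (1 : R) (fun s => y / Num.sqrt s) (- (y / (2 * s * Num.sqrt s))).
  apply: is_derive_eq; rewrite /GRing.scale /= (_ : Num.sqrt s ^- 2 = s^-1); last by rewrite sqr_sqrtr ?ltW.
  by field; rewrite !gt_eqF.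
have h3 : is_derive s (1 : R) (Phi \o (fun s => y / Num.sqrt s))
  (gpdf (y / Num.sqrt s) * (- (y / (2 * s * Num.sqrt s)))) by exact: is_derive1_comp.
apply: is_derive_eq.
by rewrite /gk1 gkE//; field; rewrite !gt_eqF.
Qed.

Lemma heat_gPhi : heat_family gPhi gk gk1 gk2 gk3.
Proof.
split=> s y s0; [exact: gPhi_dy|exact: gk_dy|exact: gk1_dy|exact: gPhi_ds|exact: gk1_ds].
Qed.

Lemma heat_gk : heat_family gk gk1 gk2 gk3 gk4.
Proof.
split=> s y s0; [exact: gk_dy|exact: gk1_dy|exact: gk2_dy|exact: gk_ds|exact: gk2_ds].
Qed.

End heat.

Section tilt.
Context {R : realType}.
Implicit Types s y v h : R.

Lemma peak_le1 : normal_peak 1 <= 1 :> R.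
Proof.
have p2 := @pi_ge2 R; rewrite /normal_peak expr1n mul1r -mulr_natr; set p := pi in p2 *.
have h : 1 <= Num.sqrt (p * 2) by rewrite -[X in X <= _]sqrtr1 ler_sqrt; lra.
by rewrite invr_le1 ?unitfE ?gt_eqF//; lra.
Qed.

(* Completing the square: [- y^2 / (2 s) = lam y + lam^2 s / 2 - (y + lam s)^2 / (2 s)]. *)
Lemma gk_tilt (P : R -> R) (j : nat) (lam s y : R) : (j <= 4)%N -> 0 <= lam -> 0 < s ->
  (forall u, `|P u| <= 10 * (1 + `|u|) ^+ j) ->
  `|P (y / Num.sqrt s) * (Num.sqrt s)^-1 ^+ j * gk s y| <=
  10 * expR 18 * ((Num.sqrt s)^-1 * ((Num.sqrt s)^-1 + lam) ^+ j) *
    expR (lam * y + lam ^+ 2 * s / 2) * expR (- (2 * (`|y + lam * s| / Num.sqrt s))).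
Proof.
move=> j4 l0 s0 hP.
have r0 : 0 < Num.sqrt s by rewrite sqrtr_gt0.
have es : s = Num.sqrt s ^+ 2 by rewrite sqr_sqrtr ?ltW.
rewrite /gk; set r := Num.sqrt s in r0 es *.
set u := y / r; set w := (y + lam * s) / r.
have ew : w = u + lam * r by rewrite /w /u es; field; rewrite gt_eqF.
have -> : `|y + lam * s| / r = `|w| by rewrite /w normrM [`|r^-1|]ger0_norm// invr_ge0 ltW.
have -> : expR (- y ^+ 2 / (2 * s)) = expR (lam * y + lam ^+ 2 * s / 2) * expR (- (w ^+ 2 / 2)).
  rewrite -expRD; congr expR; rewrite ew /u es; field; rewrite gt_eqF//.
clearbody u w.
have lr0 : 0 <= lam * r by rewrite mulr_ge0// ltW.
have lr1 : 0 <= 1 + lam * r by lra.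
have hu : 1 + `|u| <= (1 + `|w|) * (1 + lam * r).
  have : `|u| <= `|w| + lam * r.
    have -> : u = w - lam * r by rewrite ew; ring.
    apply: le_trans (ler_normB _ _) _.
    by rewrite [`|lam * r|]ger0_norm.
  have : 0 <= `|w| * (lam * r) by rewrite mulr_ge0.
  nra.
have h1 : `|P u| <= 10 * (expR `|w| ^+ j * (1 + lam * r) ^+ j).
  apply: le_trans (hP u) _; rewrite ler_pM2l// -exprMn.
  rewrite lerXn2r// ?nnegrE ?addr_ge0// ?mulr_ge0 ?expR_ge0//.
  by apply: le_trans hu _; rewrite ler_wpM2r ?expR_ge1Dx.
have h2 : expR `|w| ^+ j * expR (- (w ^+ 2 / 2)) <= expR 18 * expR (- (2 * `|w|)).
  have : expR `|w| ^+ j <= expR (4 * `|w|).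
    rewrite -expRM_natl mulr_natl ler_expR -mulr_natl ler_wpM2r//.
    by rewrite ler_nat.
  rewrite -(@ler_pM2r _ (expR (- (w ^+ 2 / 2)))) ?expR_gt0// => h; apply: le_trans h _.
  rewrite -!expRD ler_expR -(real_normK (num_real w)).
  by have := sqr_ge0 (`|w| - 6); nra.
rewrite !normrM [`|expR _|]ger0_norm ?expR_ge0// [`|expR _|]ger0_norm ?expR_ge0//.
rewrite [`|normal_peak _|]ger0_norm; last exact: normal_peak_ge0.
rewrite normrX [`|r^-1|]ger0_norm; last by rewrite invr_ge0 ltW.
set E := expR (lam * y + _).
have E0 : 0 < E by rewrite expR_gt0.
have q0 : 0 < r^-1 by rewrite invr_gt0.
have -> : r^-1 + lam = r^-1 * (1 + lam * r) by field; rewrite gt_eqF.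
rewrite exprMn.
set Q := (1 + lam * r) ^+ j in h1 *.
have Q0 : 0 <= Q by rewrite exprn_ge0.
have qj : 0 < r^-1 ^+ j by rewrite exprn_gt0.
apply: le_trans (_ : `|P u| * (r^-1 ^+ j * (r^-1 * E * expR (- (w ^+ 2 / 2)))) <= _).
  rewrite -mulrA ler_wpM2l// ler_pM2l//.
  rewrite !mulrA ler_wpM2r ?expR_ge0// ler_wpM2r ?expR_ge0//.
  by rewrite ger_pMl// peak_le1.
apply: le_trans (ler_wpM2r _ h1) _.
  by rewrite !mulr_ge0 ?expR_ge0// ltW.
have -> : 10 * (expR `|w| ^+ j * Q) * (r^-1 ^+ j * (r^-1 * E * expR (- (w ^+ 2 / 2)))) =
  (10 * Q * r^-1 ^+ j * r^-1 * E) * (expR `|w| ^+ j * expR (- (w ^+ 2 / 2))) by ring.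
apply: le_trans (ler_wpM2l _ h2) _.
  by rewrite !mulr_ge0// ?expR_ge0// ltW.
rewrite le_eqVlt; apply/orP; left; apply/eqP; ring.
Qed.

Definition kap (lam t y : R) : R :=
  expR (lam * y + lam ^+ 2 * t / 2) * expR (- (`|y + lam * t| / Num.sqrt t)).

Definition bet (lam t : R) : R := (Num.sqrt t)^-1 + lam.

Lemma kap_ge0 lam t y : 0 <= kap lam t y.
Proof. by rewrite mulr_ge0 ?expR_ge0. Qed.

Lemma gk_loc (P : R -> R) (j : nat) (B : R) : (j <= 4)%N -> 0 <= B ->
  (forall u, `|P u| <= 10 * (1 + `|u|) ^+ j) ->
  exists2 C, 0 < C & forall lam s t y b : R, 0 <= lam -> lam <= 1 ->
    1 <= t -> 2 * B <= t -> `|s - t| <= B ->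
  `|P ((y + b) / Num.sqrt s) * (Num.sqrt s)^-1 ^+ j * gk s (y + b)| <=
  C * ((Num.sqrt t)^-1 * bet lam t ^+ j) * kap lam t y * expR (bet lam t * `|b|).
Proof.
move=> j4 B0 hP; exists (10 * expR 18 * (2 * 2 ^+ j) * expR (B / 2) * expR B).
  by rewrite !mulr_gt0 ?expR_gt0// exprn_gt0.
move=> lam s t y b l0 l1 t1 tB hst.
have s0 : 0 < s by move: hst; rewrite ler_norml; lra.
apply: le_trans (gk_tilt _ _ _ _ _ j4 l0 s0 hP) _.
have r0 : 0 < Num.sqrt s by rewrite sqrtr_gt0.
have q0 : 0 < Num.sqrt t by rewrite sqrtr_gt0; lra.
have hr : Num.sqrt s <= 2 * Num.sqrt t.
  rewrite -[2](ger0_norm (_ : 0 <= 2))// -sqrtr_sqr -sqrtrM ?sqr_ge0// ler_sqrt.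
    by move: hst; rewrite ler_norml; lra.
  by rewrite mulr_ge0 ?sqr_ge0//; lra.
have hr2 : Num.sqrt t <= 2 * Num.sqrt s.
  rewrite -[2](ger0_norm (_ : 0 <= 2))// -sqrtr_sqr -sqrtrM ?sqr_ge0// ler_sqrt.
    by move: hst; rewrite ler_norml; lra.
  by rewrite mulr_ge0 ?sqr_ge0//; lra.
have q1 : 1 <= Num.sqrt t by rewrite -[X in X <= _]sqrtr1 ler_sqrt; lra.
set r := Num.sqrt s in r0 hr hr2 *; rewrite /kap /bet; set q := Num.sqrt t in q0 q1 hr hr2 *.
have i1 : r^-1 <= 2 * q^-1.
  by rewrite -[2]invrK -invfM lef_pV2 ?posrE//; [lra|apply: mulr_gt0; lra].
have i2 : (r^-1 + lam) ^+ j <= 2 ^+ j * (q^-1 + lam) ^+ j.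
  have := invr_gt0 r; have := invr_gt0 q; rewrite r0 q0 => x1 x2.
  rewrite -exprMn lerXn2r ?nnegrE//; nra.
have i3 : expR (lam * (y + b) + lam ^+ 2 * s / 2) <=
    expR (B / 2) * expR (lam * y + lam ^+ 2 * t / 2) * expR (lam * `|b|).
  rewrite -!expRD ler_expR.
  have : lam * b <= lam * `|b| by rewrite ler_wpM2l// ler_norm.
  have : lam ^+ 2 * (s - t) <= B.
    have l2 : lam ^+ 2 <= 1 by rewrite expr_le1.
    move: hst; rewrite ler_norml => /andP[h1 h2].
    have : 0 <= lam ^+ 2 by rewrite sqr_ge0.
    by nra.
  lra.
have i4 : expR (- (2 * (`|y + b + lam * s| / r))) <=
    expR B * expR (- (`|y + lam * t| / q)) * expR (q^-1 * `|b|).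
  rewrite -!expRD ler_expR.
  have h1 : `|y + b + lam * s| / q <= 2 * (`|y + b + lam * s| / r).
    rewrite mulrCA ler_wpM2l//.
    by rewrite -[leLHS]mul1r ler_pdivrMr// mulrAC ler_pdivlMr// mul1r.
  have h2 : `|y + lam * t| <= `|y + b + lam * s| + `|b| + B.
    have -> : y + lam * t = (y + b + lam * s) - b - lam * (s - t) by ring.
    apply: le_trans (ler_normB _ _) _; apply: lerD; first exact: ler_normB.
    by rewrite normrM (ger0_norm l0); have := normr_ge0 (s - t); nra.
  have h3 : `|y + lam * t| / q <= (`|y + b + lam * s| + `|b| + B) / q.
    by rewrite ler_wpM2r// invr_ge0 ltW.
  have h4 : B / q <= B by rewrite ler_pdivrMr// ler_peMr.
  move: h3; rewrite !mulrDl [q^-1 * _]mulrC; lra.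
set b1 := expR (- (2 * _)) in i4 *; set b2 := expR (lam * (y + b) + _) in i3 *.
have -> : 10 * expR 18 * (2 * 2 ^+ j) * expR (B / 2) * expR B * (q^-1 * (q^-1 + lam) ^+ j) *
  (expR (lam * y + lam ^+ 2 * t / 2) * expR (- (`|y + lam * t| / q))) *
  expR ((q^-1 + lam) * `|b|) =
  10 * expR 18 * ((2 * q^-1) * (2 ^+ j * (q^-1 + lam) ^+ j)) *
  (expR (B / 2) * expR (lam * y + lam ^+ 2 * t / 2) * expR (lam * `|b|)) *
  (expR B * expR (- (`|y + lam * t| / q)) * expR (q^-1 * `|b|)).
  by rewrite (mulrDl q^-1 lam `|b|) (expRD (q^-1 * _)); ring.
have r'0 : 0 <= r^-1 by rewrite invr_ge0 ltW.
apply: ler_pM => //; rewrite ?expR_ge0//.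
  by rewrite !mulr_ge0 ?expR_ge0// exprn_ge0 ?addr_ge0.
apply: ler_pM => //; rewrite ?expR_ge0//.
  by rewrite !mulr_ge0 ?expR_ge0// exprn_ge0 ?addr_ge0.
rewrite ler_pM2l ?mulr_gt0 ?expR_gt0//.
by apply: ler_pM => //; rewrite exprn_ge0 ?addr_ge0.
Qed.

Definition loc_bound (B : R) (j : nat) (C : R) (g : R -> R -> R) :=
  forall lam s t y b : R, 0 <= lam -> lam <= 1 -> 1 <= t -> 2 * B <= t -> `|s - t| <= B ->
    `|g s (y + b)| <=
      C * ((Num.sqrt t)^-1 * bet lam t ^+ j) * kap lam t y * expR (bet lam t * `|b|).

Lemma loc_poly (B : R) (P : R -> R) (j : nat) (g : R -> R -> R) : (j <= 4)%N -> 0 <= B ->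
  (forall u, `|P u| <= 10 * (1 + `|u|) ^+ j) ->
  (forall s y, 0 < s -> g s y = P (y / Num.sqrt s) * (Num.sqrt s)^-1 ^+ j * gk s y) ->
  exists2 C, 0 < C & loc_bound B j C g.
Proof.
move=> j4 B0 hP hg; have [C C0 hC] := gk_loc P j B j4 B0 hP.
exists C => // lam s t y b l0 l1 t1 tB st; rewrite hg; first exact: hC.
by move: st; rewrite ler_norml; lra.
Qed.

Lemma loc_gk2 (B : R) : 0 <= B -> exists2 C, 0 < C & loc_bound B 2 C gk2.
Proof.
move=> B0; apply: (loc_poly B (fun u => u ^+ 2 - 1)) => // [u|s y s0].
  rewrite ler_norml; have := normr_ge0 u; rewrite -(real_normK (num_real u)).
  by move: `|u| => a a0; apply/andP; split; nra.
rewrite /gk2; congr (_ * _); rewrite -{1 2}(sqr_sqrtr (ltW s0)).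
by field; rewrite gt_eqF ?sqrtr_gt0.
Qed.

Lemma loc_gk3 (B : R) : 0 <= B -> exists2 C, 0 < C & loc_bound B 3 C gk3.
Proof.
move=> B0; apply: (loc_poly B (fun u => 3 * u - u ^+ 3)) => // [u|s y s0].
  apply: le_trans (ler_normB _ _) _; rewrite normrM normrX ger0_norm//.
  by have := normr_ge0 u; move: `|u| => a a0; nra.
rewrite /gk3; congr (_ * _); rewrite -{1 2}(sqr_sqrtr (ltW s0)).
by field; rewrite gt_eqF ?sqrtr_gt0.
Qed.

Lemma loc_gk4 (B : R) : 0 <= B -> exists2 C, 0 < C & loc_bound B 4 C gk4.
Proof.
move=> B0; apply: (loc_poly B (fun u => u ^+ 4 - 6 * u ^+ 2 + 3)) => // [u|s y s0].
  apply: le_trans (ler_normD _ _) _; rewrite [`|3|]ger0_norm//.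
  have := ler_normB (u ^+ 4) (6 * u ^+ 2); rewrite [`|6 * _|]normrM !normrX (ger0_norm (_ : 0 <= 6))//.
  have := normr_ge0 u; move: `|u| => a a0 h.
  have -> : 10 * (1 + a) ^+ 4 = 10 + 40 * a + 60 * a ^+ 2 + 40 * a ^+ 3 + 10 * a ^+ 4 by ring.
  have := exprn_ge0 3 a0; have := exprn_ge0 4 a0; have := exprn_ge0 2 a0; lra.
rewrite /gk4; congr (_ * _); rewrite -{1 2 3}(sqr_sqrtr (ltW s0)).
by field; rewrite gt_eqF ?sqrtr_gt0.
Qed.

Lemma heat_step f f1 f2 f3 f4 (j : nat) (K B Bv C3 C4 : R) :
  0 < K -> 0 <= Bv -> 0 < C3 -> 0 < C4 ->
  heat_family f f1 f2 f3 f4 -> loc_bound B j C3 f3 -> loc_bound B j.+1 C4 f4 ->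
  exists2 C, 0 < C & forall lam s t y v h : R, 0 <= lam -> bet lam t <= 1 ->
    bet lam t <= K / 2 -> 1 <= t -> 2 * B <= t -> `|s - t| <= B -> `|s - v - t| <= B ->
    0 <= v -> v <= Bv ->
  `|f (s - v) (y + h) - f s y - f1 s y * h - f2 s y * (h ^+ 2 - v) / 2| <=
  C * ((Num.sqrt t)^-1 * bet lam t ^+ j) * kap lam t y * (v + `|h| ^+ 3 * expR (K * `|h|)).
Proof.
move=> K0 Bv0 C30 C40 hf l3 l4.
exists ((C3 + C4) * ((1 + expR (K / 2)) * (1 + Bv + Bv ^+ 2))).
  have := sqr_ge0 Bv; have := @expR_gt0 R (K / 2) => e1 e2.
  by apply: mulr_gt0; [lra|apply: mulr_gt0; lra].
move=> lam s t y v h l0 b1 bK t1 tB st svt v0 vB.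
have q0 : 0 < (Num.sqrt t)^-1 by rewrite invr_gt0 sqrtr_gt0; lra.
have be0 : 0 <= bet lam t by rewrite addr_ge0// ltW.
have l1 : lam <= 1 by move: b1; rewrite /bet; lra.
have sv0 : 0 < s - v by move: svt; rewrite ler_norml; lra.
set A := (Num.sqrt t)^-1 * bet lam t ^+ j.
have A0 : 0 <= A by rewrite mulr_ge0 ?(ltW q0) ?exprn_ge0.
set k := kap lam t y; have k0 : 0 <= k by exact: kap_ge0.
have Ak0 : 0 <= A * k := mulr_ge0 A0 k0.
have CAk0 C : 0 < C -> 0 <= C * A * k by move=> C0; rewrite -mulrA (mulr_ge0 (ltW C0) Ak0).
have eh : expR (bet lam t * `|h|) <= expR (K / 2 * `|h|).
  by rewrite ler_expR ler_wpM2r.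
have H := heat_onestep f f1 f2 f3 f4 s y v h (C3 * A * k * expR (K / 2 * `|h|))
  (C4 * A * k * expR (K / 2 * `|h|)) hf v0 sv0.
apply: le_trans (H _ _) _.
- move=> z zy; have -> : z = y + (z - y) by ring.
  apply: le_trans (l3 lam s t y (z - y) l0 l1 t1 tB st) _.
  rewrite -/A -/k; apply: ler_wpM2l; first exact: CAk0.
  apply: le_trans _ eh; rewrite ler_expR ler_wpM2l//.
- move=> s' s1 s2.
  have st' : `|s' - t| <= B by move: st svt; rewrite !ler_norml; lra.
  apply: le_trans (l4 lam s' t y h l0 l1 t1 tB st') _.
  rewrite -/k; apply: ler_pM => //; rewrite ?expR_ge0 ?mulr_ge0 ?exprn_ge0 ?(ltW C40) ?(ltW q0)//.
  rewrite ler_wpM2r// ler_wpM2l ?(ltW C40)// ler_wpM2l ?(ltW q0)//.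
  by rewrite exprS ler_piMl ?exprn_ge0.
set a := `|h|; have a0 : 0 <= a by exact: normr_ge0.
set E := expR (K / 2 * a); set X := a ^+ 3 * expR (K * a); set e := expR (K / 2).
have E0 : 0 < E by exact: expR_gt0.
have e0 : 0 < e by exact: expR_gt0.
have E1 : 1 <= E by rewrite -expR0 ler_expR mulr_ge0// ; lra.
have EE : expR (K * a) = E ^+ 2 by rewrite /E expr2 -expRD; congr expR; field.
have X0 : 0 <= X by rewrite mulr_ge0 ?expR_ge0 ?exprn_ge0.
have h3 : E * a ^+ 3 <= X.
  by rewrite /X EE mulrC ler_wpM2l ?exprn_ge0//; nra.
have h1 : E * a <= e + X.
  have [a1|/ltW a1] := leP a 1.
    have : E <= e by rewrite ler_expR; nra.
    nra.
  apply: le_trans (_ : X <= _); last by lra.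
  apply: le_trans h3; rewrite ler_pM2l// exprS ler_peMr//.
  by rewrite expr_ge1.
have h0 : E <= e + X.
  have [a1|/ltW a1] := leP a 1.
    have : E <= e by rewrite ler_expR; nra.
    nra.
  apply: le_trans (_ : X <= _); last by lra.
  apply: le_trans h3; rewrite ler_peMr ?(ltW E0)//.
  by rewrite expr_ge1.
clear H eh l3 l4 hf st svt sv0 b1 bK l1 CAk0 A0; clearbody E X e a A k.
have -> : C3 * A * k * E * (a ^+ 3 + v * a) + C4 * A * k * E * v ^+ 2 =
  (A * k) * (C3 * (E * a ^+ 3 + v * (E * a)) + C4 * (v ^+ 2 * E)) by ring.
have -> : (C3 + C4) * ((1 + e) * (1 + Bv + Bv ^+ 2)) * A * k * (v + X) =
  (A * k) * ((C3 + C4) * ((1 + e) * (1 + Bv + Bv ^+ 2) * (v + X))) by ring.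
apply: ler_wpM2l => //.
have m1 : E * a ^+ 3 + v * (E * a) <= (1 + e) * (1 + Bv + Bv ^+ 2) * (v + X).
  apply: le_trans (_ : X + v * (e + X) <= _); first by apply: lerD => //; exact: ler_wpM2l.
  apply: le_trans (_ : (1 + e) * (1 + Bv) * (v + X) <= _).
    have := mulr_ge0 (ltW e0) X0; have := mulr_ge0 (ltW e0) (mulr_ge0 Bv0 X0).
    have := mulr_ge0 (mulr_ge0 (ltW e0) Bv0) v0; have := ler_wpM2r X0 vB.
    have := mulr_ge0 Bv0 v0; nra.
  rewrite ler_wpM2r ?addr_ge0// ler_wpM2l//; first lra.
  by rewrite lerDl sqr_ge0.
have m2 : v ^+ 2 * E <= (1 + e) * (1 + Bv + Bv ^+ 2) * (v + X).
  apply: le_trans (_ : v ^+ 2 * (e + X) <= _); first by apply: ler_wpM2l => //; exact: sqr_ge0.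
  apply: le_trans (_ : (1 + e) * ((Bv + Bv ^+ 2) * (v + X)) <= _).
    have n1 : v ^+ 2 <= Bv * v by rewrite expr2 ler_wpM2r.
    have n2 : v ^+ 2 <= Bv ^+ 2 by rewrite lerXn2r ?nnegrE.
    have n3 : v ^+ 2 * e <= Bv * v * e by rewrite ler_wpM2r// ltW.
    have n4 : v ^+ 2 * X <= Bv ^+ 2 * X by rewrite ler_wpM2r.
    have p1 := mulr_ge0 Bv0 v0; have p2 := mulr_ge0 Bv0 X0.
    have p3 := mulr_ge0 (sqr_ge0 Bv) v0; have p4 := mulr_ge0 (sqr_ge0 Bv) X0.
    have p5 := mulr_ge0 (ltW e0) p1; have p6 := mulr_ge0 (ltW e0) p2.
    have p7 := mulr_ge0 (ltW e0) p3; have p8 := mulr_ge0 (ltW e0) p4.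
    lra.
  by rewrite -!mulrA ler_wpM2l ?ler_wpM2r ?addr_ge0//; lra.
by rewrite mulrDl; apply: lerD; apply: ler_wpM2l => //; exact: ltW.
Qed.

End tilt.

(** * Conditional moments *)

Section lift.
Context {d : measure_display} {T : measurableType d} {R : realType}.
Variable mu : {measure set T -> \bar R}.
Variable G : set (set T).
Hypothesis sG : sigma_algebra setT G.
Hypothesis GM : G `<=` measurable.

Let GT := g_sigma_algebraType G.

Let GmeasE : (@measurable _ GT) = G.
Proof. by rewrite /measurable /=; exact: sigma_algebra_id. Qed.

Let GmeasP (A : set T) : G A <-> @measurable _ GT A.
Proof. by rewrite -{1}GmeasE. Qed.

Lemma sub_measurable_fun (f : T -> R) : sub_measurable G f <-> measurable_fun (setT : set GT) f.
Proof.
split=> [h _ B mB|h B mB].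
  by rewrite setTI; apply/GmeasP; exact: h.
by apply/GmeasP; have := h measurableT B mB; rewrite setTI.
Qed.

Import HBNNSimple.

Let integral_nnsfun_mul (X : T -> \bar R) (h : {nnsfun GT >-> R}) :
  measurable_fun setT X -> (forall w, (0 <= X w)%E) ->
  (\int[mu]_w ((h w)%:E * X w) =
   \sum_(r \in range h) (r%:E * \int[mu]_(w in h @^-1` [set r]) X w))%E.
Proof.
move=> mX X0.
have mh (r : R) : measurable (h @^-1` [set r] : set T).
  by apply: GM; apply/GmeasP; exact: measurable_sfunP.
have e w : ((h w)%:E * X w = \sum_(r \in range h) ((r * \1_(h @^-1` [set r]) w)%:E * X w))%E.
  rewrite [in LHS]fimfunE -fsumEFin// ge0_mule_fsuml// => r.
  by rewrite EFinM nnfun_muleindic_ge0.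
under eq_integral => w _ do rewrite e.
rewrite ge0_integral_fsum //; last 2 first.
- move=> r; apply: emeasurable_funM => //; apply/measurable_EFinP.
  by apply: measurable_funM => //; exact: measurable_indic.
- by move=> r w _; apply: mule_ge0 => //; rewrite EFinM nnfun_muleindic_ge0.
apply: eq_fsbigr => r; rewrite inE => -[w0 _ hr].
have r0 : 0 <= r by rewrite -hr.
rewrite [in RHS]integral_mkcond -ge0_integralZl//; last 2 first.
- by apply/(measurable_restrictT _ _).1 => //; exact: measurable_funTS.
- by move=> w _; rewrite patchE; case: ifP.
apply: eq_integral => w _; rewrite patchE indicE.
by case: ifP; rewrite ?mulr1 ?mulr0 ?mule0 ?mul0e.
Qed.

Lemma lift_le (X Y : T -> R) (H : T -> R) :
  measurable_fun setT X -> measurable_fun setT Y ->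
  (forall w, 0 <= X w) -> (forall w, 0 <= Y w) ->
  (forall A, G A -> (\int[mu]_(w in A) (X w)%:E <= \int[mu]_(w in A) (Y w)%:E)%E) ->
  sub_measurable G H -> (forall w, 0 <= H w) ->
  (\int[mu]_w (H w * X w)%:E <= \int[mu]_w (H w * Y w)%:E)%E.
Proof.
move=> mX mY X0 Y0 XY /sub_measurable_fun mH H0.
have mH' : measurable_fun (setT : set GT) (EFin \o H) by exact/measurable_EFinP.
pose h := nnsfun_approx measurableT mH'.
have hcvg w : (h n w)%:E @[n --> \oo] --> (H w)%:E.
  exact: (@cvg_nnsfun_approx _ GT R _ measurableT _ mH' (fun x _ => H0 x) w Logic.I).
have hnd w : {homo (fun n => h n w) : n m / (n <= m)%N >-> n <= m}.
  by move=> n m nm; have /lefP := nd_nnsfun_approx measurableT mH' nm; exact.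
have mhT n : measurable_fun (setT : set T) (h n : T -> R).
  move=> _ B mB; rewrite setTI; apply: GM; apply/GmeasP.
  by have := @measurable_funPT _ _ GT _ (h n) measurableT B mB; rewrite setTI.
have key (Z : T -> R) : measurable_fun setT Z -> (forall w, 0 <= Z w) ->
    (\int[mu]_w ((h n w)%:E * (Z w)%:E))%E @[n --> \oo] --> (\int[mu]_w (H w * Z w)%:E)%E.
  move=> mZ Z0.
  have -> : (\int[mu]_w (H w * Z w)%:E = \int[mu]_w limn (fun n => (h n w)%:E * (Z w)%:E))%E.
    apply: eq_integral => w _; apply/esym/cvg_lim => //.
    by rewrite EFinM; apply: cvgeZr.
  apply: cvg_monotone_convergence => //.
  - by move=> n; apply: emeasurable_funM => //; exact/measurable_EFinP.
  - by move=> n w _; apply: mule_ge0 => //; rewrite lee_fin.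
  - by move=> w _ n m nm; apply: lee_wpmul2r; rewrite lee_fin; [exact: Z0|exact: hnd].
apply: lee_cvg_to (key _ mX X0) (key _ mY Y0) _.
apply: nearW => n.
rewrite !integral_nnsfun_mul//; try exact/measurable_EFinP.
apply: lee_fsum => // r [w _ <-].
apply: lee_wpmul2l; first by rewrite lee_fin.
by apply: XY; apply/GmeasP; exact: measurable_sfunP.
Qed.

End lift.

Section expectation.
Context {d : measure_display} {T : measurableType d} {R : realType}.
Variable P : probability T R.
Implicit Types (f g : T -> R) (c : R).

Definition itg (f : T -> R) := P.-integrable setT (EFin \o f).
Definition Ex (f : T -> R) : R := (\int[P]_w f w)%R.

Lemma itg_meas f : itg f -> measurable_fun setT f.
Proof. by move=> /integrableP[/measurable_EFinP]. Qed.

Lemma itg_dom f g : measurable_fun setT f -> itg g -> (forall w, `|f w| <= g w) -> itg f.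
Proof.
move=> mf ig fg; apply: le_integrable ig => //; first exact/measurable_EFinP.
move=> w _ /=; rewrite lee_fin; apply: le_trans (fg w) _; exact: ler_norm.
Qed.

Lemma itg_cst c : itg (cst c).
Proof. by apply: finite_measure_integrable_cst. Qed.

Lemma itg_bnd f c : measurable_fun setT f -> (forall w, `|f w| <= c) -> itg f.
Proof. by move=> mf h; apply: itg_dom mf (itg_cst c) h. Qed.

Lemma itgD f g : itg f -> itg g -> itg (fun w => f w + g w).
Proof.
move=> i1 i2; have := integrableD measurableT i1 i2.
by apply: eq_integrable => // w _ /=; rewrite EFinD.
Qed.

Lemma itgZ c f : itg f -> itg (fun w => c * f w).
Proof.
move=> i1; have := integrableZl measurableT c i1.
by apply: eq_integrable => // w _ /=; rewrite EFinM.
Qed.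

Lemma itgB f g : itg f -> itg g -> itg (fun w => f w - g w).
Proof.
move=> i1 i2; have := integrableB measurableT i1 i2.
by apply: eq_integrable => // w _ /=; rewrite EFinB.
Qed.

Lemma itg_norm f : itg f -> itg (fun w => `|f w|).
Proof.
by move=> i1; have := integrable_abse i1; apply: eq_integrable => // w _ /=.
Qed.

Lemma ExD f g : itg f -> itg g -> Ex (fun w => f w + g w) = Ex f + Ex g.
Proof. exact: RintegralD. Qed.

Lemma ExB f g : itg f -> itg g -> Ex (fun w => f w - g w) = Ex f - Ex g.
Proof. exact: RintegralB. Qed.

Lemma ExZ c f : itg f -> Ex (fun w => c * f w) = c * Ex f.
Proof. exact: RintegralZl. Qed.

Lemma Ex_le f g : itg f -> itg g -> (forall w, f w <= g w) -> Ex f <= Ex g.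
Proof. by move=> i1 i2 fg; apply: le_Rintegral. Qed.

Lemma Ex_ge0 f : (forall w, 0 <= f w) -> 0 <= Ex f.
Proof. by move=> f0; apply: Rintegral_ge0. Qed.

Lemma Ex_cst c : Ex (cst c) = c.
Proof. rewrite /Ex Rintegral_cst// [X in fine X](_ : _ = 1%E) ?mulr1//; exact: probability_setT. Qed.

Lemma Ex_abs f g : itg f -> itg g -> (forall w, `|f w| <= g w) -> `|Ex f| <= Ex g.
Proof.
move=> i1 i2 fg; apply: le_trans (le_normr_Rintegral measurableT i1) _.
by apply: Ex_le => //; exact: itg_norm.
Qed.

Lemma eq_Ex f g : f =1 g -> Ex f = Ex g.
Proof. by move=> fg; congr Ex; apply/funext. Qed.

Lemma ExE f : itg f -> (\int[P]_w (f w)%:E = (Ex f)%:E)%E.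
Proof. by move=> i; rewrite /Ex /Rintegral fineK//; apply: integrable_fin_num. Qed.

Lemma itg_ge0 f : measurable_fun setT f -> (forall w, 0 <= f w) ->
  (\int[P]_w (f w)%:E < +oo)%E -> itg f.
Proof.
move=> mf f0 h; apply/integrableP; split; first exact/measurable_EFinP.
apply: le_lt_trans h; rewrite le_eqVlt; apply/orP; left; apply/eqP.
by apply: eq_integral => w _ /=; rewrite ger0_norm.
Qed.

Lemma Ex_indic A : measurable A -> Ex (\1_A) = fine (P A).
Proof. by move=> mA; rewrite /Ex /Rintegral integral_indic// setIT. Qed.

Section submeas.
Variable G : set (set T).
Hypothesis sG : sigma_algebra setT G.
Hypothesis GM : G `<=` measurable.

Let smE f := sub_measurable_fun G sG f.

Lemma sm_meas f : sub_measurable G f -> measurable_fun setT f.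
Proof. by move=> h _ B mB; rewrite setTI; apply: GM; exact: h. Qed.

Lemma sm_comp f (g : R -> R) : measurable_fun setT g -> sub_measurable G f ->
  sub_measurable G (fun w => g (f w)).
Proof.
move=> mg h B mB; have := mg measurableT B mB; rewrite setTI => mgB.
exact: (h _ mgB).
Qed.

Lemma sm_cst c : sub_measurable G (cst c).
Proof. by apply/smE. Qed.

Lemma sm_add f g : sub_measurable G f -> sub_measurable G g ->
  sub_measurable G (fun w => f w + g w).
Proof. by move=> /smE hf /smE hg; apply/smE; exact: measurable_funD. Qed.

Lemma sm_sub f g : sub_measurable G f -> sub_measurable G g ->
  sub_measurable G (fun w => f w - g w).
Proof. by move=> /smE hf /smE hg; apply/smE; exact: measurable_funB. Qed.

Lemma sm_mul f g : sub_measurable G f -> sub_measurable G g ->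
  sub_measurable G (fun w => f w * g w).
Proof. by move=> /smE hf /smE hg; apply/smE; exact: measurable_funM. Qed.

Lemma sm_max f g : sub_measurable G f -> sub_measurable G g ->
  sub_measurable G (fun w => Num.max (f w) (g w)).
Proof. by move=> /smE hf /smE hg; apply/smE; exact: measurable_maxr. Qed.

Lemma sm_sum (n : nat) (f : nat -> T -> R) : (forall i, (i < n)%N -> sub_measurable G (f i)) ->
  sub_measurable G (fun w => \sum_(i < n) f i w).
Proof.
elim: n => [|n ih] h.
  have -> : (fun w : T => \sum_(i < 0) f i w) = cst 0.
    by apply/funext => w; rewrite big_ord0.
  exact: sm_cst.
have -> : (fun w : T => \sum_(i < n.+1) f i w) = (fun w => \sum_(i < n) f i w + f n w).
  by apply/funext => w; rewrite big_ord_recr.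
apply: sm_add; last exact: h.
by apply: ih => i im; apply: h; exact: ltnW.
Qed.

End submeas.

End expectation.

(* The filtration is shifted so that [x k] is the increment from time [k] to [k + 1].
   [md_V] holds everywhere, not only almost surely, and [md_mean] says that the conditional
   mean vanishes through positive and negative parts, so that integrability need not be
   assumed. *)
Record md_sys {d : measure_display} {T : measurableType d} {R : realType}
  (P : probability T R) (F : nat -> set (set T)) (x v : nat -> T -> R) (K L M : R) : Prop := {
  md_sigma : forall k, sigma_algebra setT (F k);
  md_meas : forall k, F k `<=` measurable;
  md_incl : forall k, F k `<=` F k.+1;
  md_x : forall k, sub_measurable (F k.+1) (x k);
  md_v : forall k, sub_measurable (F k) (v k);
  md_v0 : forall k w, 0 <= v k w;
  md_V : forall k w, `|\sum_(i < k) v i w - k%:R| <= M;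
  md_mean : forall k A, F k A ->
    (\int[P]_(w in A) (Num.max (x k w) 0)%:E = \int[P]_(w in A) (Num.max (- x k w) 0)%:E)%E;
  md_var : forall k A, F k A ->
    (\int[P]_(w in A) (x k w ^+ 2)%:E = \int[P]_(w in A) (v k w)%:E)%E;
  md_third : forall k A, F k A ->
    (\int[P]_(w in A) (`|x k w| ^+ 3 * expR (K * `|x k w|))%:E <=
     \int[P]_(w in A) (L * v k w)%:E)%E }.

Arguments md_sigma {d T R P F x v K L M} _ _.
Arguments md_meas {d T R P F x v K L M} _ _.
Arguments md_incl {d T R P F x v K L M} _ _.
Arguments md_x {d T R P F x v K L M} _ _.
Arguments md_v {d T R P F x v K L M} _ _.
Arguments md_v0 {d T R P F x v K L M} _ _.
Arguments md_V {d T R P F x v K L M} _ _.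
Arguments md_mean {d T R P F x v K L M} _ _.
Arguments md_var {d T R P F x v K L M} _ _.
Arguments md_third {d T R P F x v K L M} _ _.

Section system.
Context {d : measure_display} {T : measurableType d} {R : realType}.
Variables (P : probability T R) (F : nat -> set (set T)) (x v : nat -> T -> R) (K L M : R).
Hypotheses (K0 : 0 < K) (L0 : 0 < L) (M0 : 0 < M).
Hypothesis sys : md_sys P F x v K L M.

Let sF := md_sigma sys.
Let mF := md_meas sys.
Local Notation E := (Ex P).
Local Notation "'I' f" := (itg P f) (at level 10).

Lemma md_v_le k w : v k w <= 2 * M + 1.
Proof.
have := md_V sys k.+1 w; have := md_V sys k w.
rewrite big_ord_recr /= !ler_norml -natr1; lra.
Qed.

Lemma md_incl_le i j : (i <= j)%N -> F i `<=` F j.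
Proof.
elim: j => [|j ih]; first by rewrite leqn0 => /eqP ->.
rewrite leq_eqVlt ltnS => /predU1P[->//|/ih h].
exact: subset_trans h (md_incl sys j).
Qed.

Lemma sm_le i j (f : T -> R) : (i <= j)%N -> sub_measurable (F i) f -> sub_measurable (F j) f.
Proof. by move=> ij h B mB; apply: (md_incl_le i j ij); exact: h. Qed.

Lemma md_x_meas k : measurable_fun setT (x k).
Proof. exact: (sm_meas _ (mF k.+1) _ (md_x sys k)). Qed.

Lemma md_v_meas k : measurable_fun setT (v k).
Proof. exact: (sm_meas _ (mF k) _ (md_v sys k)). Qed.

Section cond.
Variables (k : nat) (H : T -> R).
Hypotheses (mH : sub_measurable (F k) H) (H0 : forall w, 0 <= H w) (iH : I H).

Let mHT : measurable_fun setT H := sm_meas _ (mF k) _ mH.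

Let mth : measurable_fun setT (fun w => `|x k w| ^+ 3 * expR (K * `|x k w|)).
Proof.
have mn : measurable_fun setT (fun w => `|x k w|).
  by apply: measurableT_comp => //; exact: md_x_meas.
apply: measurable_funM; first exact: measurable_funX.
by apply: measurableT_comp => //; exact: measurable_funM.
Qed.

Lemma cond_itg_v : I (fun w => H w * v k w).
Proof.
apply: itg_dom (itgZ _ (2 * M + 1) _ iH) _; first by apply: measurable_funM => //; exact: md_v_meas.
move=> w; rewrite ger0_norm ?mulr_ge0 ?(md_v0 sys)// mulrC ler_wpM2r//; exact: md_v_le.
Qed.

Lemma cond_v_le : E (fun w => H w * v k w) <= (2 * M + 1) * E H.
Proof.
rewrite -ExZ//; apply: Ex_le => [||w]; [exact: cond_itg_v|exact: itgZ|].
by rewrite mulrC ler_wpM2r//; exact: md_v_le.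
Qed.

Let th0 w : 0 <= `|x k w| ^+ 3 * expR (K * `|x k w|).
Proof. by rewrite mulr_ge0 ?expR_ge0 ?exprn_ge0. Qed.

Let third_le :
  (\int[P]_w (H w * (`|x k w| ^+ 3 * expR (K * `|x k w|)))%:E <=
   \int[P]_w (H w * (L * v k w))%:E)%E.
Proof.
apply: (lift_le _ _ (sF k) (mF k)) => //.
- by apply: measurable_funM => //; exact: md_v_meas.
- by move=> w; rewrite mulr_ge0 ?(md_v0 sys)// ltW.
- exact: (md_third sys).
Qed.

Let iLv : I (fun w => H w * (L * v k w)).
Proof.
have -> : (fun w => H w * (L * v k w)) = (fun w => L * (H w * v k w)).
  by apply/funext => w; rewrite mulrCA.
exact: itgZ cond_itg_v.
Qed.

Lemma cond_itg_third : I (fun w => H w * (`|x k w| ^+ 3 * expR (K * `|x k w|))).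
Proof.
apply: itg_ge0 => [|w|]; [exact: measurable_funM|exact: mulr_ge0|].
by apply: le_lt_trans third_le _; rewrite (ExE _ _ iLv) ltry.
Qed.

Lemma cond_third_le : E (fun w => H w * (`|x k w| ^+ 3 * expR (K * `|x k w|))) <=
  L * E (fun w => H w * v k w).
Proof.
have := third_le; rewrite (ExE _ _ iLv) (ExE _ _ cond_itg_third) lee_fin.
have -> : Ex P (fun w => H w * (L * v k w)) = E (fun w => L * (H w * v k w)).
  by apply: eq_Ex => w; rewrite mulrCA.
by rewrite ExZ//; exact: cond_itg_v.
Qed.

Let msq : measurable_fun setT (fun w => x k w ^+ 2).
Proof. by apply: measurable_funX; exact: md_x_meas. Qed.

Let var_eq : (\int[P]_w (H w * x k w ^+ 2)%:E = \int[P]_w (H w * v k w)%:E)%E.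
Proof.
apply/eqP; rewrite eq_le; apply/andP; split; apply: (lift_le _ _ (sF k) (mF k)) => //;
  try exact: md_v_meas; try exact: (md_v0 sys); try (by move=> w; rewrite sqr_ge0).
- by move=> A FA; rewrite (md_var sys).
- by move=> A FA; rewrite (md_var sys).
Qed.

Lemma cond_itg_sq : I (fun w => H w * x k w ^+ 2).
Proof.
apply: itg_ge0 => [|w|]; [exact: measurable_funM|by rewrite mulr_ge0 ?sqr_ge0|].
by rewrite var_eq (ExE _ _ cond_itg_v) ltry.
Qed.

Lemma cond_var : E (fun w => H w * x k w ^+ 2) = E (fun w => H w * v k w).
Proof.
by have := var_eq; rewrite (ExE _ _ cond_itg_v) (ExE _ _ cond_itg_sq) => -[].
Qed.

Lemma cond_itg_x : I (fun w => H w * x k w).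
Proof.
apply: itg_dom (itgD _ _ _ iH cond_itg_sq) _; first by apply: measurable_funM => //; exact: md_x_meas.
move=> w; rewrite normrM (ger0_norm (H0 w)) -[leRHS](_ : H w * (1 + x k w ^+ 2) = _); last by ring.
rewrite ler_wpM2l// -(real_normK (num_real (x k w))).
by have := normr_ge0 (x k w); move: `|_| => a; nra.
Qed.

Let mpos : measurable_fun setT (fun w => Num.max (x k w) 0).
Proof. by apply: measurable_maxr => //; exact: md_x_meas. Qed.

Let mneg : measurable_fun setT (fun w => Num.max (- x k w) 0).
Proof. by apply: measurable_maxr => //; apply: measurableT_comp => //; exact: md_x_meas. Qed.

Let pos_itg : I (fun w => H w * Num.max (x k w) 0).
Proof.
apply: itg_dom (itg_norm _ _ cond_itg_x) _; first exact: measurable_funM.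
move=> w; rewrite !normrM ler_wpM2l//.
by rewrite /Num.max; case: ifP => // _; rewrite normr0.
Qed.

Let neg_itg : I (fun w => H w * Num.max (- x k w) 0).
Proof.
apply: itg_dom (itg_norm _ _ cond_itg_x) _; first exact: measurable_funM.
move=> w; rewrite !normrM ler_wpM2l//.
by rewrite /Num.max; case: ifP => // _; rewrite ?normr0 ?normrN.
Qed.

Lemma cond_mean : E (fun w => H w * x k w) = 0.
Proof.
have -> : E (fun w => H w * x k w) =
    E (fun w => H w * Num.max (x k w) 0 - H w * Num.max (- x k w) 0).
  apply: eq_Ex => w; rewrite -mulrBr; congr (_ * _).
  by rewrite /Num.max; case: ltP => h1; case: ltP => h2; lra.
rewrite ExB//; apply/eqP; rewrite subr_eq0; apply/eqP.
suff : (\int[P]_w (H w * Num.max (x k w) 0)%:E = \int[P]_w (H w * Num.max (- x k w) 0)%:E)%E.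
  by rewrite (ExE _ _ pos_itg) (ExE _ _ neg_itg) => -[].
have p1 w : 0 <= Num.max (x k w) 0 by rewrite le_max lexx orbT.
have p2 w : 0 <= Num.max (- x k w) 0 by rewrite le_max lexx orbT.
apply/eqP; rewrite eq_le; apply/andP; split; apply: (lift_le _ _ (sF k) (mF k)) => //.
- by move=> A FA; rewrite (md_mean sys).
- by move=> A FA; rewrite (md_mean sys).
Qed.

End cond.

Section cond_signed.
Variables (k : nat) (H : T -> R) (c : R).
Hypotheses (mH : sub_measurable (F k) H) (Hc : forall w, `|H w| <= c).

Let Hp w := Num.max (H w) 0.
Let Hn w := Num.max (- H w) 0.
Let mHp : sub_measurable (F k) Hp.
Proof. by apply: (sm_max _ (sF k)) => //; exact: (sm_cst _ (sF k)). Qed.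
Let mHn : sub_measurable (F k) Hn.
Proof.
apply: (sm_max _ (sF k)); last exact: (sm_cst _ (sF k)).
by apply: (sm_comp _ H (fun a => - a)) => //; exact: oppr_measurable.
Qed.
Let Hp0 w : 0 <= Hp w. Proof. by rewrite le_max lexx orbT. Qed.
Let Hn0 w : 0 <= Hn w. Proof. by rewrite le_max lexx orbT. Qed.
Let HE w : H w = Hp w - Hn w.
Proof. by rewrite /Hp /Hn /Num.max; case: ltP => h1; case: ltP => h2; lra. Qed.
Let iHp : I Hp.
Proof.
apply: (itg_bnd _ _ c); first exact: (sm_meas _ (mF k)).
move=> w; apply: le_trans (Hc w).
by rewrite /Hp /Num.max; case: ifP => // _; rewrite normr0.
Qed.
Let iHn : I Hn.
Proof.
apply: (itg_bnd _ _ c); first exact: (sm_meas _ (mF k)).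
move=> w; apply: le_trans (Hc w).
by rewrite /Hn /Num.max; case: ifP => // _; rewrite ?normr0 ?normrN.
Qed.

Lemma bcond_itg_x : I (fun w => H w * x k w).
Proof.
have -> : (fun w => H w * x k w) = (fun w => Hp w * x k w - Hn w * x k w).
  by apply/funext => w; rewrite HE mulrBl.
by apply: itgB; apply: cond_itg_x.
Qed.

Lemma bcond_mean : E (fun w => H w * x k w) = 0.
Proof.
have -> : E (fun w => H w * x k w) = E (fun w => Hp w * x k w - Hn w * x k w).
  by apply: eq_Ex => w; rewrite {1}HE mulrBl.
by rewrite ExB ?cond_mean ?subrr//; apply: cond_itg_x.
Qed.

Lemma bcond_itg_var : I (fun w => H w * (x k w ^+ 2 - v k w)).
Proof.
have -> : (fun w => H w * (x k w ^+ 2 - v k w)) =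
    (fun w => (Hp w * x k w ^+ 2 - Hp w * v k w) - (Hn w * x k w ^+ 2 - Hn w * v k w)).
  by apply/funext => w; rewrite {1}HE; ring.
by apply: itgB; apply: itgB; (apply: cond_itg_sq || apply: cond_itg_v).
Qed.

Lemma bcond_var : E (fun w => H w * (x k w ^+ 2 - v k w)) = 0.
Proof.
have -> : E (fun w => H w * (x k w ^+ 2 - v k w)) =
    E (fun w => (Hp w * x k w ^+ 2 - Hp w * v k w) - (Hn w * x k w ^+ 2 - Hn w * v k w)).
  by apply: eq_Ex => w; rewrite {1}HE; ring.
rewrite !ExB; do ?[apply: itgB]; do ?[exact: cond_itg_sq|exact: cond_itg_v].
by rewrite !cond_var// !subrr.
Qed.

End cond_signed.

End system.

Section bounded_families.
Context {R : realType}.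

Lemma gPhi_bnd (s y : R) : `|gPhi s y| <= 1.
Proof. by rewrite /gPhi ger0_norm ?Phi_ge0 ?Phi_le1. Qed.

Definition bounded_family (c : R) (f : R -> R -> R) := forall s y, 1 <= s -> `|f s y| <= c.

Lemma gk_poly_bnd (P : R -> R) (j : nat) (g : R -> R -> R) : (j <= 4)%N ->
  (forall u, `|P u| <= 10 * (1 + `|u|) ^+ j) ->
  (forall s y, 0 < s -> g s y = P (y / Num.sqrt s) * (Num.sqrt s)^-1 ^+ j * gk s y) ->
  bounded_family (10 * expR 18) g.
Proof.
move=> j4 hP hg s y s1; rewrite hg; last by lra.
apply: le_trans (gk_tilt P j 0 s y j4 (lexx _) _ hP) _; first by lra.
have -> : 0 * y + 0 ^+ 2 * s / 2 = 0 by ring.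
rewrite expR0 mulr1 mul0r !addr0 -[leRHS]mulr1.
have q1 : 1 <= Num.sqrt s by rewrite -[X in X <= _]sqrtr1 ler_sqrt; lra.
have i1 : (Num.sqrt s)^-1 <= 1 by rewrite invf_le1; lra.
have i0 : 0 <= (Num.sqrt s)^-1 by rewrite invr_ge0; lra.
apply: ler_pM.
- by rewrite !mulr_ge0 ?expR_ge0 ?exprn_ge0.
- exact: expR_ge0.
- rewrite -[leRHS]mulr1 ler_wpM2l ?mulr_ge0 ?expR_ge0// -exprS.
  by rewrite exprn_ile1.
- by rewrite -[leRHS]expR0 ler_expR oppr_le0 !mulr_ge0.
Qed.

Lemma gk_bnd : bounded_family (10 * expR 18) gk.
Proof.
apply: (gk_poly_bnd (fun=> 1) 0) => // [u|s y _]; last by rewrite expr0 !mul1r.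
by rewrite normr1; lra.
Qed.

Lemma gk1_bnd : bounded_family (10 * expR 18) gk1.
Proof.
apply: (gk_poly_bnd (fun u => - u) 1) => // [u|s y s0].
  by rewrite normrN expr1; have := normr_ge0 u; lra.
rewrite /gk1; congr (_ * _); rewrite -{1}(sqr_sqrtr (ltW s0)).
by field; rewrite gt_eqF ?sqrtr_gt0.
Qed.

Lemma gk2_bnd : bounded_family (10 * expR 18) gk2.
Proof.
apply: (gk_poly_bnd (fun u => u ^+ 2 - 1) 2) => // [u|s y s0].
  rewrite ler_norml; have := normr_ge0 u; rewrite -(real_normK (num_real u)).
  by move: `|u| => a a0; apply/andP; split; nra.
rewrite /gk2; congr (_ * _); rewrite -{1 2}(sqr_sqrtr (ltW s0)).
by field; rewrite gt_eqF ?sqrtr_gt0.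
Qed.

Lemma continuous_Phi : continuous (Phi : R -> R).
Proof.
move=> x; apply: differentiable_continuous; apply/derivable1_diffP.
by case: (is_derive_Phi x).
Qed.

Lemma measurable_Phi : measurable_fun setT (Phi : R -> R).
Proof. by apply: continuous_measurable_fun; exact: continuous_Phi. Qed.

Context {d : measure_display} {T : measurableType d}.
Variable G : set (set T).
Hypothesis sG : sigma_algebra setT G.

Lemma sm_inv (f : T -> R) : sub_measurable G f -> (forall w, 0 < f w) ->
  sub_measurable G (fun w => (f w)^-1).
Proof.
move=> mf f0.
have -> : (fun w => (f w)^-1) = (fun w => expR (- ln (f w))).
  by apply/funext => w; rewrite expRN lnK// posrE.
apply: (sm_comp _ (fun w => - ln (f w)) expR) => //.
apply: (sm_comp _ (fun w => ln (f w)) -%R); first exact: oppr_measurable.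
exact: (sm_comp _ f (@ln R) (@measurable_ln R) mf).
Qed.

Lemma sm_sqrt (f : T -> R) : sub_measurable G f -> sub_measurable G (fun w => Num.sqrt (f w)).
Proof.
by move=> mf; apply: (sm_comp _ f Num.sqrt) => //; apply: continuous_measurable_fun; exact: sqrt_continuous.
Qed.

Lemma sm_expR (f : T -> R) : sub_measurable G f -> sub_measurable G (fun w => expR (f w)).
Proof. by move=> mf; apply: (sm_comp _ f expR). Qed.

Lemma sm_opp (f : T -> R) : sub_measurable G f -> sub_measurable G (fun w => - f w).
Proof. by move=> mf; apply: (sm_comp _ f -%R) => //; exact: oppr_measurable. Qed.

Lemma sm_norm (f : T -> R) : sub_measurable G f -> sub_measurable G (fun w => `|f w|).
Proof. by move=> mf; apply: (sm_comp _ f Num.norm) => //; exact: normr_measurable. Qed.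

Lemma sm_exp (f : T -> R) n : sub_measurable G f -> sub_measurable G (fun w => f w ^+ n).
Proof. by move=> mf; apply: (sm_comp _ f (fun a => a ^+ n)) => //; exact: exprn_measurable. Qed.

Lemma sm_scale (c : R) (f : T -> R) : sub_measurable G f -> sub_measurable G (fun w => c * f w).
Proof. by move=> mf; apply: (sm_mul _ sG) => //; exact: (sm_cst _ sG). Qed.

Definition sm_family (f : R -> R -> R) := forall s y : T -> R,
  sub_measurable G s -> sub_measurable G y -> (forall w, 0 < s w) ->
  sub_measurable G (fun w => f (s w) (y w)).

Lemma sm_gPhi : sm_family gPhi.
Proof.
move=> s y ms my s0; apply: (sm_comp _ _ Phi); first exact: measurable_Phi.
apply: (sm_mul _ sG) => //; apply: sm_inv; first exact: sm_sqrt.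
by move=> w; rewrite sqrtr_gt0.
Qed.

Lemma sm_gk : sm_family gk.
Proof.
move=> s y ms my s0; apply: (sm_mul _ sG).
  apply: sm_scale; apply: sm_inv; first exact: sm_sqrt.
  by move=> w; rewrite sqrtr_gt0.
apply: sm_expR; apply: (sm_mul _ sG); first by apply: sm_opp; exact: sm_exp.
by apply: sm_inv => [|w]; [exact: sm_scale|rewrite mulr_gt0].
Qed.

Lemma sm_gk1 : sm_family gk1.
Proof.
move=> s y ms my s0; apply: (sm_mul _ sG); last exact: sm_gk.
by apply: sm_opp; apply: (sm_mul _ sG) => //; exact: sm_inv.
Qed.

Lemma sm_gk2 : sm_family gk2.
Proof.
move=> s y ms my s0; apply: (sm_mul _ sG); last exact: sm_gk.
apply: (sm_sub _ sG); last exact: sm_inv.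
apply: (sm_mul _ sG); first exact: sm_exp.
by apply: sm_inv => [|w]; [exact: sm_exp|rewrite exprn_gt0].
Qed.

Lemma sm_kap (lam t : R) (y : T -> R) : sub_measurable G y ->
  sub_measurable G (fun w => kap lam t (y w)).
Proof.
move=> my; apply: (sm_mul _ sG); apply: sm_expR.
  by apply: (sm_add _ sG); [exact: sm_scale|exact: (sm_cst _ sG)].
apply: sm_opp; apply: (sm_mul _ sG); last exact: (sm_cst _ sG).
by apply: sm_norm; apply: (sm_add _ sG) => //; exact: (sm_cst _ sG).
Qed.

End bounded_families.

Definition psum {T : Type} {R : realType} (x : nat -> T -> R) (k : nat) (w : T) : R :=
  \sum_(i < k) x i w.

(** * The Lindeberg expansion *)

Section lindeberg.
Context {d : measure_display} {T : measurableType d} {R : realType}.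
Variables (P : probability T R) (F : nat -> set (set T)) (x v : nat -> T -> R) (K L M : R).
Hypotheses (K0 : 0 < K) (L0 : 0 < L) (M0 : 0 < M).
Hypothesis sys : md_sys P F x v K L M.

Let sF := md_sigma sys.
Let mF := md_meas sys.
Local Notation E := (Ex P).
Local Notation "'I' f" := (itg P f) (at level 10).
Local Notation S := (psum x).
Local Notation V := (psum v).

Lemma psumS (z : nat -> T -> R) k w : psum z k.+1 w = psum z k w + z k w.
Proof. by rewrite /psum big_ord_recr. Qed.

Lemma psum0 (z : nat -> T -> R) w : psum z 0 w = 0.
Proof. by rewrite /psum big_ord0. Qed.

Lemma sm_S k : sub_measurable (F k) (S k).
Proof.
apply: (sm_sum _ (sF k)) => i ik; apply: (sm_le P F x v K L M sys i.+1) => //; exact: (md_x sys).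
Qed.

Lemma sm_V k : sub_measurable (F k) (V k).
Proof.
apply: (sm_sum _ (sF k)) => i ik; apply: (sm_le P F x v K L M sys i); first exact: ltnW.
exact: (md_v sys).
Qed.

Lemma meas_S k : measurable_fun setT (S k).
Proof. exact: (sm_meas _ (mF k) _ (sm_S k)). Qed.

Lemma exp_third (lam h : R) : 0 <= lam -> lam <= K ->
  expR (lam * h) <= expR K + `|h| ^+ 3 * expR (K * `|h|).
Proof.
move=> l0 lK; have [h1|/ltW h1] := leP `|h| 1.
  apply: le_trans (_ : expR K <= _); last by rewrite lerDl mulr_ge0 ?expR_ge0 ?exprn_ge0.
  by rewrite ler_expR; move: h1; rewrite ler_norml => /andP[h1 h2]; nra.
apply: le_trans (_ : `|h| ^+ 3 * expR (K * `|h|) <= _); last by rewrite lerDr expR_ge0.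
apply: le_trans (_ : expR (K * `|h|) <= _); last by rewrite ler_peMl ?expR_ge0 ?expr_ge1.
rewrite ler_expR; apply: le_trans (_ : lam * `|h| <= _); last by rewrite ler_wpM2r.
by rewrite ler_wpM2l// ler_norm.
Qed.

Lemma exp_itg (lam : R) k : 0 <= lam -> lam <= K -> I (fun w => expR (lam * S k w)).
Proof.
move=> l0 lK; elim: k => [|k ih].
  apply: (itg_bnd _ _ 1) => [|w]; last by rewrite psum0 mulr0 expR0 normr1.
  have -> : (fun w : T => expR (lam * S 0 w)) = cst (expR (lam * 0)); last exact: measurable_cst.
  by apply/funext => w; rewrite psum0.
have sm : sub_measurable (F k) (fun w => expR (lam * S k w)).
  apply: (sm_expR); apply: (sm_scale _ (sF k)); exact: sm_S.
have h0 w : 0 <= expR (lam * S k w) by exact: expR_ge0.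
have h3 := cond_itg_third _ _ _ _ _ _ _ L0 sys k _ sm h0 ih.
apply: itg_dom (itgD _ _ _ (itgZ _ (expR K) _ ih) h3) _.
  apply: measurableT_comp => //; apply: measurable_funM => //; exact: meas_S.
move=> w; rewrite ger0_norm ?expR_ge0// psumS mulrDr expRD.
rewrite [expR K * _]mulrC -mulrDr ler_wpM2l ?expR_ge0//; exact: exp_third.
Qed.

Lemma kap_itg (lam t a : R) k : 0 <= lam -> lam <= K -> I (fun w => kap lam t (S k w - a)).
Proof.
move=> l0 lK; apply: itg_dom (itgZ _ (expR (- (lam * a) + lam ^+ 2 * t / 2)) _ (exp_itg _ k l0 lK)) _.
  apply: (sm_meas _ (mF k)); apply: (sm_kap _ (sF k)).
  by apply: (sm_sub _ (sF k)); [exact: sm_S|exact: (sm_cst _ (sF k))].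
move=> w; rewrite ger0_norm ?kap_ge0// /kap -!expRD ler_expR.
have : 0 <= `|S k w - a + lam * t| / Num.sqrt t by rewrite divr_ge0 ?sqrtr_ge0.
by lra.
Qed.

Section step.
Variables (f f1 f2 : R -> R -> R) (C c : R) (j : nat).
Hypothesis C0 : 0 <= C.
Hypothesis hstep : forall lam s t y v h : R, 0 <= lam -> bet lam t <= 1 ->
    bet lam t <= K / 2 -> 1 <= t -> 2 * (M + 1) <= t -> `|s - t| <= M + 1 ->
    `|s - v - t| <= M + 1 -> 0 <= v -> v <= 2 * M + 1 ->
  `|f (s - v) (y + h) - f s y - f1 s y * h - f2 s y * (h ^+ 2 - v) / 2| <=
  C * ((Num.sqrt t)^-1 * bet lam t ^+ j) * kap lam t y * (v + `|h| ^+ 3 * expR (K * `|h|)).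
Hypotheses (bf : bounded_family c f) (bf1 : bounded_family c f1) (bf2 : bounded_family c f2).
Hypotheses (sf : forall k, sm_family (F k) f) (sf1 : forall k, sm_family (F k) f1)
  (sf2 : forall k, sm_family (F k) f2).

Let fS (N a : R) k w := f (N - V k w) (S k w - a).

Let Vb k w : `|V k w - k%:R| <= M. Proof. exact: (md_V sys). Qed.

Let sm_s (N : R) k : sub_measurable (F k) (fun w => N - V k w).
Proof. by apply: (sm_sub _ (sF k)); [exact: (sm_cst _ (sF k))|exact: sm_V]. Qed.

Let sm_y (a : R) k : sub_measurable (F k) (fun w => S k w - a).
Proof. by apply: (sm_sub _ (sF k)); [exact: sm_S|exact: (sm_cst _ (sF k))]. Qed.

Lemma fS_itg (N a : R) k : 1 + M <= N - k%:R -> I (fS N a k).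
Proof.
move=> hN; have h w : 1 <= N - V k w by have := Vb k w; rewrite ler_norml; lra.
apply: (itg_bnd _ _ c) => [|w]; last by apply: bf; exact: h.
apply: (sm_meas _ (mF k)); apply: sf; [exact: sm_s|exact: sm_y|].
by move=> w; have := h w; lra.
Qed.

Lemma step_bound (lam N a : R) k (t := N - k%:R) : 0 <= lam -> bet lam t <= 1 ->
  bet lam t <= K / 2 -> 2 * (M + 1) <= t ->
  `|E (fS N a k.+1) - E (fS N a k)| <=
  C * (1 + L) * (2 * M + 1) * ((Num.sqrt t)^-1 * bet lam t ^+ j) *
  E (fun w => kap lam t (S k w - a)).
Proof.
move=> l0 b1 bK tB.
have q0 : 0 <= (Num.sqrt t)^-1 by rewrite invr_ge0 sqrtr_ge0.
have be0 : 0 <= bet lam t by rewrite addr_ge0.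
have lK : lam <= K by move: bK; rewrite /bet; lra.
set s := fun w => N - V k w; set y := fun w => S k w - a.
have h1 w : 1 <= s w by have := Vb k w; rewrite /s ler_norml /t in tB *; lra.
have s0 w : 0 < s w by have := h1 w; lra.
set H := fun w => kap lam t (y w).
have smH : sub_measurable (F k) H by apply: (sm_kap _ (sF k)); exact: sm_y.
have H0 w : 0 <= H w by exact: kap_ge0.
have iH : I H by exact: kap_itg.
have sm1 : sub_measurable (F k) (fun w => f1 (s w) (y w)).
  by apply: sf1 => //; [exact: sm_s|exact: sm_y].
have sm2 : sub_measurable (F k) (fun w => f2 (s w) (y w)).
  by apply: sf2 => //; [exact: sm_s|exact: sm_y].
have c1 w : `|f1 (s w) (y w)| <= c by apply: bf1.
have c2 w : `|f2 (s w) (y w)| <= c by apply: bf2.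
have i1 := bcond_itg_x _ _ _ _ _ _ _ sys k _ c sm1 c1.
have e1 := bcond_mean _ _ _ _ _ _ _ sys k _ c sm1 c1.
have i2 := bcond_itg_var _ _ _ _ _ _ _ sys k _ c sm2 c2.
have e2 := bcond_var _ _ _ _ _ _ _ sys k _ c sm2 c2.
have ia : I (fS N a k.+1).
  apply: fS_itg; rewrite -[k.+1%:R]natr1.
  by move: M0 tB; rewrite /t => M00 tB; lra.
have ib : I (fS N a k) by apply: fS_itg; move: M0 tB; rewrite /t; lra.
pose Rm w := fS N a k.+1 w - fS N a k w -
  (f1 (s w) (y w) * x k w + 2^-1 * (f2 (s w) (y w) * (x k w ^+ 2 - v k w))).
have i12 := itgD _ _ _ i1 (itgZ _ 2^-1 _ i2).
have iR : I Rm by apply: itgB => //; exact: itgB.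
have eR : E (fS N a k.+1) - E (fS N a k) = E Rm.
  rewrite /Rm ExB//; last exact: itgB.
  by rewrite (ExB _ _ _ ia ib) ExD ?ExZ ?e1 ?e2 ?mulr0 ?addr0 ?subr0//; exact: itgZ.
have iHv := cond_itg_v _ _ _ _ _ _ _ sys k H smH H0 iH.
have iH3 := cond_itg_third _ _ _ _ _ _ _ L0 sys k H smH H0 iH.
set A := C * ((Num.sqrt t)^-1 * bet lam t ^+ j).
have A0 : 0 <= A by rewrite !mulr_ge0// exprn_ge0.
pose g w := A * (H w * v k w + H w * (`|x k w| ^+ 3 * expR (K * `|x k w|))).
have ig : I g by apply: itgZ; exact: itgD.
have Rg w : `|Rm w| <= g w.
  rewrite (_ : g w = A * H w * (v k w + `|x k w| ^+ 3 * expR (K * `|x k w|))); last by rewrite /g; ring.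
  have := hstep lam (s w) t (y w) (v k w) (x k w) l0 b1 bK _ tB _ _ (md_v0 sys k w) (md_v_le _ _ _ _ _ _ _ sys k w).
  have -> : f (s w - v k w) (y w + x k w) - f (s w) (y w) - f1 (s w) (y w) * x k w -
     f2 (s w) (y w) * (x k w ^+ 2 - v k w) / 2 = Rm w.
    rewrite /Rm /fS !psumS -/(s w) /y.
    have -> : N - (V k w + v k w) = s w - v k w by rewrite /s; ring.
    have -> : S k w + x k w - a = S k w - a + x k w by ring.
    by field.
  apply.
  - by move: M0 tB; lra.
  - by have := Vb k w; rewrite /s /t !ler_norml; lra.
  - by have := Vb k.+1 w; rewrite psumS -[k.+1%:R]natr1 /s /t !ler_norml; lra.
rewrite eR; apply: le_trans (Ex_abs _ _ _ iR ig Rg) _.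
rewrite /g ExZ; last exact: itgD.
rewrite ExD//.
have l1 := cond_third_le _ _ _ _ _ _ _ L0 sys k H smH H0 iH.
have l2 := cond_v_le _ _ _ _ _ _ _ sys k H smH H0 iH.
rewrite (_ : C * (1 + L) * (2 * M + 1) * ((Num.sqrt t)^-1 * bet lam t ^+ j) * E H =
  A * ((1 + L) * ((2 * M + 1) * E H))); last by rewrite /A; ring.
rewrite ler_wpM2l//.
apply: le_trans (_ : (1 + L) * E (fun w => H w * v k w) <= _).
  by rewrite mulrDl mul1r lerD2l.
by rewrite ler_wpM2l//; move: L0; lra.
Qed.

Lemma lindeberg (lam N a : R) n : 0 <= lam ->
  (forall k, (k < n)%N -> bet lam (N - k%:R) <= 1 /\ bet lam (N - k%:R) <= K / 2 /\
    2 * (M + 1) <= N - k%:R) ->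
  `|E (fS N a n) - f N (- a)| <=
  C * (1 + L) * (2 * M + 1) * \sum_(k < n) ((Num.sqrt (N - k%:R))^-1 * bet lam (N - k%:R) ^+ j *
    E (fun w => kap lam (N - k%:R) (S k w - a))).
Proof.
move=> l0 hk; elim: n hk => [|n ih] hk.
  rewrite big_ord0 mulr0 (_ : E (fS N a 0) = E (cst (f N (- a)))).
    by rewrite Ex_cst subrr normr0.
  by apply: eq_Ex => w; rewrite /fS !psum0 subr0 sub0r.
rewrite big_ord_recr /= mulrDr.
have [b1 [b2 b3]] := hk n (ltnSn n).
have h := step_bound lam N a n l0 b1 b2 b3.
have {}ih := ih (fun k kn => hk k (ltnW kn)).
rewrite (_ : E (fS N a n.+1) - f N (- a) =
  (E (fS N a n) - f N (- a)) + (E (fS N a n.+1) - E (fS N a n))); last by ring.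
apply: le_trans (ler_normD _ _) _; apply: lerD => //.
by rewrite mulrA.
Qed.

End step.

End lindeberg.

(** * Concentration under an exponential tilt *)

Section sums.
Context {R : realType}.
Implicit Types (N m lam : R) (n k : nat).

Lemma sqrt_step (b : R) : 1 < b -> let q := Num.sqrt b in let r := Num.sqrt (b - 1) in
  [/\ 0 < r, r < q, 0 < q, q ^+ 2 = b & r ^+ 2 = b - 1].
Proof.
move=> b1 /=; split; rewrite ?sqrtr_gt0 ?ltr_sqrt ?sqr_sqrtr; lra.
Qed.

Lemma sum_sqrt1 m n : 1 <= m ->
  \sum_(k < n) (Num.sqrt (k%:R + m))^-1 <= 2 * Num.sqrt (n%:R + m - 1).
Proof.
move=> m1; elim: n => [|n ih].
  by rewrite big_ord0 mulr_ge0 ?sqrtr_ge0.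
rewrite big_ord_recr /= -[n.+1%:R]natr1.
have n0 : 0 <= n%:R :> R by [].
rewrite (_ : n%:R + 1 + m - 1 = n%:R + m); last by ring.
set r := Num.sqrt (n%:R + m - 1) in ih *; set q := Num.sqrt (n%:R + m).
have q0 : 0 < q by rewrite sqrtr_gt0; lra.
have eq : q ^+ 2 = n%:R + m by rewrite sqr_sqrtr; lra.
have er : r ^+ 2 = n%:R + m - 1 by rewrite sqr_sqrtr; lra.
have r0 : 0 <= r by exact: sqrtr_ge0.
apply: le_trans (lerD ih (lexx _)) _.
suff : q^-1 <= 2 * (q - r) by lra.
rewrite -[q^-1]mul1r ler_pdivrMr//; nra.
Qed.

Lemma sum_sqrt m n : 1 <= m ->
  \sum_(k < n) (Num.sqrt (k%:R + m))^-1 <= 2 * Num.sqrt (n%:R + m).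
Proof.
move=> m1; apply: le_trans (sum_sqrt1 _ _ m1) _.
by rewrite ler_pM2l// ler_sqrt; [lra|have : 0 <= n%:R :> R by []; lra].
Qed.

Lemma sum_inv N n : 1 <= N - n%:R ->
  \sum_(k < n) (N - k%:R)^-1 <= ln N - ln (N - n%:R).
Proof.
elim: n => [|n ih]; first by rewrite big_ord0 subr0 subrr.
rewrite big_ord_recr /= -[n.+1%:R]natr1 => h.
have {}ih := ih ltac:(lra).
apply: le_trans (lerD ih (lexx _)) _.
set b := N - n%:R in h *; have b0 : 0 < b by rewrite /b; lra.
rewrite (_ : N - (n%:R + 1) = b - 1); last by rewrite /b; ring.
have : ln (b - 1) <= ln b - b^-1.
  have -> : b - 1 = b * (1 + - b^-1) by field; lra.
  rewrite lnM ?posrE//; last first.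
    by rewrite subr_gt0 invf_lt1//; rewrite /b; lra.
  rewrite lerD2l; apply: le_ln1Dx.
  by rewrite ltrN2 invf_lt1//; rewrite /b; lra.
by lra.
Qed.

Lemma sum_inv32 N n : 1 <= N - n%:R ->
  \sum_(k < n) (Num.sqrt (N - k%:R))^-1 ^+ 3 <= 2 * (Num.sqrt (N - n%:R))^-1 - 2 * (Num.sqrt N)^-1.
Proof.
elim: n => [|n ih]; first by rewrite big_ord0 subr0 subrr.
rewrite big_ord_recr /= -[n.+1%:R]natr1 => h.
have {}ih := ih ltac:(lra).
apply: le_trans (lerD ih (lexx _)) _.
set b := N - n%:R in h *.
rewrite (_ : N - (n%:R + 1) = b - 1); last by rewrite /b; ring.
have [|r0 rq q0 eq er] := sqrt_step b; first by rewrite /b; lra.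
move: r0 rq q0 eq er; set r := Num.sqrt (b - 1); set q := Num.sqrt b => r0 rq q0 eq er.
suff : q^-1 ^+ 3 <= 2 * (r^-1 - q^-1) by lra.
have -> : r^-1 - q^-1 = (q - r) / (q * r) by field; rewrite !gt_eqF.
have e1 : (q - r) = (q + r)^-1.
  by apply: (@mulIf _ (q + r)); [rewrite gt_eqF//; lra|rewrite mulVf ?gt_eqF//; [nra|lra]].
have p1 : 0 < (q + r) * (q * r) by rewrite !mulr_gt0//; lra.
rewrite e1 -invfM exprVn -[2]invrK -invfM lef_pV2 ?posrE ?mulr_gt0 ?exprn_gt0//; last first.
- by lra.
have : q * r <= q ^+ 2 by rewrite expr2 ler_pM2l// ltW.
have : 0 < q * r by rewrite mulr_gt0.
by rewrite exprS; nra.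
Qed.

Lemma harmonic_split (a b N : R) : 0 < a -> 1 <= b -> 0 < N -> N <= a + b ->
  b^-1 * (Num.sqrt a)^-1 <= 2 * ((Num.sqrt N)^-1 * b^-1 + N^-1 * (Num.sqrt a)^-1).
Proof.
move=> a0 b1 N0 ab.
have p0 : 0 < Num.sqrt a by rewrite sqrtr_gt0.
have n0 : 0 < Num.sqrt N by rewrite sqrtr_gt0.
have b'0 : 0 < b^-1 by rewrite invr_gt0; lra.
have p'0 : 0 < (Num.sqrt a)^-1 by rewrite invr_gt0.
have n'0 : 0 < (Num.sqrt N)^-1 by rewrite invr_gt0.
have N'0 : 0 < N^-1 by rewrite invr_gt0.
have [h|/ltW h] := leP N (2 * a).
  have h1 : (Num.sqrt a)^-1 <= 2 * (Num.sqrt N)^-1.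
    rewrite -[2]invrK -invfM lef_pV2 ?posrE//; last by rewrite mulr_gt0.
    have : Num.sqrt N <= 2 * Num.sqrt a.
      rewrite -[2](ger0_norm (_ : 0 <= 2))// -sqrtr_sqr -sqrtrM ?sqr_ge0// ler_sqrt; first lra.
      by rewrite mulr_ge0 ?sqr_ge0//; lra.
    lra.
  have := ler_wpM2l (ltW b'0) h1; have := mulr_gt0 N'0 p'0; lra.
have h1 : b^-1 <= 2 * N^-1.
  by rewrite -[2]invrK -invfM lef_pV2 ?posrE//; [lra|lra|rewrite mulr_gt0].
have := ler_wpM2r (ltW p'0) h1; have := mulr_gt0 n'0 b'0; lra.
Qed.

Lemma sum_bet3 : exists2 C : R, 0 < C & forall m n lam, 1 <= m -> 0 <= lam ->
  \sum_(k < n) bet lam (n%:R + m - k%:R) ^+ 3 / Num.sqrt (k%:R + m) <=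
  C / Num.sqrt (n%:R + m) * (lam ^+ 3 * (n%:R + m) + (Num.sqrt m)^-1).
Proof.
exists 40 => // m n lam m1 l0.
set N := n%:R + m.
have N1 : 1 <= N by rewrite /N; have : 0 <= n%:R :> R by []; lra.
have q0 : 0 < Num.sqrt N by rewrite sqrtr_gt0; lra.
have qq : Num.sqrt N ^+ 2 = N by rewrite sqr_sqrtr; lra.
have m0 : 0 < (Num.sqrt m)^-1 by rewrite invr_gt0 sqrtr_gt0; lra.
apply: le_trans (_ : \sum_(k < n) (4 * lam ^+ 3 * (Num.sqrt (k%:R + m))^-1 +
   8 * ((Num.sqrt N)^-1 * (Num.sqrt (N - k%:R))^-1 ^+ 3 +
     N^-1 * (Num.sqrt m)^-1 * (Num.sqrt (k%:R + m))^-1)) <= _).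
  apply: ler_sum => k _.
  have kn : k%:R + 1 <= n%:R :> R by rewrite natr1 ler_nat.
  have k0 : 0 <= k%:R :> R by [].
  have b1 : m <= N - k%:R by rewrite /N; lra.
  set b := N - k%:R in b1 *; set a := k%:R + m.
  have ba : N <= a + b by rewrite /a /b; lra.
  have a0 : 0 < a by rewrite /a; lra.
  have := harmonic_split a b N a0 ltac:(lra) ltac:(lra) ba.
  have p0 : 0 < (Num.sqrt a)^-1 by rewrite invr_gt0 sqrtr_gt0.
  have r0 : 0 < (Num.sqrt b)^-1 by rewrite invr_gt0 sqrtr_gt0; lra.
  have rm : (Num.sqrt b)^-1 <= (Num.sqrt m)^-1.
    by rewrite lef_pV2 ?posrE ?sqrtr_gt0 ?ler_sqrt; lra.
  have -> : b^-1 = (Num.sqrt b)^-1 ^+ 2 by rewrite exprVn sqr_sqrtr//; lra.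
  rewrite /bet; move: p0 r0 rm; set p := (Num.sqrt a)^-1; set r := (Num.sqrt b)^-1.
  move=> p0 r0 rm hs.
  have h3 : (r + lam) ^+ 3 <= 4 * (lam ^+ 3 + r ^+ 3).
    have : 0 <= (r + lam) * (r - lam) ^+ 2 by rewrite mulr_ge0 ?sqr_ge0//; lra.
    by lra.
  have h4 := ler_wpM2r (ltW p0) h3.
  have h5 : r ^+ 3 * p <= 2 * ((Num.sqrt N)^-1 * r ^+ 3 + N^-1 * (Num.sqrt m)^-1 * p).
    have := ler_wpM2l (ltW r0) hs.
    have : N^-1 * p * r <= N^-1 * p * (Num.sqrt m)^-1.
      by rewrite ler_wpM2l// mulr_ge0 ?(ltW p0)// invr_ge0; lra.
    by rewrite exprS; lra.
  by lra.
rewrite big_split /= -mulr_sumr -mulr_sumr big_split /= -!mulr_sumr.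
have s1 := sum_sqrt m n m1.
have s2 : \sum_(k < n) (Num.sqrt (N - k%:R))^-1 ^+ 3 <= 2 * (Num.sqrt m)^-1.
  have e : N - n%:R = m by rewrite /N; ring.
  have := sum_inv32 N n; rewrite e => /(_ m1).
  have : 0 < (Num.sqrt N)^-1 by rewrite invr_gt0.
  by lra.
move: s1 s2; rewrite -/N; set A := \sum_(i < n) _; set B := \sum_(i < n) _ => s1 s2.
have t1 : 4 * lam ^+ 3 * A <= 8 * (lam ^+ 3 * Num.sqrt N).
  by have := ler_wpM2l (exprn_ge0 3 l0) s1; lra.
have t2 : (Num.sqrt N)^-1 * B <= 2 * ((Num.sqrt N)^-1 * (Num.sqrt m)^-1).
  by rewrite mulrCA ler_pM2l ?invr_gt0.
have t3 : N^-1 * (Num.sqrt m)^-1 * A <= 2 * ((Num.sqrt N)^-1 * (Num.sqrt m)^-1).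
  have -> : 2 * ((Num.sqrt N)^-1 * (Num.sqrt m)^-1) = N^-1 * (Num.sqrt m)^-1 * (2 * Num.sqrt N).
    by rewrite -{2}qq; field; rewrite !gt_eqF// sqrtr_gt0; lra.
  by rewrite ler_wpM2l// mulr_ge0 ?(ltW m0)// invr_ge0; lra.
have -> : 40 / Num.sqrt N * (lam ^+ 3 * N + (Num.sqrt m)^-1) =
  40 * (lam ^+ 3 * Num.sqrt N) + 40 * ((Num.sqrt N)^-1 * (Num.sqrt m)^-1).
  by rewrite -{2}qq; field; rewrite !gt_eqF// sqrtr_gt0; lra.
have : 0 <= lam ^+ 3 * Num.sqrt N by rewrite mulr_ge0 ?exprn_ge0 ?sqrtr_ge0.
have : 0 < (Num.sqrt N)^-1 * (Num.sqrt m)^-1 by rewrite (mulr_gt0 _ m0)// invr_gt0.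
lra.
Qed.

Lemma sum_bet2 : exists2 C : R, 0 < C & forall m n lam, 1 <= m -> 0 <= lam ->
  \sum_(k < n) bet lam (n%:R + m - k%:R) ^+ 2 / Num.sqrt (k%:R + m) <=
  C / Num.sqrt (n%:R + m) * (lam ^+ 2 * (n%:R + m) + 1 + ln (n%:R + m)).
Proof.
exists 40 => // m n lam m1 l0.
set N := n%:R + m.
have N1 : 1 <= N by rewrite /N; have : 0 <= n%:R :> R by []; lra.
have q0 : 0 < Num.sqrt N by rewrite sqrtr_gt0; lra.
have qq : Num.sqrt N ^+ 2 = N by rewrite sqr_sqrtr; lra.
apply: le_trans (_ : \sum_(k < n) (2 * lam ^+ 2 * (Num.sqrt (k%:R + m))^-1 +
   4 * ((Num.sqrt N)^-1 * (N - k%:R)^-1 + N^-1 * (Num.sqrt (k%:R + m))^-1)) <= _).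
  apply: ler_sum => k _.
  have kn : k%:R + 1 <= n%:R :> R by rewrite natr1 ler_nat.
  have k0 : 0 <= k%:R :> R by [].
  have b1 : m <= N - k%:R by rewrite /N; lra.
  set b := N - k%:R in b1 *; set a := k%:R + m.
  have ba : N <= a + b by rewrite /a /b; lra.
  have a0 : 0 < a by rewrite /a; lra.
  have := harmonic_split a b N a0 ltac:(lra) ltac:(lra) ba.
  have p0 : 0 < (Num.sqrt a)^-1 by rewrite invr_gt0 sqrtr_gt0.
  have -> : b^-1 = (Num.sqrt b)^-1 ^+ 2 by rewrite exprVn sqr_sqrtr//; lra.
  rewrite /bet; move: p0; set p := (Num.sqrt a)^-1; set r := (Num.sqrt b)^-1.
  move=> p0 hs.
  have h3 : (r + lam) ^+ 2 <= 2 * (lam ^+ 2 + r ^+ 2).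
    by have := sqr_ge0 (r - lam); lra.
  have h4 := ler_wpM2r (ltW p0) h3.
  by lra.
rewrite big_split /= -mulr_sumr -mulr_sumr big_split /= -!mulr_sumr.
have s1 := sum_sqrt m n m1.
have s2 : \sum_(k < n) (N - k%:R)^-1 <= ln N.
  have e : N - n%:R = m by rewrite /N; ring.
  have := sum_inv N n; rewrite e => /(_ m1).
  by have := ln_ge0 m1; lra.
move: s1 s2; rewrite -/N; set A := \sum_(i < n) _; set B := \sum_(i < n) _ => s1 s2.
have t1 : lam ^+ 2 * A <= 2 * (lam ^+ 2 * Num.sqrt N).
  by have := ler_wpM2l (exprn_ge0 2 l0) s1; lra.
have t2 : (Num.sqrt N)^-1 * B <= (Num.sqrt N)^-1 * ln N.
  by rewrite ler_pM2l ?invr_gt0.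
have t3 : N^-1 * A <= 2 * (Num.sqrt N)^-1.
  have -> : 2 * (Num.sqrt N)^-1 = N^-1 * (2 * Num.sqrt N).
    by rewrite -{2}qq; field; rewrite gt_eqF.
  by rewrite ler_wpM2l// invr_ge0; lra.
have -> : 40 / Num.sqrt N * (lam ^+ 2 * N + 1 + ln N) =
  40 * (lam ^+ 2 * Num.sqrt N) + 40 * (Num.sqrt N)^-1 + 40 * ((Num.sqrt N)^-1 * ln N).
  by rewrite -{2}qq; field; rewrite gt_eqF.
have : 0 <= lam ^+ 2 * Num.sqrt N by rewrite mulr_ge0 ?exprn_ge0 ?sqrtr_ge0.
have : 0 <= (Num.sqrt N)^-1 * ln N by apply: mulr_ge0; [rewrite invr_ge0 ltW|exact: ln_ge0].
have : 0 < (Num.sqrt N)^-1 by rewrite invr_gt0.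
lra.
Qed.

End sums.

Section kernel.
Context {d : measure_display} {T : measurableType d} {R : realType}.
Variable P : probability T R.
Local Notation E := (Ex P).

Lemma contraction_bound (a : R -> R) (g rho h B : R) : 0 <= rho -> rho < 1 ->
  (forall z, a z <= g + rho * a (z + h)) -> (forall z, a z <= B) ->
  forall z, a z <= g / (1 - rho).
Proof.
move=> r0 r1 ha hB z.
have hs : has_sup (range a).
  by split; [exists (a z), z|exists B => _ [y _ <-]].
set s := sup (range a).
have as_ y : a y <= s by apply: (sup_upper_bound hs); exists y.
have : s <= g + rho * s.
  apply: ge_sup => [|_ [y _ <-]]; first by exists (a z), z.
  by apply: le_trans (ha y) _; rewrite lerD2l ler_wpM2l.
move=> h1; apply: le_trans (as_ z) _.
by rewrite ler_pdivlMr; [lra|lra].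
Qed.

Definition oexp (r a : R) : R := if 0 <= a then expR (- (a / r)) else 0.

Lemma measurable_oexp r : measurable_fun setT (oexp r).
Proof.
apply: measurable_fun_ifT => //; first exact: measurable_fun_ler.
apply: measurableT_comp => //; apply: measurableT_comp; first exact: oppr_measurable.
exact: measurable_funM.
Qed.

Definition near_ind (h a : R) : R := if `|a| <= h then 1 else 0.

Lemma measurable_near_ind h : measurable_fun setT (near_ind h).
Proof.
by apply: measurable_fun_ifT => //; apply: measurable_fun_ler.
Qed.

Lemma near_ind_ge0 h a : 0 <= near_ind h a.
Proof. by rewrite /near_ind; case: ifP. Qed.

Lemma near_ind_le1 h a : near_ind h a <= 1.
Proof. by rewrite /near_ind; case: ifP. Qed.

Lemma oexp_ge0 r a : 0 <= oexp r a.
Proof. by rewrite /oexp; case: ifP => // _; rewrite expR_ge0. Qed.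

Lemma oexp_le1 r a : 0 < r -> oexp r a <= 1.
Proof.
move=> r0; rewrite /oexp; case: ifP => // a0.
by rewrite -expR0 ler_expR oppr_le0 divr_ge0// ltW.
Qed.

Lemma oexp_step r h a : 0 < r -> 0 <= h ->
  oexp r a <= near_ind h a + expR (- (h / r)) * oexp r (a - h).
Proof.
move=> r0 h0; rewrite {1}/oexp; case: ifP => [a0|_]; last first.
  by rewrite addr_ge0 ?near_ind_ge0// mulr_ge0 ?expR_ge0 ?oexp_ge0.
have [ah|ah] := leP a h.
  apply: le_trans (_ : near_ind h a <= _); last by rewrite lerDl mulr_ge0 ?expR_ge0 ?oexp_ge0.
  rewrite /near_ind ger0_norm// ah -expR0 ler_expR oppr_le0 divr_ge0//; exact: ltW.
apply: le_trans (_ : expR (- (h / r)) * oexp r (a - h) <= _); last by rewrite lerDr near_ind_ge0.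
rewrite /oexp subr_ge0 (ltW ah) -expRD ler_expR; lra.
Qed.

Variables (wt : T -> R) (h : R).
Hypotheses (wt0 : forall w, 0 <= wt w) (iwt : itg P wt) (h0 : 0 < h).

Lemma itg_wt (f : R -> R) (u : T -> R) : measurable_fun setT f -> measurable_fun setT u ->
  (forall a, `|f a| <= 1) -> itg P (fun w => wt w * f (u w)).
Proof.
move=> mf mu f1; apply: itg_dom (iwt) _.
  by apply: measurable_funM; [exact: itg_meas iwt|exact: measurableT_comp].
by move=> w; rewrite normrM (ger0_norm (wt0 w)) -[leRHS]mulr1 ler_wpM2l.
Qed.

Lemma ind_norm hh a : `|near_ind hh a| <= 1.
Proof. by rewrite ger0_norm ?near_ind_ge0 ?near_ind_le1. Qed.

Lemma oexp_norm r a : 0 < r -> `|oexp r a| <= 1.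
Proof. by move=> r0; rewrite ger0_norm ?oexp_ge0 ?oexp_le1. Qed.

(* By [oexp_step], [z |-> E (wt * oexp r (u - z))] is at most [g] plus a contraction of its own
   translate. *)
Lemma oexp_bound (u : T -> R) (g r : R) : measurable_fun setT u -> h <= r ->
  (forall z, E (fun w => wt w * near_ind h (u w - z)) <= g) ->
  forall z, E (fun w => wt w * oexp r (u w - z)) <= 2 * g * r / h.
Proof.
move=> mu hr hg z.
have r0 : 0 < r by apply: lt_le_trans hr.
have g0 : 0 <= g.
  by apply: le_trans (hg 0); apply: Ex_ge0 => w; rewrite mulr_ge0 ?near_ind_ge0.
have mu' y : measurable_fun setT (fun w => u w - y) by apply: measurable_funB.
have io y : itg P (fun w => wt w * oexp r (u w - y)).
  by apply: itg_wt => //; [exact: measurable_oexp|move=> a; exact: oexp_norm].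
have ii y : itg P (fun w => wt w * near_ind h (u w - y)).
  by apply: itg_wt => //; [exact: measurable_near_ind|move=> a; exact: ind_norm].
set rho := expR (- (h / r)).
have hr0 : 0 < h / r by rewrite divr_gt0.
have rho1 : rho <= (1 + h / r)^-1.
  by rewrite /rho expRN lef_pV2 ?posrE ?expR_gt0 ?expR_ge1Dx//; lra.
have rh0 : 0 < r + h by rewrite addr_gt0.
have e1 : 1 - (1 + h / r)^-1 = h / (r + h) by field; rewrite !gt_eqF//; lra.
have p1 : 0 < h / (r + h) by rewrite divr_gt0.
have := @contraction_bound (fun y => E (fun w => wt w * oexp r (u w - y))) g rho h (E wt)
  (expR_ge0 _) _ _ _ z.
move=> H; apply: le_trans (H _ _ _) _.
- by lra.
- move=> y; rewrite -ExZ// ; apply: le_trans (lerD (hg y) (lexx _)).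
  rewrite -ExD//; last exact: itgZ.
  apply: Ex_le => //; first by apply: itgD => //; exact: itgZ.
  move=> w; rewrite mulrCA -mulrDr ler_wpM2l//.
  rewrite opprD addrA; apply: oexp_step => //; exact: ltW.
- move=> y; apply: Ex_le => // w.
  by rewrite -[leRHS]mulr1 ler_wpM2l// oexp_le1.
apply: le_trans (_ : g / (h / (r + h)) <= _).
  by rewrite ler_wpM2l// lef_pV2 ?posrE//; lra.
rewrite invf_div (_ : 2 * g * r / h = g * ((2 * r) / h)); last by ring.
apply: ler_wpM2l => //.
by rewrite ler_wpM2r ?invr_ge0 ?(ltW h0)//; lra.
Qed.

Lemma exp_kernel_bound (u : T -> R) (g r : R) : measurable_fun setT u -> h <= r ->
  (forall z, E (fun w => wt w * near_ind h (u w - z)) <= g) ->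
  forall z, E (fun w => wt w * expR (- (`|u w - z| / r))) <= 4 * g * r / h.
Proof.
move=> mu hr hg z.
have r0 : 0 < r by apply: lt_le_trans hr.
have h1 := oexp_bound u g r mu hr hg z.
have mu2 : measurable_fun setT (fun w => - u w).
  by apply: measurableT_comp => //; exact: oppr_measurable.
have hg2 y : E (fun w => wt w * near_ind h (- u w - y)) <= g.
  apply: le_trans (hg (- y)); rewrite (_ : E _ = E (fun w => wt w * near_ind h (u w - - y)))//.
  by apply: eq_Ex => w; rewrite /near_ind -normrN opprD !opprK.
have h2 := oexp_bound (fun w => - u w) g r mu2 hr hg2 (- z).
have mu' y : measurable_fun setT (fun w => u w - y) by apply: measurable_funB.
have mu2' y : measurable_fun setT (fun w => - u w - y) by apply: measurable_funB.
have i1 : itg P (fun w => wt w * oexp r (u w - z)).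
  by apply: itg_wt => //; [exact: measurable_oexp|move=> a; exact: oexp_norm].
have i2 : itg P (fun w => wt w * oexp r (- u w - - z)).
  by apply: itg_wt => //; [exact: measurable_oexp|move=> a; exact: oexp_norm].
rewrite (_ : 4 * g * r / h = 2 * g * r / h + 2 * g * r / h); last by ring.
apply: le_trans (lerD h1 h2); rewrite -ExD//; apply: Ex_le => [||w].
- apply: (itg_wt (fun a => expR (- (`|a| / r)))) => //.
    apply: measurableT_comp => //; apply: measurableT_comp; first exact: oppr_measurable.
    by apply: measurable_funM => //; exact: normr_measurable.
  move=> a; rewrite ger0_norm ?expR_ge0// -expR0 ler_expR oppr_le0 divr_ge0//; exact: ltW.
- exact: itgD.
rewrite -mulrDr ler_wpM2l// /oexp.
have [a0|/ltW a0] := leP 0 (u w - z).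
  by rewrite ger0_norm// lerDl; case: ifP => // _; rewrite expR_ge0.
rewrite ler0_norm// (_ : - u w - - z = - (u w - z)); last by ring.
by rewrite oppr_ge0 a0 add0r.
Qed.

End kernel.

Definition tiltw {T : Type} {R : realType} (x : nat -> T -> R) (lam : R) (k : nat) (w : T) : R :=
  expR (lam * psum x k w - lam ^+ 2 * k%:R / 2).

Definition conc {d} {T : measurableType d} {R : realType} (P : probability T R)
    (x : nat -> T -> R) (lam h : R) (k : nat) (g : R) :=
  forall z, Ex P (fun w => tiltw x lam k w * near_ind h (psum x k w - z)) <= g.

Section conc_kap.
Context {d : measure_display} {T : measurableType d} {R : realType}.
Variables (P : probability T R) (F : nat -> set (set T)) (x v : nat -> T -> R) (K L M : R).
Hypotheses (K0 : 0 < K) (L0 : 0 < L) (M0 : 0 < M).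
Hypothesis sys : md_sys P F x v K L M.

Lemma tiltw_ge0 lam k w : 0 <= tiltw x lam k w.
Proof. exact: expR_ge0. Qed.

Lemma tiltw_itg lam k : 0 <= lam -> lam <= K -> itg P (tiltw x lam k).
Proof.
move=> l0 lK.
have -> : tiltw x lam k = (fun w => expR (- (lam ^+ 2 * k%:R / 2)) * expR (lam * psum x k w)).
  by apply/funext => w; rewrite -expRD addrC.
by apply: itgZ; exact: (exp_itg P F x v K L M L0 sys).
Qed.

Lemma kap_conc (lam a N h g : R) k : 0 <= lam -> lam <= K -> 0 < h -> h <= Num.sqrt (N - k%:R) ->
  conc P x lam h k g ->
  Ex P (fun w => kap lam (N - k%:R) (psum x k w - a)) <=
    expR (- (lam * a) + lam ^+ 2 * N / 2) * (4 * g * Num.sqrt (N - k%:R) / h).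
Proof.
move=> l0 lK h0 ht hc; set t := N - k%:R in ht *.
have iw := tiltw_itg lam k l0 lK.
have mS := meas_S P F x v K L M sys k.
have hb := exp_kernel_bound P (tiltw x lam k) h (tiltw_ge0 lam k) iw h0 (psum x k) g _ mS ht hc (a - lam * t).
have -> : Ex P (fun w => kap lam t (psum x k w - a)) =
  Ex P (fun w => expR (- (lam * a) + lam ^+ 2 * N / 2) *
    (tiltw x lam k w * expR (- (`|psum x k w - (a - lam * t)| / Num.sqrt t)))).
  apply: eq_Ex => w; rewrite /kap /tiltw mulrA -!expRD; congr expR.
  have -> : psum x k w - (a - lam * t) = psum x k w - a + lam * t by ring.
  by move: (`|_| / _) => X; rewrite /t; field.
rewrite ExZ; first by rewrite ler_wpM2l ?expR_ge0.
apply: (itg_wt P _ (tiltw_ge0 lam k) iw (fun b => expR (- (`|b| / Num.sqrt t)))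
   (fun w => psum x k w - (a - lam * t))).
- apply: measurableT_comp => //; apply: measurableT_comp; first exact: oppr_measurable.
  by apply: measurable_funM => //; exact: normr_measurable.
- exact: measurable_funB.
- by move=> b; rewrite ger0_norm ?expR_ge0// -expR0 ler_expR oppr_le0 divr_ge0 ?sqrtr_ge0.
Qed.

End conc_kap.

Section concentration.
Context {R : realType}.
Variables (K L M : R).
Hypotheses (K0 : 0 < K) (L0 : 0 < L) (M0 : 0 < M).

Lemma bet_mono (lam lam0 m t : R) : lam <= lam0 -> 1 <= m -> m <= t -> bet lam t <= bet lam0 m.
Proof.
move=> ll m1 mt; rewrite /bet lerD// lef_pV2 ?posrE ?sqrtr_gt0 ?ler_sqrt; lra.
Qed.

Lemma gk_lower (lam m s y z : R) : 0 <= lam -> lam <= 1 -> 1 <= m -> 2 * M <= m ->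
  M <= Num.sqrt m -> `|s - m| <= M -> `|y - z| <= Num.sqrt m ->
  normal_peak 1 / 2 * expR (- (4 + M / 2)) * (Num.sqrt m)^-1 *
    expR (lam * (y - (z + lam * m)) + lam ^+ 2 * m / 2) <= gk s (y - (z + lam * m)).
Proof.
move=> l0 l1 m1 mM mM2; rewrite !ler_norml => /andP[s1 s2] /andP[y1 y2].
have s0 : 0 < s by lra.
have sm : m / 2 <= s by lra.
have q0 : 0 < Num.sqrt s by rewrite sqrtr_gt0.
have r0 : 0 < Num.sqrt m by rewrite sqrtr_gt0; lra.
have rr : Num.sqrt m ^+ 2 = m by rewrite sqr_sqrtr; lra.
have l2 : lam ^+ 2 <= 1 by rewrite expr_le1.
have l2' := sqr_ge0 lam.
rewrite /gk.
have h1 : 2^-1 * (Num.sqrt m)^-1 <= (Num.sqrt s)^-1.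
  rewrite -invfM lef_pV2 ?posrE ?mulr_gt0//.
  rewrite -[2](ger0_norm (_ : 0 <= 2))// -sqrtr_sqr -sqrtrM ?sqr_ge0// ler_sqrt; first lra.
  by rewrite mulr_ge0 ?sqr_ge0//; lra.
have h2 : expR (- (4 + M / 2)) * expR (lam * (y - (z + lam * m)) + lam ^+ 2 * m / 2) <=
    expR (- (y - (z + lam * m)) ^+ 2 / (2 * s)).
  rewrite -expRD ler_expR.
  set Y := y - (z + lam * m).
  have -> : - Y ^+ 2 / (2 * s) = lam * Y + lam ^+ 2 * s / 2 - (Y + lam * s) ^+ 2 / (2 * s).
    by field; lra.
  have e : Y + lam * s = (y - z) + lam * (s - m) by rewrite /Y; ring.
  have : (Y + lam * s) ^+ 2 / (2 * s) <= 4.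
    rewrite ler_pdivrMr; last by lra.
    apply: le_trans (_ : (2 * Num.sqrt m) ^+ 2 <= _); last by rewrite exprMn rr; lra.
    rewrite e; have : - (2 * Num.sqrt m) <= y - z + lam * (s - m) <= 2 * Num.sqrt m.
      move: (Num.sqrt m) r0 mM2 y1 y2 => q q00 mM2 y1 y2; nra.
    by move: (_ + _) (2 * _) => X q2 /andP[X1 X2]; nra.
  have : - M <= lam ^+ 2 * (s - m) by nra.
  lra.
apply: le_trans (_ : normal_peak 1 * (2^-1 * (Num.sqrt m)^-1) *
   (expR (- (4 + M / 2)) * expR (lam * (y - (z + lam * m)) + lam ^+ 2 * m / 2)) <= _).
  by rewrite le_eqVlt; apply/orP; left; apply/eqP; ring.
have p0 := @peak_gt0 R.
apply: ler_pM => //; rewrite ?mulr_ge0 ?expR_ge0 ?(ltW p0) ?invr_ge0 ?(ltW r0)//.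
by rewrite ler_pM2l.
Qed.

Lemma concentration_constants (Q : R) : 0 < Q -> exists q lam0 : R,
  [/\ [/\ 1 <= q, q <= q ^+ 2, 4 * (M + 1) <= q & M <= q],
      [/\ 0 < lam0, lam0 <= 1, lam0 <= K, q^-1 + lam0 <= 1 & q^-1 + lam0 <= K / 2] &
      q^-1 * Q <= 4^-1].
Proof.
move: K0 M0 => K0' M0' Q0.
have K1 : 0 < K^-1 by rewrite invr_gt0.
pose q := 1 + 4 * (M + 1) + 2 + 4 * K^-1 + Q * 4.
have qM : 4 * (M + 1) <= q by rewrite /q; lra.
have q2 : 2 <= q by rewrite /q; lra.
have qK : 4 * K^-1 <= q by rewrite /q; lra.
have qQ : Q * 4 <= q by rewrite /q; lra.
clearbody q; have q0 : 0 < q by lra.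
have iq : q^-1 <= 2^-1 by rewrite lef_pV2 ?posrE.
have iqK : q^-1 <= K / 4.
  by rewrite -[K / 4]invrK invf_div lef_pV2 ?posrE ?divr_gt0.
have iqQ : q^-1 * Q <= 4^-1 by rewrite mulrC ler_pdivrMr//; lra.
have [lam0 [l0 lh lK]] : exists lam0 : R, [/\ 0 < lam0, lam0 <= 2^-1 & lam0 <= K / 4].
  exists (Num.min (2^-1) (K / 4)); split.
  - by rewrite lt_min; lra.
  - by rewrite ge_min lexx.
  - by rewrite ge_min lexx orbT.
exists q, lam0; split => //; first by split; [lra|nra|by []|lra].
by split; lra.
Qed.

(* [q = sqrt m] is chosen so large that the bound obtained for the expansion of the heat kernel at
   time [n], which involves the constant [A] at earlier times, reproduces [A]. *)
Theorem concentration : exists m A c lam0 : R,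
  [/\ [/\ 1 <= m, 4 * (M + 1) <= m & M <= Num.sqrt m], [/\ 0 < A, 0 < c & 0 < lam0],
   [/\ lam0 <= 1, lam0 <= K, bet lam0 m <= 1 & bet lam0 m <= K / 2] &
  forall d (T : measurableType d) (P : probability T R) F x v, md_sys P F x v K L M ->
  forall n (lam : R), 0 <= lam -> lam <= lam0 -> lam ^+ 3 * (n%:R + m) <= c ->
    conc P x lam (Num.sqrt m) n (A * Num.sqrt m / Num.sqrt (n%:R + m))].
Proof.
have B0 : 0 <= M + 1 by move: M0; lra.
have [C3 C30 l3] := loc_gk3 (M + 1) B0.
have [C4 C40 l4] := loc_gk4 (M + 1) B0.
have Bv0 : 0 <= 2 * M + 1 by move: M0; lra.
have [C C0 hC] := heat_step _ _ _ _ _ 3 K (M + 1) (2 * M + 1) C3 C4 K0 Bv0 C30 C40 heat_gk l3 l4.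
clear C3 C30 l3 C4 C40 l4 Bv0.
have [Cs Cs0 hCs] := @sum_bet3 R.
have [C' C'0 eC'] : exists2 C', 0 < C' & C' = C * (1 + L) * (2 * M + 1).
  by exists (C * (1 + L) * (2 * M + 1)) => //; rewrite !mulr_gt0//; move: L0 M0; lra.
have [c1 c10 ec1] : exists2 c1 : R, 0 < c1 & c1 = normal_peak 1 / 2 * expR (- (4 + M / 2)).
  exists (normal_peak 1 / 2 * expR (- (4 + M / 2))) => //.
  by rewrite !mulr_gt0 ?expR_gt0 ?peak_gt0.
have [C1 C10 eC1] : exists2 C1, 0 < C1 & C1 = c1^-1 by exists c1^-1; rewrite ?invr_gt0.
have [Q Q0 eQ] : exists2 Q, 0 < Q & Q = 8 * C1 * C' * Cs.
  by exists (8 * C1 * C' * Cs) => //; do 3![apply: mulr_gt0 => //].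
have [q [lam0 [[q1 qm mM qM] [lam00 l01 lK bq1 bqK] iqQ]]] := concentration_constants Q Q0.
have q0 : 0 < q by apply: lt_le_trans q1.
have [m em sm] : exists2 m, m = q ^+ 2 & Num.sqrt m = q.
  by exists (q ^+ 2) => //; rewrite sqrtr_sqr gtr0_norm.
rewrite -em in qm.
have {}mM : 4 * (M + 1) <= m by exact: le_trans qm.
have m1 : 1 <= m by exact: le_trans qm.
have [M1m M2m Mm] : [/\ M + 1 <= m, 2 * M <= m & M < m] by move: M0; split; lra.
have m0 : 0 < m by apply: lt_le_trans m1.
exists m, (2 * C1), (4 * Q)^-1, lam0; split.
- by split; rewrite ?sm.
- by split => //; [rewrite mulr_gt0|rewrite invr_gt0 mulr_gt0].
- by split; rewrite ?/bet ?sm.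
move=> d T P F x v sys n lam l0 l1.
have lam1 : lam <= 1 by exact: le_trans l01.
have lamK : lam <= K by exact: le_trans lK.
have hbet t : m <= t -> bet lam t <= 1 /\ bet lam t <= K / 2.
  move=> mt; have hb := bet_mono _ _ _ _ l1 m1 mt.
  by split; apply: (le_trans hb); rewrite /bet sm.
have bnd2 := @gk2_bnd R; have bnd1 := @gk1_bnd R; have bnd0 := @gk_bnd R.
elim/ltn_ind: n => n IH hl.
have [N eN] : exists N, N = n%:R + m by exists (n%:R + m).
rewrite -eN in hl *.
have nm : n%:R <= N by rewrite eN lerDl ltW.
have N0 : 0 < N by rewrite eN ltr_wpDl.
have sN0 : 0 < Num.sqrt N by rewrite sqrtr_gt0.
move=> z; have [a ea] : exists a, a = z + lam * m by exists (z + lam * m).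
have hm (k : R) : k <= n%:R -> m <= N - k by move=> kn; rewrite lerBrDl eN lerD2r.
have hk k : (k < n)%N -> bet lam (N - k%:R) <= 1 /\ bet lam (N - k%:R) <= K / 2 /\
    2 * (M + 1) <= N - k%:R.
  move=> kn; have mt : m <= N - k%:R by apply: hm; rewrite ler_nat ltnW.
  have [h1 h2] := hbet _ mt; split => //; split => //; apply: le_trans mt.
  by apply: le_trans mM; rewrite ler_wpM2r// ler_nat.
have hlin := lindeberg P F x v K L M L0 M0 sys gk gk1 gk2 C (10 * expR 18) 3 (ltW C0)
  hC bnd0 bnd1 bnd2
  (fun k => sm_gk _ (md_sigma sys k)) (fun k => sm_gk1 _ (md_sigma sys k))
  (fun k => sm_gk2 _ (md_sigma sys k)) lam N a n l0 hk.
have [EN eEN] : exists EN, EN = Ex P (fun w => gk (N - psum v n w) (psum x n w - a)).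
  by exists (Ex P (fun w => gk (N - psum v n w) (psum x n w - a))).
rewrite -eEN -eC' in hlin.
have [D D0 eD] : exists2 D, 0 < D & D = expR (- (lam * a) + lam ^+ 2 * N / 2).
  by exists (expR (- (lam * a) + lam ^+ 2 * N / 2)); rewrite ?expR_gt0.
have h1 : gk N (- a) <= D * (Num.sqrt N)^-1.
  rewrite /gk eD mulrC ler_pM//; rewrite ?expR_ge0 ?mulr_ge0 ?normal_peak_ge0 ?invr_ge0 ?(ltW sN0)//.
    rewrite ler_expR.
    have -> : - (- a) ^+ 2 / (2 * N) = - (lam * a) + lam ^+ 2 * N / 2 - (a - lam * N) ^+ 2 / (2 * N).
      by field; rewrite gt_eqF.
    by rewrite lerBlDr lerDl divr_ge0 ?sqr_ge0// mulr_ge0 ?(ltW N0).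
  by rewrite ger_pMl ?invr_gt0// peak_le1.
have h2 : \sum_(k < n) ((Num.sqrt (N - k%:R))^-1 * bet lam (N - k%:R) ^+ 3 *
    Ex P (fun w => kap lam (N - k%:R) (psum x k w - a))) <=
    D * (8 * C1) * (Cs / Num.sqrt N * (lam ^+ 3 * N + q^-1)).
  have := hCs m n lam m1 l0; rewrite -eN sm => hs.
  have DC0 : 0 <= D * (8 * C1) by apply: mulr_ge0; [exact: ltW|apply: mulr_ge0 => //; exact: ltW].
  apply: le_trans (ler_wpM2l DC0 hs).
  rewrite mulr_sumr; apply: ler_sum => k _.
  have kn : k%:R + 1 <= n%:R :> R by rewrite natr1 ler_nat.
  have k0 : 0 <= k%:R :> R by [].
  have mt : m <= N - k%:R by apply: hm; rewrite ler_nat ltnW.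
  have Nk0 : 0 < N - k%:R by apply: lt_le_trans mt.
  have st0 : 0 < Num.sqrt (N - k%:R) by rewrite sqrtr_gt0.
  have hk3 : lam ^+ 3 * (k%:R + m) <= (4 * Q)^-1.
    by apply: le_trans hl; rewrite ler_wpM2l ?exprn_ge0// eN lerD2r ler_nat ltnW.
  have := IH k (ltn_ord k) hk3; rewrite sm => hc.
  have := kap_conc P F x v K L M L0 sys lam a N q _ k l0 lamK _ _ hc.
  rewrite -eD => H.
  have be0 : 0 <= bet lam (N - k%:R) by rewrite addr_ge0// invr_ge0 ltW.
  apply: le_trans (ler_wpM2l _ (H _ _)) _.
  - by rewrite mulr_ge0 ?exprn_ge0// invr_ge0 ltW.
  - by [].
  - by rewrite -sm ler_sqrt ?(ltW Nk0).
  have skm : 0 < Num.sqrt (k%:R + m) by rewrite sqrtr_gt0 ltr_wpDl.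
  rewrite le_eqVlt; apply/orP; left; apply/eqP.
  by field; rewrite !gt_eqF.
have EN_le : EN <= D * (2 * (Num.sqrt N)^-1).
  have : EN <= gk N (- a) + C' * (D * (8 * C1) * (Cs / Num.sqrt N * (lam ^+ 3 * N + q^-1))).
    rewrite -lerBlDl; apply: le_trans (ler_wpM2l (ltW C'0) h2).
    by move: hlin; rewrite ler_norml => /andP[_].
  have -> : C' * (D * (8 * C1) * (Cs / Num.sqrt N * (lam ^+ 3 * N + q^-1))) =
    D * (Num.sqrt N)^-1 * (Q * (lam ^+ 3 * N) + q^-1 * Q) by rewrite eQ; ring.
  have x1 : Q * (lam ^+ 3 * N) <= 4^-1.
    apply: le_trans (ler_wpM2l (ltW Q0) hl) _.
    by rewrite invfM mulrCA divff ?mulr1// gt_eqF.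
  have x2 : 0 < D * (Num.sqrt N)^-1 by rewrite mulr_gt0 ?invr_gt0.
  have := ler_wpM2l (ltW x2) (lerD x1 iqQ); clear - h1 x2.
  lra.
have key : Ex P (fun w => tiltw x lam n w * near_ind (Num.sqrt m) (psum x n w - z)) <=
  C1 * q * D^-1 * EN.
  have iEN : itg P (fun w => gk (N - psum v n w) (psum x n w - a)).
    apply: (fS_itg P F x v K L M sys gk (10 * expR 18)) => //.
      by move=> k; exact: sm_gk _ (md_sigma sys k).
    by apply: le_trans (hm _ (lexx _)); rewrite addrC.
  rewrite eEN -ExZ//; apply: Ex_le.
  - apply: (itg_wt P _ (tiltw_ge0 x lam n) (tiltw_itg P F x v K L M L0 sys lam n l0 lamK)
      (near_ind (Num.sqrt m)) (fun w => psum x n w - z)).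
    + exact: measurable_near_ind.
    + by apply: measurable_funB => //; exact: (meas_S P F x v K L M sys n).
    + by move=> b; exact: ind_norm.
  - exact: itgZ.
  move=> w; have cD0 : 0 <= C1 * q * D^-1 by rewrite !mulr_ge0 ?invr_ge0 ?(ltW C10) ?(ltW q0) ?(ltW D0).
  have Vb : `|psum v n w - n%:R| <= M by exact: (md_V sys).
  have s0 : 0 < N - psum v n w.
    move: Vb; rewrite ler_norml eN => /andP[_ Vb].
    by rewrite subr_gt0 -ltrBlDl (le_lt_trans Vb).
  rewrite {1}/near_ind; case: ifPn => [hy|_]; last first.
    by rewrite mulr0 mulr_ge0 ?(ltW (gk_gt0 _ _ s0)).
  rewrite mulr1.
  have h := gk_lower lam m (N - psum v n w) (psum x n w) z l0 lam1 m1 _ _ _ hy.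
  have -> : tiltw x lam n w = C1 * q * D^-1 * (c1 * q^-1 *
     expR (lam * (psum x n w - a) + lam ^+ 2 * m / 2)).
    have -> : expR (lam * (psum x n w - a) + lam ^+ 2 * m / 2) = tiltw x lam n w * D.
      by rewrite eD -expRD; congr expR; rewrite eN; field.
    by rewrite eC1; field; rewrite !gt_eqF.
  rewrite ler_wpM2l// ec1 -sm ea; apply: h.
  - by [].
  - by rewrite sm.
  - rewrite (_ : N - psum v n w - m = - (psum v n w - n%:R)) ?normrN//.
    by rewrite eN; ring.
apply: le_trans key _; rewrite sm.
have x0 : 0 < C1 * q * D^-1 by rewrite !mulr_gt0 ?invr_gt0.
apply: le_trans (ler_wpM2l (ltW x0) EN_le) _.
by rewrite le_eqVlt; apply/orP; left; apply/eqP; field; rewrite !gt_eqF.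
Qed.

End concentration.

(** * Moderate deviations *)

Section unsmooth.
Context {R : realType}.

Lemma Phi_step (i u : R) : 0 <= i <= 1 -> (0 < u -> i = 1) -> (u < 0 -> i = 0) ->
  `|i - Phi u| <= expR (- u ^+ 2 / 2).
Proof.
move=> /andP[i0 i1] hp hn; have p0 := Phi_ge0 u; have p1 := Phi_le1 u.
have [u0|u0|u0] := ltgtP u 0.
- rewrite (hn u0) sub0r normrN ger0_norm// -[u in Phi u]opprK.
  apply: le_trans (Phi_tail _ _) _; first by lra.
  by rewrite sqrrN.
- rewrite (hp u0) ger0_norm ?subr_ge0//.
  by have := Phi_tail1 _ (ltW u0); lra.
- have := Phi_sym u; rewrite u0 oppr0 (_ : - 0 ^+ 2 / 2 = 0); last by ring.
  by rewrite expR0 ler_norml; lra.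
Qed.

Lemma gauss_kernel (lam m s y : R) : 0 < s -> s <= 2 * m -> 0 <= bet lam m -> bet lam m <= 1 ->
  0 <= lam -> 1 <= m ->
  expR (- (y / Num.sqrt s) ^+ 2 / 2) <=
    expR m * (expR (lam * y + lam ^+ 2 * m / 2) * expR (- (`|y| / Num.sqrt m))).
Proof.
move=> s0 sm b0 b1 l0 m1; rewrite -!expRD ler_expR.
rewrite exprMn exprVn sqr_sqrtr; last exact: ltW.
have h1 : y ^+ 2 / (4 * m) <= y ^+ 2 / s / 2.
  rewrite -mulrA ler_wpM2l ?sqr_ge0// -invfM lef_pV2 ?posrE; lra.
have h2 : `|y| * bet lam m <= y ^+ 2 / (4 * m) + m.
  apply: le_trans (_ : `|y| <= _); first by rewrite ler_piMr.
  rewrite -subr_ge0.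
  have -> : y ^+ 2 / (4 * m) + m - `|y| = (`|y| - 2 * m) ^+ 2 / (4 * m).
    by rewrite -(real_normK (num_real y)); field; lra.
  by rewrite divr_ge0 ?sqr_ge0//; lra.
have h3 : - (lam * `|y|) <= lam * y.
  by rewrite -mulrN ler_wpM2l//; have := ler_norm (- y); rewrite normrN; lra.
have h4 : 0 <= lam ^+ 2 * m by rewrite mulr_ge0 ?sqr_ge0//; lra.
have h5 : `|y| * bet lam m = `|y| / Num.sqrt m + lam * `|y| by rewrite /bet; ring.
have -> : - (y ^+ 2 * s^-1) / 2 = - (y ^+ 2 / s / 2) by ring.
move: h1 h2; rewrite h5; move: (y ^+ 2 / _) (_ / s / 2) (`|y| / _) => a b c; lra.
Qed.

End unsmooth.

Section moderate.
Context {R : realType}.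
Variables (K L M : R).
Hypotheses (K0 : 0 < K) (L0 : 0 < L) (M0 : 0 < M).

Theorem moderate_deviation : exists m C c lam0 : R,
  [/\ 1 <= m, 0 < C, 0 < c, 0 < lam0 /\ lam0 <= 1 &
  forall d (T : measurableType d) (P : probability T R) F x v, md_sys P F x v K L M ->
  forall n (lam : R), 0 <= lam -> lam <= lam0 -> lam ^+ 3 * (n%:R + m) <= c ->
  forall ind : T -> R, measurable_fun setT ind -> (forall w, 0 <= ind w <= 1) ->
    (forall w, lam * (n%:R + m) < psum x n w -> ind w = 1) ->
    (forall w, psum x n w < lam * (n%:R + m) -> ind w = 0) ->
    `|Ex P ind - Phi (- (lam * Num.sqrt (n%:R + m)))| <=
    C * expR (- (lam ^+ 2 * (n%:R + m) / 2)) *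
      (1 + lam ^+ 2 * (n%:R + m) + ln (n%:R + m)) / Num.sqrt (n%:R + m)].
Proof.
have [m [A [c [lam0 [[m1 mM Mm] [A0 c0 lam00] [la lb lc ld] hconc]]]]] := concentration K L M K0 L0 M0.
have B0 : 0 <= M + 1 by move: M0; lra.
have [C3 C30 l3] := loc_gk2 (M + 1) B0.
have [C4 C40 l4] := loc_gk3 (M + 1) B0.
have Bv0 : 0 <= 2 * M + 1 by move: M0; lra.
have [C C0 hC] := heat_step _ _ _ _ _ 2 K (M + 1) (2 * M + 1) C3 C4 K0 Bv0 C30 C40 heat_gPhi l3 l4.
have [Cs Cs0 hCs] := @sum_bet2 R.
have [C' C'0 eC'] : exists2 C', 0 < C' & C' = C * (1 + L) * (2 * M + 1).
  by exists (C * (1 + L) * (2 * M + 1)) => //; rewrite !mulr_gt0//; move: L0 M0; lra.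
have m0 : 0 < m by apply: lt_le_trans m1.
have sm0 : 0 < Num.sqrt m by rewrite sqrtr_gt0.
have [M1m M2m Mm'] : [/\ M + 1 <= m, 2 * (M + 1) <= m & M < m] by move: M0; split; lra.
exists m, (C' * (4 * A) * Cs + 4 * A * expR m * Num.sqrt m), c, lam0; split => //.
  by rewrite addr_gt0// !mulr_gt0 ?expR_gt0.
clear l3 l4 C30 C40.
move=> d T P F x v sys n lam l0 l1 hl ind mind ind01 ind1 ind0.
have hcl k : (k <= n)%N -> conc P x lam (Num.sqrt m) k (A * Num.sqrt m / Num.sqrt (k%:R + m)).
  move=> kn; apply: (hconc _ _ _ F x v) => //.
  by apply: le_trans hl; rewrite ler_wpM2l ?exprn_ge0// lerD2r ler_nat.
clear hconc.
have [N eN] : exists N, N = n%:R + m by exists (n%:R + m).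
rewrite -eN in hl ind1 ind0 *.
have nm : n%:R <= N by rewrite eN lerDl ltW.
have N1 : 1 <= N by rewrite eN -[leLHS]add0r lerD.
have N0 : 0 < N by apply: lt_le_trans N1.
have sN0 : 0 < Num.sqrt N by rewrite sqrtr_gt0.
have lam1 : lam <= 1 by exact: le_trans la.
have lamK : lam <= K by exact: le_trans lb.
have hm (k : R) : k <= n%:R -> m <= N - k by move=> kn; rewrite lerBrDl eN lerD2r.
have hbet t : m <= t -> bet lam t <= 1 /\ bet lam t <= K / 2.
  move=> mt; have hb := bet_mono _ _ _ _ l1 m1 mt.
  by split; apply: (le_trans hb).
have [a ea] : exists a, a = lam * N by exists (lam * N).
rewrite -ea in ind1 ind0.
have hk k : (k < n)%N -> bet lam (N - k%:R) <= 1 /\ bet lam (N - k%:R) <= K / 2 /\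
    2 * (M + 1) <= N - k%:R.
  move=> kn; have mt : m <= N - k%:R by apply: hm; rewrite ler_nat ltnW.
  by have [h1 h2] := hbet _ mt; split => //; split => //; apply: le_trans mt.
have bPhi : bounded_family (10 * expR 18) (@gPhi R).
  move=> s y s1; apply: le_trans (gPhi_bnd s y) _.
  have h18 : (1 : R) <= expR 18 by rewrite -expR0 ler_expR.
  by apply: le_trans h18 _; rewrite ler_peMl ?expR_ge0// ler1n.
have hlin := lindeberg P F x v K L M L0 M0 sys gPhi gk gk1 C (10 * expR 18) 2 (ltW C0)
  hC bPhi gk_bnd gk1_bnd
  (fun k => sm_gPhi _ (md_sigma sys k)) (fun k => sm_gk _ (md_sigma sys k))
  (fun k => sm_gk1 _ (md_sigma sys k)) lam N a n l0 hk.
rewrite -eC' in hlin.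
have iEN : itg P (fun w => gPhi (N - psum v n w) (psum x n w - a)).
  apply: (fS_itg P F x v K L M sys gPhi (10 * expR 18)) => //.
    by move=> k; exact: sm_gPhi _ (md_sigma sys k).
  by apply: le_trans (hm _ (lexx _)); rewrite addrC.
have iind : itg P ind.
  by apply: (itg_bnd _ _ 1) => // w; have /andP[i0 i1] := ind01 w; rewrite ger0_norm.
have [EN eEN] : exists EN, EN = Ex P (fun w => gPhi (N - psum v n w) (psum x n w - a)).
  by exists (Ex P (fun w => gPhi (N - psum v n w) (psum x n w - a))).
rewrite -eEN in hlin.
have [D D0 eD] : exists2 D, 0 < D & D = expR (- (lam ^+ 2 * N / 2)).
  by exists (expR (- (lam ^+ 2 * N / 2))); rewrite ?expR_gt0.
have eD' : expR (- (lam * a) + lam ^+ 2 * N / 2) = D.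
  by rewrite eD ea; congr expR; field.
rewrite -eD.
have h2 : \sum_(k < n) ((Num.sqrt (N - k%:R))^-1 * bet lam (N - k%:R) ^+ 2 *
    Ex P (fun w => kap lam (N - k%:R) (psum x k w - a))) <=
    D * (4 * A) * (Cs / Num.sqrt N * (lam ^+ 2 * N + 1 + ln N)).
  have := hCs m n lam m1 l0; rewrite -eN => hs.
  have DC0 : 0 <= D * (4 * A) by apply: mulr_ge0; [exact: ltW|apply: mulr_ge0 => //; exact: ltW].
  apply: le_trans (ler_wpM2l DC0 hs).
  rewrite mulr_sumr; apply: ler_sum => k _.
  have kn : k%:R + 1 <= n%:R :> R by rewrite natr1 ler_nat.
  have k0 : 0 <= k%:R :> R by [].
  have mt : m <= N - k%:R by apply: hm; rewrite ler_nat ltnW.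
  have Nk0 : 0 < N - k%:R by apply: lt_le_trans mt.
  have st0 : 0 < Num.sqrt (N - k%:R) by rewrite sqrtr_gt0.
  have hc := hcl k (ltnW (ltn_ord k)).
  have := kap_conc P F x v K L M L0 sys lam a N (Num.sqrt m) _ k l0 lamK sm0 _ hc.
  rewrite eD' => H.
  have be0 : 0 <= bet lam (N - k%:R) by rewrite addr_ge0// invr_ge0 ltW.
  apply: le_trans (ler_wpM2l _ (H _)) _.
  - by rewrite mulr_ge0 ?exprn_ge0// invr_ge0 ltW.
  - by rewrite ler_sqrt ?(ltW Nk0).
  have skm : 0 < Num.sqrt (k%:R + m) by rewrite sqrtr_gt0 ltr_wpDl.
  rewrite le_eqVlt; apply/orP; left; apply/eqP.
  by field; rewrite !gt_eqF.
have h3 : `|EN - Phi (- (lam * Num.sqrt N))| <=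
    C' * (D * (4 * A) * (Cs / Num.sqrt N * (lam ^+ 2 * N + 1 + ln N))).
  have -> : Phi (- (lam * Num.sqrt N)) = gPhi N (- a).
    rewrite /gPhi ea; congr Phi.
    rewrite -[X in _ = - (lam * X) / _](sqr_sqrtr (ltW N0)).
    by field; rewrite gt_eqF.
  by apply: le_trans hlin _; rewrite ler_wpM2l// ltW.
have h4 : `|Ex P ind - EN| <= expR m * D * (4 * (A * Num.sqrt m / Num.sqrt N)).
  rewrite eEN -ExB//.
  have iw := tiltw_itg P F x v K L M L0 sys lam n l0 lamK.
  have mS := meas_S P F x v K L M sys n.
  have hb := exp_kernel_bound P (tiltw x lam n) (Num.sqrt m) (tiltw_ge0 x lam n) iw sm0
     (psum x n) _ (Num.sqrt m) mS (lexx _) (hcl n (leqnn n)) a.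
  have iker : itg P (fun w => tiltw x lam n w * expR (- (`|psum x n w - a| / Num.sqrt m))).
    apply: (itg_wt P _ (tiltw_ge0 x lam n) iw (fun b => expR (- (`|b| / Num.sqrt m)))
       (fun w => psum x n w - a)).
    - apply: measurableT_comp => //; apply: measurableT_comp; first exact: oppr_measurable.
      by apply: measurable_funM => //; exact: normr_measurable.
    - exact: measurable_funB.
    - by move=> b; rewrite ger0_norm ?expR_ge0// -expR0 ler_expR oppr_le0 divr_ge0 ?sqrtr_ge0.
  have x0 : 0 <= expR m * D by rewrite mulr_ge0 ?expR_ge0 ?(ltW D0).
  apply: le_trans (_ : expR m * D * Ex P (fun w => tiltw x lam n w *
      expR (- (`|psum x n w - a| / Num.sqrt m))) <= _); last first.
    rewrite ler_wpM2l//; apply: le_trans hb _; rewrite -eN.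
    by rewrite le_eqVlt; apply/orP; left; apply/eqP; field; rewrite !gt_eqF.
  rewrite -ExZ//; apply: Ex_abs; [exact: itgB|exact: itgZ|move=> w].
  have Vb : `|psum v n w - n%:R| <= M by exact: (md_V sys).
  have [s0 sm] : 0 < N - psum v n w /\ N - psum v n w <= 2 * m.
    by move: Vb Mm' M2m; rewrite ler_norml eN; clear; lra.
  have [s es] : exists s, s = N - psum v n w by exists (N - psum v n w).
  have [y ey] : exists y, y = psum x n w - a by exists (psum x n w - a).
  rewrite -es -ey in s0 sm *.
  have ss0 : 0 < Num.sqrt s by rewrite sqrtr_gt0.
  have b0 : 0 <= bet lam m by rewrite addr_ge0// invr_ge0 ltW.
  have b1 : bet lam m <= 1 by have [] := hbet m (lexx m).
  apply: le_trans (_ : expR (- (y / Num.sqrt s) ^+ 2 / 2) <= _).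
    apply: Phi_step => //.
    - by rewrite pmulr_lgt0 ?invr_gt0// ey subr_gt0 => h; apply: ind1.
    - by rewrite pmulr_llt0 ?invr_gt0// ey subr_lt0 => h; apply: ind0.
  apply: le_trans (gauss_kernel lam m s y s0 sm b0 b1 l0 m1) _.
  have -> : expR (lam * y + lam ^+ 2 * m / 2) = D * tiltw x lam n w.
    by rewrite eD -expRD; congr expR; rewrite ey ea eN; field.
  by rewrite le_eqVlt; apply/orP; left; apply/eqP; ring.
have -> : Ex P ind - Phi (- (lam * Num.sqrt N)) =
  (Ex P ind - EN) + (EN - Phi (- (lam * Num.sqrt N))) by ring.
apply: le_trans (ler_normD _ _) _; apply: le_trans (lerD h4 h3) _.
have [Y eY] : exists Y, Y = 1 + lam ^+ 2 * N + ln N by exists (1 + lam ^+ 2 * N + ln N).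
rewrite -eY; have Y1 : 0 <= Y - 1.
  by rewrite subr_ge0 eY -addrA lerDl addr_ge0 ?ln_ge0// mulr_ge0 ?sqr_ge0 ?(ltW N0).
have -> : lam ^+ 2 * N + 1 + ln N = Y by rewrite eY; ring.
rewrite -subr_ge0.
have -> : (C' * (4 * A) * Cs + 4 * A * expR m * Num.sqrt m) * D * Y / Num.sqrt N -
  (expR m * D * (4 * (A * Num.sqrt m / Num.sqrt N)) + C' * (D * (4 * A) * (Cs / Num.sqrt N * Y))) =
  4 * A * expR m * Num.sqrt m * D / Num.sqrt N * (Y - 1) by ring.
rewrite mulr_ge0//.
by rewrite !mulr_ge0 ?expR_ge0 ?invr_ge0 ?(ltW A0) ?(ltW sm0) ?(ltW D0) ?(ltW sN0).
Qed.

End moderate.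

Section conditioning.
Context {d : measure_display} {T : measurableType d} {R : realType}.

Lemma cond_prob (P : probability T R) (D : set T) : measurable D -> (0 < P D)%E ->
  exists Q : probability T R,
    (forall A, measurable A -> (Q A = ((fine (P D))^-1)%:E * P (A `&` D))%E) /\
    (forall B (f : T -> \bar R), measurable B -> measurable_fun setT f ->
      (forall w, (0 <= f w)%E) ->
      (\int[Q]_(w in B) f w = ((fine (P D))^-1)%:E * \int[P]_(w in B `&` D) f w)%E).
Proof.
move=> mD PD0.
pose Q : probability T R := mnormalize (mrestr P mD) P.
have QE A : measurable A -> (Q A = ((fine (P D))^-1)%:E * P (A `&` D))%E.
  move=> mA; rewrite /Q /= /mnormalize /= /mrestr setTI.
  rewrite gt_eqF//= lt_eqF ?ltey_eq ?fin_num_measure//=.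
  by rewrite muleC.
exists Q; split => // B f mB mf f0.
have c0 : 0 <= (fine (P D))^-1 by rewrite invr_ge0 fine_ge0.
have mBD : measurable (B `&` D) by exact: measurableI.
rewrite (@ge0_negligible_integral _ _ _ Q B (B `\` D)) //; last 3 first.
- exact: measurableD.
- exact: measurable_funTS.
- apply: (eq_trans (QE _ _)); first exact: measurableD.
  by rewrite setDE -setIA setICl setI0 measure0 mule0.
rewrite setDD.
rewrite (eq_measure_integral (mscale (NngNum c0) P)); last first.
  move=> A mA AB; apply: (eq_trans (QE _ mA)); rewrite /mscale /=; congr (_ * P _)%E.
  by apply/setIidPl; apply: subset_trans AB _; exact: subIsetr.
by rewrite ge0_integral_mscale//; exact: measurable_funTS.
Qed.

Lemma cond_sys (P : probability T R) (F : nat -> set (set T)) (x v : nat -> T -> R) (K L M : R)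
    (D : set T) (j : nat) : 0 < L -> md_sys P F x v K L M -> F j D -> (0 < P D)%E ->
  exists Q : probability T R,
    md_sys Q (fun k => F (j + k)%N) (fun k => x (j + k)%N) (fun k => v (j + k)%N) K L (2 * M) /\
    (forall A, measurable A -> (Q A = ((fine (P D))^-1)%:E * P (A `&` D))%E).
Proof.
move=> L0 sys FD PD0.
have mD : measurable D by exact: (md_meas sys j).
have [Q [QE QI]] := cond_prob P D mD PD0.
exists Q; split => //.
have c0 : (0 <= ((fine (P D))^-1)%:E)%E by rewrite lee_fin invr_ge0 fine_ge0.
have mx k : measurable_fun setT (x k) by exact: (md_x_meas _ _ _ _ _ _ _ sys).
have mv k : measurable_fun setT (v k) by exact: (md_v_meas _ _ _ _ _ _ _ sys).
have inD k A : F (j + k)%N A -> F (j + k)%N (A `&` D).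
  have sF := md_sigma sys (j + k).
  have FD' : F (j + k)%N D by apply: (md_incl_le _ _ _ _ _ _ _ sys j (j + k)) => //; exact: leq_addr.
  move=> FA; have := sigma_algebra_id sF => e.
  by rewrite -e; apply: (@measurableI _ (g_sigma_algebraType (F (j + k)%N)));
    [move: FA|move: FD']; rewrite -{1}e.
split.
- by move=> k; exact: (md_sigma sys).
- by move=> k; exact: (md_meas sys).
- by move=> k; rewrite addnS; exact: (md_incl sys).
- by move=> k; rewrite addnS; exact: (md_x sys).
- by move=> k; exact: (md_v sys).
- by move=> k w; exact: (md_v0 sys).
- move=> k w; have h1 := md_V sys (j + k) w; have h2 := md_V sys j w.
  move: h1; rewrite big_split_ord /= natrD => h1.
  by move: h1 h2; rewrite !ler_norml; lra.
- move=> k A FA; have mA := md_meas sys _ _ FA.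
  rewrite !QI//; try by move=> w; rewrite lee_fin le_max lexx orbT.
  + by congr (_ * _)%E; apply: (md_mean sys); exact: inD.
  + by apply/measurable_EFinP; apply: measurable_maxr => //; apply: measurableT_comp => //; exact: oppr_measurable.
  + by apply/measurable_EFinP; apply: measurable_maxr.
- move=> k A FA; have mA := md_meas sys _ _ FA.
  rewrite !QI//; try by move=> w; rewrite lee_fin ?sqr_ge0 ?(md_v0 sys).
  + by congr (_ * _)%E; apply: (md_var sys); exact: inD.
  + by apply/measurable_EFinP.
  + by apply/measurable_EFinP; exact: measurable_funX.
- move=> k A FA; have mA := md_meas sys _ _ FA.
  rewrite !QI//.
  + by apply: lee_wpmul2l => //; apply: (md_third sys); exact: inD.
  + by apply/measurable_EFinP; exact: measurable_funM.
  + by move=> w; rewrite lee_fin mulr_ge0 ?(md_v0 sys)// ltW.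
  + apply/measurable_EFinP; apply: measurable_funM.
      by apply: measurable_funX; apply: measurableT_comp.
    by apply: measurableT_comp => //; apply: measurable_funM => //; apply: measurableT_comp.
Qed.

End conditioning.

Section chernoff.
Context {R : realType}.

Lemma expR_taylor (u : R) : expR u <= 1 + u + u ^+ 2 / 2 + `|u| ^+ 3 * expR `|u|.
Proof.
have h := taylor3 expR expR expR expR 0 u (expR `|u|) (@is_derive_expR R) (@is_derive_expR R)
  (@is_derive_expR R).
have hz z : `|z - 0| <= `|u| -> `|expR z| <= expR `|u|.
  rewrite subr0 => zu; rewrite ger0_norm ?expR_ge0// ler_expR.
  by apply: le_trans zu; exact: ler_norm.
by move: {h}(h hz) => h; move: h; rewrite add0r expR0 !mul1r ler_norml; lra.
Qed.

Context {d : measure_display} {T : measurableType d}.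
Variables (P : probability T R) (F : nat -> set (set T)) (x v : nat -> T -> R) (K L M : R).
Hypotheses (K0 : 0 < K) (L0 : 0 < L) (M0 : 0 < M).
Hypothesis sys : md_sys P F x v K L M.

Lemma exp_moment (lam : R) n : 0 <= lam -> lam <= K ->
  Ex P (fun w => expR (lam * psum x n w)) <= expR ((lam ^+ 2 / 2 + L * lam ^+ 3) * (n%:R + M)).
Proof.
move=> l0 lK; set a := _ + L * _.
have a0 : 0 <= a by rewrite addr_ge0 ?mulr_ge0 ?exprn_ge0 ?divr_ge0 ?sqr_ge0// ltW.
pose G k w := expR (lam * psum x k w - a * psum v k w).
have V0 k w : 0 <= psum v k w by apply: sumr_ge0 => i _; exact: (md_v0 sys).
have mG k : sub_measurable (F k) (G k).
  apply: sm_expR; apply: (sm_sub _ (md_sigma sys k)); apply: (sm_scale _ (md_sigma sys k)).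
    exact: (sm_S P F x v K L M sys).
  exact: (sm_V P F x v K L M sys).
have iG k : itg P (G k).
  apply: itg_dom (exp_itg P F x v K L M L0 sys lam k l0 lK) _.
    exact: (sm_meas _ (md_meas sys k) _ (mG k)).
  move=> w; rewrite ger0_norm ?expR_ge0// ler_expR.
  by have := mulr_ge0 a0 (V0 k w); lra.
have key k : Ex P (G k) <= 1.
  elim: k => [|k ih].
    rewrite (_ : G 0%N = cst 1) ?Ex_cst//.
    by apply/funext => w; rewrite /G !psum0 !mulr0 subr0 expR0.
  apply: le_trans ih.
  pose H w := G k w * expR (- (a * v k w)).
  have mH : sub_measurable (F k) H.
    apply: (sm_mul _ (md_sigma sys k)) => //; apply: sm_expR; apply: sm_opp.
    apply: (sm_scale _ (md_sigma sys k)); exact: (md_v sys).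
  have H0 w : 0 <= H w by rewrite mulr_ge0 ?expR_ge0.
  have iH : itg P H.
    apply: itg_dom (iG k) _; first exact: (sm_meas _ (md_meas sys k) _ mH).
    move=> w; rewrite ger0_norm// -[leRHS]mulr1 ler_wpM2l ?expR_ge0// -expR0 ler_expR oppr_le0.
    by rewrite mulr_ge0 ?(md_v0 sys).
  have ix := cond_itg_x _ _ _ _ _ _ _ sys k H mH H0 iH.
  have iv := cond_itg_v _ _ _ _ _ _ _ sys k H mH H0 iH.
  have i2 := cond_itg_sq _ _ _ _ _ _ _ sys k H mH H0 iH.
  have i3 := cond_itg_third _ _ _ _ _ _ _ L0 sys k H mH H0 iH.
  have e1 := cond_mean _ _ _ _ _ _ _ sys k H mH H0 iH.
  have e2 := cond_var _ _ _ _ _ _ _ sys k H mH H0 iH.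
  have e3 := cond_third_le _ _ _ _ _ _ _ L0 sys k H mH H0 iH.
  have j1 := itgZ _ lam _ ix; have j2 := itgZ _ (lam ^+ 2 / 2) _ i2.
  have j3 := itgZ _ (lam ^+ 3) _ i3; have jv := itgZ _ a _ iv.
  apply: le_trans (_ : Ex P (fun w => H w + lam * (H w * x k w) + lam ^+ 2 / 2 * (H w * x k w ^+ 2) +
      lam ^+ 3 * (H w * (`|x k w| ^+ 3 * expR (K * `|x k w|)))) <= _).
    apply: Ex_le => //.
      by apply: itgD => //; apply: itgD => //; exact: itgD.
    move=> w; rewrite /G !psumS.
    have -> : expR (lam * (psum x k w + x k w) - a * (psum v k w + v k w)) = H w * expR (lam * x k w).
      by rewrite /H /G -!expRD; congr expR; ring.
    apply: le_trans (ler_wpM2l (H0 w) (expR_taylor (lam * x k w))) _.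
    have h3 : `|lam * x k w| ^+ 3 * expR `|lam * x k w| <= lam ^+ 3 * (`|x k w| ^+ 3 * expR (K * `|x k w|)).
      rewrite normrM (ger0_norm l0) exprMn -mulrA ler_wpM2l ?exprn_ge0// ler_wpM2l ?exprn_ge0//.
      by rewrite ler_expR ler_wpM2r.
    by have := ler_wpM2l (H0 w) h3; lra.
  rewrite ExD//; last by apply: itgD => //; exact: itgD.
  rewrite ExD//; last exact: itgD.
  rewrite ExD// !ExZ// e1 e2 mulr0 addr0.
  apply: le_trans (_ : Ex P (fun w => H w + a * (H w * v k w)) <= _).
    rewrite ExD// ExZ//.
    by have := ler_wpM2l (exprn_ge0 3 l0) e3; rewrite /a; lra.
  apply: Ex_le => //; first exact: itgD.
  move=> w; have := ler_wpM2l (H0 w) (expR_ge1Dx (a * v k w)).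
  have -> : H w * expR (a * v k w) = G k w by rewrite /H -mulrA -expRD addNr expR0 mulr1.
  lra.
rewrite -[leRHS]mulr1; apply: le_trans (ler_wpM2l (expR_ge0 _) (key n)).
rewrite -ExZ//; apply: Ex_le => [||w]; [exact: (exp_itg P F x v K L M L0 sys)|exact: itgZ|].
rewrite -expRD ler_expR.
have Vb : `|psum v n w - n%:R| <= M by exact: (md_V sys).
have : a * psum v n w <= a * (n%:R + M).
  by rewrite ler_wpM2l//; move: Vb; rewrite ler_norml; lra.
lra.
Qed.

Lemma exp_tail_bound (lam y : R) n (ind : T -> R) : 0 <= lam -> lam <= K ->
  measurable_fun setT ind -> (forall w, 0 <= ind w <= 1) ->
  (forall w, psum x n w < y -> ind w = 0) ->
  Ex P ind <= expR (- (lam * y) + (lam ^+ 2 / 2 + L * lam ^+ 3) * (n%:R + M)).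
Proof.
move=> l0 lK mi i01 ind0.
have ii : itg P ind.
  by apply: (itg_bnd _ _ 1) => // w; have /andP[i0 i1] := i01 w; rewrite ger0_norm.
have ie := exp_itg P F x v K L M L0 sys lam n l0 lK.
rewrite expRD; apply: le_trans (ler_wpM2l (expR_ge0 _) (exp_moment lam n l0 lK)).
rewrite -ExZ//; apply: Ex_le => [||w]; [by []|exact: itgZ|].
rewrite -expRD; have /andP[i0 i1] := i01 w.
have [h|h] := leP y (psum x n w); last by rewrite ind0// expR_ge0.
apply: le_trans i1 _; rewrite -expR0 ler_expR addrC subr_ge0.
by rewrite ler_wpM2l.
Qed.

End chernoff.

Section asymptotics.
Context {R : realType}.

Lemma ex_nat_ge (r : R) : exists n0 : nat, forall n, (n0 <= n)%N -> r <= n%:R.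
Proof.
exists (Num.truncn r).+1 => n hn; apply: (@le_trans _ _ ((Num.truncn r).+1%:R)).
  by apply: ltW; exact: truncnS_gt.
by rewrite ler_nat.
Qed.

Lemma ln_sqr_bound (x : R) : 1 <= x -> ln x ^+ 2 <= 64 * Num.sqrt (Num.sqrt x).
Proof.
move=> x1; set y := Num.sqrt (Num.sqrt (Num.sqrt x)).
have s0 : 0 < Num.sqrt x by rewrite sqrtr_gt0; lra.
have s1 : 0 < Num.sqrt (Num.sqrt x) by rewrite sqrtr_gt0.
have y0 : 0 < y by rewrite sqrtr_gt0.
have e1 : Num.sqrt (Num.sqrt x) = y ^+ 2 by rewrite sqr_sqrtr// ltW.
have e2 : x = y ^+ 8.
  rewrite (_ : y ^+ 8 = ((y ^+ 2) ^+ 2) ^+ 2); last by ring.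
  rewrite -e1 sqr_sqrtr; last exact: ltW.
  by rewrite sqr_sqrtr//; lra.
have l0 : 0 <= ln y.
  apply: ln_ge0; rewrite leNgt; apply/negP => y1.
  have : y ^+ 8 < 1 by rewrite exprn_ilt1// ltW.
  by rewrite -e2; lra.
rewrite e1 {1}e2 lnXn//.
have : ln y <= y by apply: ltW; exact: ln_sublinear.
by rewrite -mulr_natl => h; nra.
Qed.

Lemma ln_sqr_small (e : R) : 0 < e ->
  exists n0 : nat, forall n, (n0 <= n)%N -> 1 <= ln n%:R :> R /\ (3 : R) <= n%:R /\
    (1 + 2 * ln n%:R ^+ 2) / Num.sqrt n%:R <= e.
Proof.
move=> e0.
have [n0 h0] := ex_nat_ge (expR 1 + 3 + (200 / e) ^+ 4).
exists n0 => n hn; have hx := h0 n hn.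
have h4 : 0 <= (200 / e) ^+ 4 by apply: exprn_ge0; apply: divr_ge0; [exact: ler0n|exact: ltW].
have e1 := @expR_gt0 R 1.
set x : R := n%:R in hx *.
have x3 : 3 <= x by lra.
have l1 : 1 <= ln x.
  by rewrite -[X in X <= _]expRK ler_ln ?posrE ?expR_gt0//; lra.
split => //; split => //.
have s0 : 0 < Num.sqrt x by rewrite sqrtr_gt0; lra.
have q0 : 0 < Num.sqrt (Num.sqrt x) by rewrite sqrtr_gt0.
set q := Num.sqrt (Num.sqrt x) in q0 *.
have eq : Num.sqrt x = q ^+ 2 by rewrite sqr_sqrtr// ltW.
have ex : x = q ^+ 4.
  by rewrite (_ : q ^+ 4 = (q ^+ 2) ^+ 2); [rewrite -eq sqr_sqrtr//; lra|ring].
have hq : 200 / e <= q.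
  rewrite leNgt; apply/negP => hlt.
  have : q ^+ 4 < (200 / e) ^+ 4.
    by rewrite ltrXn2r// ?nnegrE ?(ltW q0)// divr_ge0// ltW.
  by rewrite -ex; lra.
have q1 : 1 <= q.
  rewrite leNgt; apply/negP => hlt.
  have : q ^+ 4 < 1 by rewrite exprn_ilt1// ltW.
  by rewrite -ex; lra.
have := @ln_sqr_bound x ltac:(lra); rewrite -/q => hl.
rewrite eq ler_pdivrMr ?exprn_gt0//.
have hq' : 200 <= e * q by move: hq; rewrite ler_pdivrMr// mulrC.
apply: le_trans (_ : 200 * q <= _); first by lra.
by rewrite expr2 mulrA ler_wpM2r// ltW.
Qed.

Lemma cube_log_bound (w l : R) : 0 <= w -> 1 <= l ->
  (1 + w) * (w ^+ 2 + l) <= 1 + 3 * w ^+ 3 + 2 * l ^+ 2.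
Proof.
move=> w0 l1.
have h1 : w * l <= w ^+ 3 + l ^+ 2.
  have [h|h] := leP (w ^+ 2) l.
    have : w * l <= l ^+ 2.
      rewrite expr2 ler_wpM2r//; first by lra.
      rewrite leNgt; apply/negP => hlt; nra.
    by have := exprn_ge0 3 w0; lra.
  have : w * l <= w ^+ 3 by rewrite exprS ler_wpM2l// ltW.
  by have := sqr_ge0 l; lra.
have h2 : w ^+ 2 <= 1 + w ^+ 3.
  have [h|h] := leP w 1; first by have := exprn_ge0 3 w0; nra.
  have : w ^+ 2 <= w ^+ 3 by rewrite (exprS w 2) ler_peMl ?sqr_ge0// ltW.
  lra.
have -> : (1 + w) * (w ^+ 2 + l) = w ^+ 2 + w ^+ 3 + l + w * l by ring.
nra.
Qed.

Lemma cube_le (a b : R) : 0 <= b -> a ^+ 3 <= b ^+ 3 -> a <= b.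
Proof.
move=> b0 h; rewrite leNgt; apply/negP => ba.
have : b ^+ 3 < a ^+ 3 by rewrite ltrXn2r// nnegrE; lra.
lra.
Qed.

End asymptotics.

Lemma md_sys_mono {d} {T : measurableType d} {R : realType} (P : probability T R) F x v (K L M M' : R) :
  M <= M' -> md_sys P F x v K L M -> md_sys P F x v K L M'.
Proof.
move=> MM [h1 h2 h3 h4 h5 h6 h7 h8 h9 h10]; split => //.
by move=> k w; apply: le_trans (h7 k w) MM.
Qed.

(* Passing from the smoothed variance [N = nr + m] back to [nr] moves the Gaussian
   argument from [u = w sqrt (nr / N)] to [w]. *)
Section transfer.
Context {R : realType}.

Let le_sqr_mul (y l b : R) : 1 <= l -> 1 <= b -> y <= (y ^+ 2 + l) * b.
Proof.
move=> l1 b1; apply: (@le_trans _ _ ((y ^+ 2 + l) * 1)); first nra.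
by rewrite ler_wpM2l//; have := sqr_ge0 y; lra.
Qed.

Variables (m nr N s S w u : R).
Hypotheses (m1 : 1 <= m) (n3 : 3 <= nr) (s0 : 0 < s) (S0 : 0 < S) (es : s ^+ 2 = nr)
  (eN : N = nr + m) (eS : S ^+ 2 = N) (sS : s <= S) (s1 : 1 <= s) (l1 : 1 <= ln nr)
  (w0 : 0 <= w) (ws : w ^+ 3 <= s) (uE : u = w * (s / S)).

Let q0 : 0 < s / S. Proof. exact: divr_gt0. Qed.
Let q1 : s / S <= 1. Proof. by rewrite ler_pdivrMr// mul1r. Qed.
Let u0 : 0 <= u. Proof. by rewrite uE mulr_ge0// ltW. Qed.
Let uw : u <= w. Proof. by rewrite uE ler_piMr. Qed.
Let nr0 : 0 < nr. Proof. by apply: lt_le_trans n3. Qed.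
Let m0 : 0 < m. Proof. by apply: lt_le_trans m1. Qed.
Let N0 : 0 < N. Proof. by rewrite eN addr_gt0. Qed.
Let nN : nr <= N. Proof. by rewrite eN lerDl ltW. Qed.
Let mN : m <= N. Proof. by rewrite eN lerDr ltW. Qed.
Let w20 : 0 <= w ^+ 2. Proof. exact: sqr_ge0. Qed.

Let w2 : w ^+ 2 <= nr.
Proof.
have [h|h] := leP w 1.
  by apply: (@le_trans _ _ 1); [rewrite expr_le1|apply: le_trans n3; rewrite ler1n].
apply: (@le_trans _ _ (w ^+ 3)); first by rewrite (exprS w 2) ler_peMl// ltW.
by apply: le_trans ws _; rewrite -es expr2 ler_peMl// ltW.
Qed.

Lemma transfer_expR : expR (- (u ^+ 2 / 2)) <= expR (m / 2) * expR (- w ^+ 2 / 2).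
Proof.
rewrite -expRD ler_expR.
have : w ^+ 2 - u ^+ 2 <= m.
  have -> : w ^+ 2 - u ^+ 2 = w ^+ 2 * (m / N).
    rewrite uE exprMn expr_div_n es eS (_ : m = N - nr); last by rewrite eN addrC addKr.
    by field; rewrite gt_eqF.
  by rewrite mulrA ler_pdivrMr// [leRHS]mulrC ler_pM2r// (le_trans w2).
lra.
Qed.

Lemma transfer_ln : ln N <= ln nr + m.
Proof.
have mn0 : 0 < m / nr by rewrite divr_gt0.
have -> : N = nr * (1 + m / nr) by rewrite eN; field; rewrite gt_eqF.
rewrite lnM ?posrE ?addr_gt0// lerD2l; apply: le_trans (le_ln1Dx _) _.
  by rewrite (lt_trans _ mn0)// ltrN10.
by rewrite ler_pdivrMr// ler_peMr ?(ltW m0)// (le_trans _ n3)// ler1n.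
Qed.

Lemma transfer_dist : w - u <= m * ((w ^+ 2 + ln nr) / s).
Proof.
have q2 : 1 - s / S <= m / nr.
  apply: le_trans (_ : 1 - (s / S) ^+ 2 <= _).
    by rewrite lerD2l lerN2 expr2 ler_piMl// ltW.
  have -> : 1 - (s / S) ^+ 2 = m / N.
    rewrite expr_div_n es eS (_ : m = N - nr); last by rewrite eN addrC addKr.
    by field; rewrite gt_eqF.
  by rewrite ler_wpM2l ?(ltW m0)// lef_pV2 ?posrE.
have -> : w - u = w * (1 - s / S) by rewrite uE; ring.
apply: le_trans (ler_wpM2l w0 q2) _.
rewrite mulrCA ler_wpM2l ?(ltW m0)// -es expr2 invfM mulrA ler_pM2r ?invr_gt0//.
by rewrite ler_pdivrMr// -expr2 es; exact: le_sqr_mul.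
Qed.

Lemma transfer (C p : R) : 0 < C ->
  `|p - Phi (- u)| <= C * expR (- (u ^+ 2 / 2)) * (1 + u ^+ 2 + ln N) / S ->
  `|p - Phi (- w)| <= (C * expR (m / 2) * (2 + m) + m * expR (m / 2)) *
    expR (- w ^+ 2 / 2) * (w ^+ 2 + ln nr) / s.
Proof.
move=> C0 hmain.
have hexp := transfer_expR; have lnN := transfer_ln; have hd := transfer_dist.
set Ew := expR (- w ^+ 2 / 2) in hexp *.
have Ew0 : 0 < Ew by exact: expR_gt0.
have l0 : 0 <= ln N by apply: ln_ge0; rewrite (le_trans _ nN)// (le_trans _ n3)// ler1n.
have t2 : C * expR (- (u ^+ 2 / 2)) * (1 + u ^+ 2 + ln N) / S <=
    C * (expR (m / 2) * Ew) * ((2 + m) * (w ^+ 2 + ln nr)) / s.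
  apply: ler_pM.
  - by apply: mulr_ge0; [rewrite mulr_ge0 ?expR_ge0 ?(ltW C0)|rewrite !addr_ge0 ?sqr_ge0].
  - by rewrite invr_ge0 ltW.
  - apply: ler_pM; [by rewrite mulr_ge0 ?expR_ge0 ?(ltW C0)|by rewrite !addr_ge0 ?sqr_ge0| |].
      by rewrite ler_pM2l.
    have : u ^+ 2 <= w ^+ 2 by rewrite lerXn2r ?nnegrE.
    have : m * 1 <= m * ln nr by rewrite ler_pM2l.
    have : 0 <= m * w ^+ 2 by rewrite mulr_ge0 ?(ltW m0).
    move: lnN l1 w20; lra.
  - by rewrite lef_pV2 ?posrE.
have t3 : `|Phi (- u) - Phi (- w)| <= m * expR (m / 2) * Ew * ((w ^+ 2 + ln nr) / s).
  rewrite ger0_norm; last by rewrite subr_ge0 Phi_le// lerN2.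
  apply: le_trans (Phi_diff_upper _ _ u0 uw) _.
  have d2 : normal_peak 1 * expR (- u ^+ 2 / 2) <= expR (m / 2) * Ew.
    rewrite mulNr; apply: le_trans hexp.
    by rewrite ler_piMl ?expR_ge0// peak_le1.
  apply: le_trans (_ : (m * ((w ^+ 2 + ln nr) / s)) * (expR (m / 2) * Ew) <= _).
    apply: ler_pM => //; first by rewrite subr_ge0.
    by rewrite mulr_ge0 ?expR_ge0// ltW// peak_gt0.
  by rewrite le_eqVlt; apply/orP; left; apply/eqP; ring.
have -> : p - Phi (- w) = (p - Phi (- u)) + (Phi (- u) - Phi (- w)) by ring.
apply: le_trans (ler_normD _ _) _.
apply: le_trans (lerD (le_trans hmain t2) t3) _.
rewrite le_eqVlt; apply/orP; left; apply/eqP.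
by field; rewrite gt_eqF.
Qed.

End transfer.

Section small.
Context {R : realType}.
Variables (K L M : R).
Hypotheses (K0 : 0 < K) (L0 : 0 < L) (M0 : 0 < M).

Theorem small_deviation : exists (C tau : R) (n0 : nat), [/\ 0 < C, 0 < tau, tau <= 1 &
  forall d (T : measurableType d) (P : probability T R) F x v, md_sys P F x v K L M ->
  forall n (w : R), (n0 <= n)%N -> 0 <= w -> w ^+ 3 <= tau * Num.sqrt n%:R ->
  forall ind : T -> R, measurable_fun setT ind -> (forall t, 0 <= ind t <= 1) ->
    (forall t, w * Num.sqrt n%:R < psum x n t -> ind t = 1) ->
    (forall t, psum x n t < w * Num.sqrt n%:R -> ind t = 0) ->
    `|Ex P ind - Phi (- w)| <=
      C * expR (- w ^+ 2 / 2) * (w ^+ 2 + ln n%:R) / Num.sqrt n%:R].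
Proof.
have [m [C [c [lam0 [m1 C0 c0 [l00 l01] hMD]]]]] := moderate_deviation K L M K0 L0 M0.
have [n1 hn1] := @ln_sqr_small R 1 ltr01.
pose tau := Num.min c 1.
have tau0 : 0 < tau by rewrite lt_min c0 ltr01.
have tc : tau <= c by rewrite ge_min lexx.
have t1 : tau <= 1 by rewrite ge_min lexx orbT.
have [n2 hn2] := ex_nat_ge (tau / lam0 ^+ 3).
have em0 := @expR_gt0 R (m / 2).
exists (C * expR (m / 2) * (2 + m) + m * expR (m / 2)), tau, (maxn n1 n2); split => //.
  by rewrite addr_gt0// !mulr_gt0//; lra.
move=> d T P F x v sys n w; rewrite geq_max => /andP[nn1 nn2] w0 hw ind mind i01 ind1 ind0.
have [l1 [n3 _]] := hn1 n nn1; have nb := hn2 n nn2.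
set nr : R := n%:R in l1 n3 nb hw ind1 ind0 *.
set N := nr + m.
have m0 : 0 < m by apply: lt_le_trans m1.
have nr0 : 0 < nr by apply: lt_le_trans n3.
have N0 : 0 < N by rewrite addr_gt0.
have nN : nr <= N by rewrite lerDl ltW.
have s0 : 0 < Num.sqrt nr by rewrite sqrtr_gt0.
have S0 : 0 < Num.sqrt N by rewrite sqrtr_gt0.
have es : Num.sqrt nr ^+ 2 = nr by rewrite sqr_sqrtr ?ltW.
have eS : Num.sqrt N ^+ 2 = N by rewrite sqr_sqrtr ?ltW.
have s1 : 1 <= Num.sqrt nr by rewrite -[X in X <= _]sqrtr1 ler_sqrt// (le_trans _ n3)// ler1n.
have sS : Num.sqrt nr <= Num.sqrt N by rewrite ler_sqrt ?(ltW N0).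
set s := Num.sqrt nr in s0 es s1 sS hw ind1 ind0 *.
set S := Num.sqrt N in S0 eS sS *.
pose lam := w * s / N.
have lam_ge0 : 0 <= lam by rewrite /lam !mulr_ge0 ?invr_ge0 ?(ltW s0) ?(ltW N0).
have lamE : lam * N = w * s by rewrite /lam; field; rewrite gt_eqF.
have h3 : lam ^+ 3 * N <= w ^+ 3 / s.
  have -> : w ^+ 3 / s = lam ^+ 3 * N * (N ^+ 2 / nr ^+ 2).
    by rewrite /lam -es; field; rewrite !gt_eqF.
  rewrite ler_peMr//; first by rewrite mulr_ge0 ?exprn_ge0 ?(ltW N0).
  rewrite ler_pdivlMr ?exprn_gt0 ?mul1r//.
  by rewrite lerXn2r ?nnegrE ?(ltW nr0) ?(ltW N0).
have h3' : w ^+ 3 / s <= tau by rewrite ler_pdivrMr.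
have lam_le : lam <= lam0.
  apply: cube_le; first exact: ltW.
  have : lam ^+ 3 * N <= tau by exact: le_trans h3'.
  move=> h; have : lam ^+ 3 * nr <= lam0 ^+ 3 * nr.
    apply: le_trans (_ : lam ^+ 3 * N <= _).
      by rewrite ler_wpM2l ?exprn_ge0.
    apply: le_trans h _.
    by move: nb; rewrite ler_pdivrMr ?exprn_gt0// mulrC.
  by rewrite ler_pM2r.
have hN3 : lam ^+ 3 * (n%:R + m) <= c by rewrite (le_trans h3)// (le_trans h3').
have := hMD _ _ _ _ _ _ sys n lam lam_ge0 lam_le hN3 ind mind i01.
rewrite -/nr -/N lamE => /(_ ind1 ind0).
pose u := lam * S.
have u2 : lam ^+ 2 * N = u ^+ 2 by rewrite -eS /u; ring.
rewrite -/S -/u u2.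
have uE : u = w * (s / S) by rewrite /u /lam -eS; field; rewrite gt_eqF.
have ws : w ^+ 3 <= s by apply: le_trans hw _; rewrite ler_piMl// ltW.
exact: (transfer m nr N s S w u m1 n3 s0 S0 es (erefl _) eS sS s1 l1 w0 ws uE).
Qed.

End small.

(** * Deviations of order [sqrt n] *)

Definition pgt {d} {T : measurableType d} {R : realType} (P : probability T R)
  (x : nat -> T -> R) (n : nat) (a : R) : R := fine (P [set t | a < psum x n t]).

Section blocks.
Context {R : realType}.

Section pgt.
Context {d : measure_display} {T : measurableType d}.
Variables (P : probability T R) (F : nat -> set (set T)) (x v : nat -> T -> R) (K L M : R).
Hypothesis sys : md_sys P F x v K L M.

Lemma F_gt n a : F n [set t | a < psum x n t].
Proof.
have := sm_S P F x v K L M sys n `]a, +oo[%classic (measurable_itv _).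
rewrite (_ : _ @^-1` _ = [set t | a < psum x n t])//.
by apply/seteqP; split => t /=; rewrite in_itv /= andbT.
Qed.

Lemma meas_gt n a : measurable [set t | a < psum x n t].
Proof. exact: (md_meas sys _ _ (F_gt n a)). Qed.

Lemma F_ge n a : F n [set t | a <= psum x n t].
Proof.
have := sm_S P F x v K L M sys n `[a, +oo[%classic (measurable_itv _).
rewrite (_ : _ @^-1` _ = [set t | a <= psum x n t])//.
by apply/seteqP; split => t /=; rewrite in_itv /= andbT.
Qed.

Lemma meas_ge n a : measurable [set t | a <= psum x n t].
Proof. exact: (md_meas sys _ _ (F_ge n a)). Qed.

Lemma pgtE n a : pgt P x n a = Ex P (\1_[set t | a < psum x n t]).
Proof. by rewrite Ex_indic//; exact: meas_gt. Qed.

End pgt.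

Lemma indic01 {T : Type} (A : set T) t : 0 <= (\1_A t : R) <= 1.
Proof. by rewrite indicE; case: (_ \in _); rewrite ?ler01 ?lexx. Qed.

Variables (K L : R).
Hypotheses (K0 : 0 < K) (L0 : 0 < L).

Lemma block_lower (M : R) : 0 < M -> exists (cl tau : R) (n0 : nat),
  [/\ 0 < cl, cl <= 1, 0 < tau, tau <= 1 &
  forall d (T : measurableType d) (P : probability T R) F x v, md_sys P F x v K L M ->
  forall n (w : R), (n0 <= n)%N -> 0 <= w -> w ^+ 3 <= tau * Num.sqrt n%:R ->
    cl * expR (- w ^+ 2 / 2) / (1 + w) <= pgt P x n (w * Num.sqrt n%:R)].
Proof.
move=> M0.
have [C [tau0 [n1 [C0 t00 t01 hSM]]]] := small_deviation K L M K0 L0 M0.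
have [c c0 hc] := @Phi_lower R.
pose e := c / (2 * C).
have e0 : 0 < e by rewrite divr_gt0// mulr_gt0.
have e20 : 0 < e / 2 by rewrite divr_gt0.
have [n2 hn2] := ln_sqr_small (e / 2) e20.
pose tau := Num.min tau0 (e / 6).
have tauP : 0 < tau by rewrite lt_min t00 divr_gt0.
have ta : tau <= tau0 by rewrite ge_min lexx.
have tb : tau <= e / 6 by rewrite ge_min lexx orbT.
exists (Num.min (c / 2) 1), tau, (maxn n1 n2); split.
- by rewrite lt_min ltr01 divr_gt0.
- by rewrite ge_min lexx orbT.
- by [].
- by lra.
move=> d T P F x v sys n w; rewrite geq_max => /andP[nn1 nn2] w0 hw.
have [l1 [x3 hl]] := hn2 n nn2.
have s0 : 0 < Num.sqrt (n%:R : R) by rewrite sqrtr_gt0; lra.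
have hw' : w ^+ 3 <= tau0 * Num.sqrt n%:R.
  by apply: le_trans hw _; rewrite ler_wpM2r// ltW.
have Hm : measurable_fun setT (\1_[set t | w * Num.sqrt n%:R < psum x n t] : T -> R).
  by apply: measurable_indic; exact: (meas_gt P F x v K L M sys).
have := hSM _ _ _ _ _ _ sys n w nn1 w0 hw' (\1_[set t | w * Num.sqrt n%:R < psum x n t]) _ _ _ _.
rewrite -(pgtE P F x v K L M sys).
move=> /(_ Hm (indic01 _)).
have H1 t : w * Num.sqrt n%:R < psum x n t -> \1_[set t | w * Num.sqrt n%:R < psum x n t] t = 1 :> R.
  by move=> h; rewrite indicE mem_set.
have H0 t : psum x n t < w * Num.sqrt n%:R -> \1_[set t | w * Num.sqrt n%:R < psum x n t] t = 0 :> R.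
  by move=> h; rewrite indicE memNset//= => /(lt_trans h); rewrite ltxx.
move=> /(_ H1 H0).
have hcw := hc w w0.
have hcb := cube_log_bound _ _ w0 l1.
have w3 : w ^+ 3 / Num.sqrt n%:R <= tau by rewrite ler_pdivrMr.
move: hw hw' s0 hl w3 H1 H0; set s := Num.sqrt n%:R => hw hw' s0 hl w3 _ _.
move: hcb hl l1; set l := ln n%:R => hcb hl l1.
set Ew := expR _ in hcw *; have Ew0 : 0 < Ew by exact: expR_gt0.
clearbody Ew s l; clear hSM hc hn2.
have wp : 0 < 1 + w by lra.
have key : C * (w ^+ 2 + l) / s <= c / 2 / (1 + w).
  rewrite ler_pdivlMr//.
  have : (1 + w) * (w ^+ 2 + l) / s <= e.
    apply: le_trans (_ : (1 + 3 * w ^+ 3 + 2 * l ^+ 2) / s <= _).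
      by rewrite ler_wpM2r// invr_ge0 ltW.
    have -> : (1 + 3 * w ^+ 3 + 2 * l ^+ 2) / s = 3 * (w ^+ 3 / s) + (1 + 2 * l ^+ 2) / s by ring.
    lra.
  move=> /(ler_wpM2l (ltW C0)); rewrite (_ : C * e = c / 2); last by rewrite /e; field; rewrite gt_eqF.
  by apply: le_trans; rewrite le_eqVlt; apply/orP; left; apply/eqP; ring.
rewrite ler_norml => /andP[hp _].
apply: le_trans (_ : c / 2 * Ew / (1 + w) <= _).
  rewrite ler_wpM2r ?invr_ge0 ?(ltW wp)// ler_wpM2r ?(ltW Ew0)//.
  by rewrite ge_min lexx.
have := ler_wpM2l (ltW Ew0) key.
have -> : Ew * (C * (w ^+ 2 + l) / s) = C * Ew * (w ^+ 2 + l) / s by ring.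
have -> : Ew * (c / 2 / (1 + w)) = c / 2 * Ew / (1 + w) by ring.
move=> h1; have : c * Ew / (1 + w) = c / 2 * Ew / (1 + w) + c / 2 * Ew / (1 + w) by field; lra.
lra.
Qed.

Lemma pgt_add {d} {T : measurableType d} (P : probability T R) F x v (M : R) (n l : nat) (a b p q : R) :
  md_sys P F x v K L M -> 0 < p -> p <= pgt P x n a ->
  (forall Q : probability T R, md_sys Q (fun k => F (n + k)%N) (fun k => x (n + k)%N)
    (fun k => v (n + k)%N) K L (2 * M) -> q <= pgt Q (fun k => x (n + k)%N) l b) ->
  0 <= q -> p * q <= pgt P x (n + l) (a + b).
Proof.
move=> sys p0 hp hq q0.
pose A := [set t | a < psum x n t].
have FA : F n A := F_gt P F x v K L M sys n a.
have mA : measurable A := md_meas sys _ _ FA.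
have fA : P A \is a fin_num by exact: fin_num_measure.
have PA : (0 < P A)%E.
  by rewrite -(fineK fA) lte_fin; apply: lt_le_trans hp.
have [Q [sysQ QE]] := cond_sys P F x v K L M A n L0 sys FA PA.
have := hq Q sysQ.
set B := [set t | b < psum (fun k => x (n + k)%N) l t].
have mB : measurable B := meas_gt Q _ _ _ K L _ sysQ l b.
rewrite /pgt -/B QE// fineM//; last by apply: fin_num_measure; exact: measurableI.
rewrite [fine _%:E]/= => h.
have PA' : 0 < fine (P A) by apply: lt_le_trans hp.
have h2 : q * fine (P A) <= fine (P (B `&` A)).
  by move: h; rewrite mulrC ler_pdivlMr.
apply: le_trans (_ : fine (P (B `&` A)) <= _).
  by apply: le_trans h2; rewrite mulrC ler_wpM2l.
apply: fine_le.
- by apply: fin_num_measure; exact: measurableI.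
- by apply: fin_num_measure; exact: (meas_gt P F x v K L M sys).
apply: le_measure; rewrite ?inE.
- exact: measurableI.
- exact: (meas_gt P F x v K L M sys).
move=> t [] /= hb ha.
have -> : psum x (n + l) t = psum x n t + psum (fun k => x (n + k)%N) l t.
  by rewrite /psum big_split_ord.
exact: ltrD.
Qed.

(* The slope [lam = w / sqrt n] is kept over blocks of length [l ~ tau / (2 lam^3)], the longest for which
   [block_lower] applies; the conditioned system has constant [2 M] uniformly in the past. *)
Theorem large_lower (M : R) : 0 < M -> forall tau1 : R, 0 < tau1 ->
  exists (alpha C : R), [/\ 0 < alpha, alpha <= 1, 0 < C &
  forall d (T : measurableType d) (P : probability T R) F x v, md_sys P F x v K L M ->
  forall n (w : R), 1 <= ln n%:R :> R -> 3 <= n%:R :> R ->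
    0 <= w -> w <= alpha * Num.sqrt n%:R -> tau1 * Num.sqrt n%:R <= w ^+ 3 ->
    expR (- w ^+ 2 / 2 - C * (w ^+ 3 / Num.sqrt n%:R) * ln n%:R) <=
      pgt P x n (w * Num.sqrt n%:R)].
Proof.
move=> M0 tau1 tau10.
have M20 : 0 < 2 * M by lra.
have [cl [tau [n0 [cl0 cl1 t0 t1 hB]]]] := block_lower (2 * M) M20.
pose tau' := Num.min tau tau1.
have tp0 : 0 < tau' by rewrite lt_min t0 tau10.
have tpa : tau' <= tau by rewrite ge_min lexx.
have tpb : tau' <= tau1 by rewrite ge_min lexx orbT.
clearbody tau'.
pose alpha := Num.min 1 (tau' / (4 * n0%:R + 4)).
have n00 : 0 <= n0%:R :> R by [].
have a0 : 0 < alpha by rewrite lt_min ltr01 divr_gt0//; lra.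
have a1 : alpha <= 1 by rewrite ge_min lexx.
have a2 : alpha <= tau' / (4 * n0%:R + 4) by rewrite ge_min lexx orbT.
clearbody alpha.
have [kappa ek] : exists kappa, kappa = ln 2 - ln cl by exists (ln 2 - ln cl).
have k0 : 0 <= kappa.
  have : ln cl <= 0 by apply: ln_le0.
  have : 0 <= ln (2 : R) by apply: ln_ge0; lra.
  by rewrite ek; lra.
exists alpha, (4 * (1 + kappa) / tau'); split => //.
  by rewrite divr_gt0// mulr_gt0//; lra.
move=> d T P F x v sys n w l1 n3 w0 wa wt.
have s0 : 0 < Num.sqrt (n%:R : R) by rewrite sqrtr_gt0; lra.
have es : Num.sqrt (n%:R : R) ^+ 2 = n%:R by rewrite sqr_sqrtr; lra.
have [s e_s] : exists s : R, s = Num.sqrt n%:R by exists (Num.sqrt n%:R).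
rewrite -e_s in s0 es wa wt *.
pose lam := w / s.
have ws : w = lam * s by rewrite /lam divfK// gt_eqF.
have w00 : 0 < w.
  rewrite lt_neqAle w0 andbT; apply/eqP => h.
  by move: wt; rewrite -h expr0n /=; have := mulr_gt0 tau10 s0; lra.
have lam0 : 0 < lam by rewrite divr_gt0.
have lama : lam <= alpha by rewrite ler_pdivrMr.
have lam1 : lam <= 1 by lra.
have l3 : 0 < lam ^+ 3 by rewrite exprn_gt0.
clearbody lam.
have l3n : tau' <= lam ^+ 3 * n%:R.
  have : tau1 * s <= (lam ^+ 3 * n%:R) * s.
    by move: wt; rewrite ws -es; lra.
  by rewrite ler_pM2r//; lra.
have [r er] : exists r, r = tau' / (2 * lam ^+ 3) by exists (tau' / (2 * lam ^+ 3)).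
have r0 : 2 * n0%:R + 2 <= r.
  rewrite er ler_pdivlMr; last by lra.
  have : lam ^+ 3 <= alpha.
    apply: le_trans (_ : lam <= _) => //.
    by rewrite exprS ler_piMr ?(ltW lam0)// expr_le1 ?(ltW lam0).
  move: a2; rewrite ler_pdivlMr; last by lra.
  nra.
pose l := Num.truncn r.
have lr : l%:R <= r by rewrite truncn_le; lra.
have rl : r < l%:R + 1 by rewrite natr1; exact: truncnS_gt.
clearbody l; have ll : r / 2 <= l%:R by move: rl r0 n00; clear; lra.
have l0 : (0 < l)%N.
  by rewrite -(ltr0n R); move: ll r0 n00; clear; lra.
have nl : (n0 <= l)%N by rewrite -(ler_nat R); move: ll r0; clear; lra.
have rE : lam ^+ 3 * r = tau' / 2 by rewrite er; field; rewrite gt_eqF.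
have ln_ : (l <= n)%N.
  rewrite -(ler_nat R); apply: le_trans lr _.
  by rewrite -(ler_pM2l l3) rE; move: l3n tp0; clear; lra.
have [Z eZ] : exists Z, Z = 1 + s by exists (1 + s).
have Z0 : 0 < Z by rewrite eZ addr_gt0.
have [q eq_] : exists q, q = cl / Z by exists (cl / Z).
have q0 : 0 < q by rewrite eq_ divr_gt0.
have block (Q : probability T R) F' x' v' k : md_sys Q F' x' v' K L (2 * M) ->
    (l <= k)%N -> (k < l + l)%N -> (k <= n)%N ->
    q * expR (- (lam ^+ 2 * k%:R / 2)) <= pgt Q x' k (lam * k%:R).
  move=> sysQ lk kl kn.
  have sk0 : 0 <= Num.sqrt (k%:R : R) by exact: sqrtr_ge0.
  have sk : Num.sqrt (k%:R : R) ^+ 2 = k%:R by rewrite sqr_sqrtr.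
  have sks : Num.sqrt (k%:R : R) <= s by rewrite e_s ler_sqrt// ler_nat.
  have h := hB _ _ _ _ _ _ sysQ k (lam * Num.sqrt k%:R) (leq_trans nl lk).
  move: sk0 sk sks h; move: (Num.sqrt k%:R) => y sk0 sk sks h.
  have {}h := h ltac:(by rewrite mulr_ge0 ?(ltW lam0)).
  have hk : (lam * y) ^+ 3 <= tau * y.
    have -> : (lam * y) ^+ 3 = lam ^+ 3 * k%:R * y.
      by rewrite -sk; ring.
    rewrite ler_wpM2r//.
    have k2 : k%:R <= 2 * l%:R :> R by rewrite -natrM ler_nat mul2n -addnn ltnW.
    apply: le_trans (_ : lam ^+ 3 * (2 * r) <= _).
      by rewrite ler_wpM2l ?(ltW l3)// (le_trans k2)// ler_wpM2l.
    by move: rE tpa; clear; lra.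
  have {}h := h hk.
  have e1 : lam * y * y = lam * k%:R by rewrite -sk; ring.
  have e2 : - (lam * y) ^+ 2 / 2 = - (lam ^+ 2 * k%:R / 2) by rewrite -sk; ring.
  rewrite e1 e2 in h; apply: le_trans h.
  rewrite eq_ mulrAC ler_wpM2l ?mulr_ge0 ?expR_ge0 ?(ltW cl0)//.
  rewrite lef_pV2 ?posrE//.
    rewrite eZ lerD2l; apply: le_trans sks; rewrite ler_piMl//.
  by rewrite ltr_wpDr// mulr_ge0 ?(ltW lam0).
have sys2 : md_sys P F x v K L (2 * M) by apply: md_sys_mono sys; lra.
have claim j k : (k < l)%N -> (j.+1 * l + k <= n)%N ->
    q ^+ j.+1 * expR (- (lam ^+ 2 * (j.+1 * l + k)%:R / 2)) <= pgt P x (j.+1 * l + k) (lam * (j.+1 * l + k)%:R).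
  elim: j => [|j ih] kl hn.
    rewrite expr1 mul1n; apply: block sys2 _ _ _ => //.
    - exact: leq_addr.
    - by rewrite ltn_add2l.
    - by rewrite mul1n in hn.
  have hn' : (j.+1 * l + k <= n)%N.
    by apply: leq_trans hn; rewrite leq_add2r leq_mul2r leqnSn orbT.
  have e : (j.+2 * l + k)%N = (j.+1 * l + k + l)%N by rewrite mulSn addnC addnA addnAC [(k + _)%N]addnC.
  rewrite e natrD [lam * _]mulrDr.
  have -> : q ^+ j.+2 * expR (- (lam ^+ 2 * ((j.+1 * l + k)%:R + l%:R) / 2)) =
    (q ^+ j.+1 * expR (- (lam ^+ 2 * (j.+1 * l + k)%:R / 2))) * (q * expR (- (lam ^+ 2 * l%:R / 2))).
    have -> : - (lam ^+ 2 * ((j.+1 * l + k)%:R + l%:R) / 2) =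
      - (lam ^+ 2 * (j.+1 * l + k)%:R / 2) + - (lam ^+ 2 * l%:R / 2) by ring.
    by rewrite expRD exprS; ring.
  apply: (pgt_add P F x v M) => //.
  - by rewrite mulr_gt0 ?expR_gt0 ?exprn_gt0.
  - exact: ih.
  - move=> Q sysQ; apply: block sysQ _ _ _ => //.
    by rewrite -{1}[l]addn0 ltn_add2l.
  - by rewrite mulr_ge0 ?expR_ge0 ?(ltW q0).
pose J := (n %/ l)%N.
have J0 : (0 < J)%N by rewrite divn_gt0.
have := claim J.-1 (n %% l)%N (ltn_pmod _ l0).
rewrite prednK// -divn_eq => /(_ (leqnn n)).
have -> : lam * n%:R = w * s by rewrite ws -es; ring.
have -> : lam ^+ 2 * n%:R = w ^+ 2 by rewrite ws -es; ring.
apply: le_trans.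
have -> : - w ^+ 2 / 2 - 4 * (1 + kappa) / tau' * (w ^+ 3 / s) * ln n%:R =
  - (4 * (1 + kappa) / tau' * (w ^+ 3 / s) * ln n%:R) + - (w ^+ 2 / 2) by ring.
rewrite expRD ler_wpM2r ?expR_ge0//.
have -> : w ^+ 3 / s = lam ^+ 3 * n%:R by rewrite ws -es; field; rewrite gt_eqF.
rewrite -[q]lnK ?posrE// -expRM_natl ler_expR.
have lnq : - ln q <= (1 + kappa) * ln n%:R.
  rewrite eq_ ln_div ?posrE//.
  have : ln Z <= ln 2 + ln n%:R.
    have nr0 : 0 < n%:R :> R by apply: lt_le_trans n3.
    have s1 : 1 <= s by rewrite e_s -[leLHS]sqrtr1 ler_sqrt// (le_trans _ n3)// ler1n.
    rewrite -lnM ?posrE// ler_ln ?posrE ?mulr_gt0// eZ mulr_natl mulr2n lerD//.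
      by rewrite (le_trans _ n3)// ler1n.
    by rewrite -es expr2 ler_peMl// ltW.
  have : kappa <= kappa * ln n%:R by rewrite ler_peMr.
  by move: l1; rewrite ek; clear; lra.
have Jn : J%:R * l%:R <= n%:R :> R by rewrite -natrM ler_nat leq_divM.
have J1 : J%:R <= 4 * lam ^+ 3 * n%:R / tau'.
  rewrite ler_pdivlMr//.
  have : J%:R * (r / 2) <= n%:R by apply: le_trans Jn; rewrite ler_wpM2l.
  move=> /(ler_wpM2l (ltW l3)).
  have -> : lam ^+ 3 * (J%:R * (r / 2)) = J%:R * tau' / 4.
    have -> : lam ^+ 3 * (J%:R * (r / 2)) = J%:R * (lam ^+ 3 * r) / 2 by ring.
    by rewrite rE; field.
  by clear; lra.
have lq0 : 0 <= (1 + kappa) * ln n%:R by rewrite mulr_ge0 ?(le_trans _ l1)// addr_ge0.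
have J0' : 0 <= J%:R :> R by [].
have h1 := ler_wpM2l J0' lnq.
have h2 := ler_wpM2r lq0 J1.
have -> : 4 * (1 + kappa) / tau' * (lam ^+ 3 * n%:R) * ln n%:R =
  4 * lam ^+ 3 * n%:R / tau' * ((1 + kappa) * ln n%:R) by ring.
rewrite lerNl; apply: le_trans h2; rewrite -mulrN; exact: h1.
Qed.

End blocks.

Section shift.
Context {R : realType}.
Implicit Types (w l s p D : R).

Lemma shift_small (C c D w l s p : R) : 0 < c -> 0 < C -> C / c <= D ->
  (forall w d : R, 0 <= w -> 0 <= d -> d <= (1 + w)^-1 ->
    c * d * expR (- w ^+ 2 / 2) <= Phi (- w) - Phi (- (w + d)) /\
    c * d * expR (- w ^+ 2 / 2) <= Phi (- (w - d)) - Phi (- w)) ->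
  0 <= w -> 1 <= l -> 0 < s -> C / c * ((1 + w) * (w ^+ 2 + l) / s) <= 1 ->
  `|p - Phi (- w)| <= C * expR (- w ^+ 2 / 2) * (w ^+ 2 + l) / s ->
  Phi (- (w + D * (w ^+ 2 + 1) * l / s)) <= p <= Phi (- (w - D * (w ^+ 2 + 1) * l / s)).
Proof.
move=> c0 C0 hD hc w0 l1 s0 hsm hp.
pose d := C / c * (w ^+ 2 + l) / s.
have Cc : 0 < C / c by rewrite divr_gt0.
have w2 := sqr_ge0 w.
have d0 : 0 <= d by apply: divr_ge0; [apply: mulr_ge0; lra|lra].
have w1 : 0 < 1 + w by lra.
have d1 : d <= (1 + w)^-1.
  rewrite -[_^-1]mul1r ler_pdivlMr//; apply: le_trans hsm.
  by rewrite /d le_eqVlt; apply/orP; left; apply/eqP; ring.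
have dD : d <= D * (w ^+ 2 + 1) * l / s.
  rewrite /d ler_wpM2r ?invr_ge0 ?(ltW s0)// -[D * _ * _]mulrA; apply: ler_pM => //; first lra.
    by lra.
  nra.
have [h1 h2] := hc w d w0 d0 d1.
have e : c * d * expR (- w ^+ 2 / 2) = C * expR (- w ^+ 2 / 2) * (w ^+ 2 + l) / s.
  by rewrite /d; field; rewrite !gt_eqF.
rewrite e in h1 h2; move: hp; rewrite ler_norml => /andP[hp1 hp2].
have := @Phi_le R (- (w + D * (w ^+ 2 + 1) * l / s)) (- (w + d)) ltac:(lra).
have := @Phi_le R (- (w - d)) (- (w - D * (w ^+ 2 + 1) * l / s)) ltac:(lra).
have k1 : Phi (- (w + d)) <= p by move: h1 hp1; clear; lra.
have k2 : p <= Phi (- (w - d)) by move: h2 hp2; clear; lra.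
by move=> h3 h4; rewrite (le_trans h4 k1) (le_trans k2 h3).
Qed.

Lemma shift_lower (C D w l s p : R) : 0 < D -> C <= D -> 0 <= w -> 0 <= l -> 0 < s ->
  expR (- w ^+ 2 / 2 - C * (w ^+ 3 / s) * l) <= p ->
  Phi (- (w + D * (w ^+ 2 + 1) * l / s)) <= p.
Proof.
move=> D0 CD w0 l0 s0; apply: le_trans.
have d0 : 0 <= D * (w ^+ 2 + 1) * l / s.
  by rewrite divr_ge0 ?(ltW s0)// mulr_ge0// mulr_ge0 ?(ltW D0)// addr_ge0 ?sqr_ge0.
have ls : 0 <= l / s by rewrite divr_ge0 ?(ltW s0).
apply: le_trans (Phi_tail _ _) _; first by lra.
rewrite ler_expR.
have : C * (w ^+ 3 / s) * l <= w * (D * (w ^+ 2 + 1) * l / s).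
  have -> : C * (w ^+ 3 / s) * l = C * (w ^+ 3 * (l / s)) by ring.
  have -> : w * (D * (w ^+ 2 + 1) * l / s) = D * ((w ^+ 3 + w) * (l / s)) by ring.
  apply: (@le_trans _ _ (D * (w ^+ 3 * (l / s)))).
    by rewrite ler_wpM2r// mulr_ge0// exprn_ge0.
  by rewrite ler_wpM2l ?(ltW D0)// ler_wpM2r// lerDl.
move: d0; set dd := _ / s; clearbody dd; nra.
Qed.

Lemma shift_upper (L C3 tau c D w l s p : R) : 0 < L -> 0 <= C3 -> 0 < tau -> 0 < c ->
  (forall w : R, 0 <= w -> c * expR (- w ^+ 2 / 2) / (1 + w) <= Phi (- w)) ->
  2 * (L + (C3 + `|ln c| + 1) / tau) <= D ->
  0 <= w -> 1 <= l -> 0 < s -> ln (1 + w) <= l -> tau * s <= w ^+ 3 ->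
  2 * (C3 + 1) <= w -> 4 * L * w <= s ->
  p <= expR (- w ^+ 2 / 2 + L * (w ^+ 3 / s) + C3) ->
  p <= Phi (- (w - D * (w ^+ 2 + 1) * l / s)).
Proof.
move=> L0 C30 tau0 c0 hc hD w0 l1 s0 lw wt wC ws hp; apply: le_trans hp _.
set d := D * _ * l / s.
have D0 : 0 <= D.
  apply: le_trans hD; rewrite mulr_ge0// addr_ge0 ?(ltW L0)// divr_ge0 ?(ltW tau0)//.
  by have := normr_ge0 (ln c); lra.
have [wd|dw] := leP w d.
  have h2 : 2^-1 <= Phi (- (w - d)).
    have : Phi 0 <= Phi (- (w - d)) by apply: Phi_le; lra.
    by have := @Phi_sym R 0; rewrite oppr0; lra.
  apply: le_trans h2.
  have h3 : L * (w ^+ 3 / s) <= w ^+ 2 / 4.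
    have -> : L * (w ^+ 3 / s) = w ^+ 2 * (4 * L * w / s / 4) by field; lra.
    rewrite [leRHS]mulrC [leRHS]mulrC ler_wpM2l ?sqr_ge0//.
    have : 4 * L * w / s <= 1 by by rewrite ler_pdivrMr// mul1r.
    by lra.
  apply: (@le_trans _ _ (expR (- 1))).
    by rewrite ler_expR; nra.
  rewrite expRN lef_pV2 ?posrE ?expR_gt0//; have := @expR_ge1Dx R 1; lra.
have u0 : 0 <= w - d by lra.
apply: le_trans (hc _ u0).
have d0 : 0 <= d.
  rewrite /d divr_ge0 ?(ltW s0)// mulr_ge0//; last lra.
  by rewrite mulr_ge0// addr_ge0 ?sqr_ge0.
have w1 : 0 < 1 + w by lra.
apply: (@le_trans _ _ (c * expR (- w ^+ 2 / 2 + w * d / 2) / (1 + w))); last first.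
  apply: ler_pM.
  - by rewrite mulr_ge0 ?expR_ge0 ?(ltW c0).
  - by rewrite invr_ge0; lra.
  - by rewrite ler_wpM2l ?(ltW c0)// ler_expR; nra.
  - by rewrite lef_pV2 ?posrE//; lra.
rewrite -[in leRHS](@lnK _ c) ?posrE// -[(1 + w)^-1]lnK ?posrE ?invr_gt0// lnV ?posrE// -!expRD ler_expR.
pose q := w ^+ 3 / s.
have q1 : tau <= q by rewrite ler_pdivlMr.
have h4 : D * q * l <= w * d.
  have ls : 0 <= l / s by rewrite divr_ge0 ?(ltW s0)//; lra.
  have -> : D * q * l = D * (w ^+ 3 * (l / s)) by rewrite /q; ring.
  have -> : w * d = D * ((w ^+ 3 + w) * (l / s)) by rewrite /d; ring.
  by rewrite ler_wpM2l// ler_wpM2r// lerDl.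
rewrite -/q; clearbody q d.
pose A := C3 + `|ln c| + 1.
have A0 : 0 <= A by rewrite /A; have := normr_ge0 (ln c); lra.
have h5 : A <= A / tau * q by rewrite mulrAC ler_pdivlMr// ler_wpM2l.
have h6 : (L + A / tau) * q * l <= D * q * l / 2.
  have -> : D * q * l / 2 = D / 2 * q * l by ring.
  rewrite ler_wpM2r//; first lra.
  by rewrite ler_wpM2r//; [lra|rewrite /A; lra].
have h7 : - `|ln c| <= ln c by rewrite lerNl -normrN ler_norm.
have h8 : L * q <= L * q * l by rewrite ler_peMr// mulr_ge0//; lra.
have h9 : (A - 1) + l <= A * l by rewrite /A; have := normr_ge0 (ln c); nra.
have h10 : A * l <= A / tau * q * l by rewrite ler_wpM2r//; lra.
have h11 : (L + A / tau) * q * l = L * q * l + A / tau * q * l by ring.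
move: h9; rewrite {1}/A; lra.
Qed.

End shift.

Section tails.
Context {R : realType}.
Variables (K L : R).
Hypotheses (K0 : 0 < K) (L0 : 0 < L).

Definition pge {d} {T : measurableType d} (P : probability T R)
  (x : nat -> T -> R) (n : nat) (a : R) : R := fine (P [set t | a <= psum x n t]).

Lemma pge_chernoff {d} {T : measurableType d} (P : probability T R) F x v (M : R) n (lam y : R) :
  md_sys P F x v K L M -> 0 <= lam -> lam <= K ->
  pge P x n y <= expR (- (lam * y) + (lam ^+ 2 / 2 + L * lam ^+ 3) * (n%:R + M)).
Proof.
move=> sys l0 lK; rewrite /pge -Ex_indic; last exact: (meas_ge P F x v K L M sys).
have h := exp_tail_bound P F x v K L M L0 sys lam y n (\1_[set t | y <= psum x n t]) l0 lK.
apply: h => [||w h].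
- by apply: measurable_indic; exact: (meas_ge P F x v K L M sys).
- by move=> w; exact: indic01.
- by rewrite indicE memNset//= => /(lt_le_trans h); rewrite ltxx.
Qed.

Lemma pgt_le_pge {d} {T : measurableType d} (P : probability T R) F x v (M : R) n a :
  md_sys P F x v K L M -> pgt P x n a <= pge P x n a.
Proof.
move=> sys; have m1 := meas_gt P F x v K L M sys n a; have m2 := meas_ge P F x v K L M sys n a.
apply: fine_le; [exact: fin_num_measure|exact: fin_num_measure|].
by apply: le_measure; rewrite ?inE// => t /ltW.
Qed.

Lemma pgt_small (M C tau : R) n0 : 
  (forall d (T : measurableType d) (P : probability T R) F x v, md_sys P F x v K L M ->
  forall n (w : R), (n0 <= n)%N -> 0 <= w -> w ^+ 3 <= tau * Num.sqrt n%:R ->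
  forall ind : T -> R, measurable_fun setT ind -> (forall t, 0 <= ind t <= 1) ->
    (forall t, w * Num.sqrt n%:R < psum x n t -> ind t = 1) ->
    (forall t, psum x n t < w * Num.sqrt n%:R -> ind t = 0) ->
    `|Ex P ind - Phi (- w)| <=
      C * expR (- w ^+ 2 / 2) * (w ^+ 2 + ln n%:R) / Num.sqrt n%:R) ->
  forall d (T : measurableType d) (P : probability T R) F x v, md_sys P F x v K L M ->
  forall n (w : R), (n0 <= n)%N -> 0 <= w -> w ^+ 3 <= tau * Num.sqrt n%:R ->
    `|pgt P x n (w * Num.sqrt n%:R) - Phi (- w)| <=
      C * expR (- w ^+ 2 / 2) * (w ^+ 2 + ln n%:R) / Num.sqrt n%:R /\
    `|pge P x n (w * Num.sqrt n%:R) - Phi (- w)| <=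
      C * expR (- w ^+ 2 / 2) * (w ^+ 2 + ln n%:R) / Num.sqrt n%:R.
Proof.
move=> H d T P F x v sys n w nn w0 hw.
have m1 := meas_gt P F x v K L M sys n (w * Num.sqrt n%:R).
have m2 := meas_ge P F x v K L M sys n (w * Num.sqrt n%:R).
rewrite /pgt /pge -!Ex_indic//; split.
  apply: (H _ _ _ _ _ _ sys) => // [|t h|t h].
  - by move=> t; exact: indic01.
  - by rewrite indicE mem_set.
  - by rewrite indicE memNset//= => /(lt_trans h); rewrite ltxx.
apply: (H _ _ _ _ _ _ sys) => // [|t h|t h].
- by move=> t; exact: indic01.
- by rewrite indicE mem_set//=; exact: ltW.
- by rewrite indicE memNset//= => /(lt_le_trans h); rewrite ltxx.
Qed.

Theorem tails (M : R) : 0 < M -> exists (alpha D : R) (n0 : nat), [/\ 0 < alpha, alpha <= 1, 0 < D &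
  forall d (T : measurableType d) (P : probability T R) F x v, md_sys P F x v K L M ->
  forall n (w : R), (n0 <= n)%N -> 0 <= w -> w <= alpha * Num.sqrt n%:R ->
   Phi (- (w + D * (w ^+ 2 + 1) * ln n%:R / Num.sqrt n%:R)) <= pgt P x n (w * Num.sqrt n%:R) /\
   pge P x n (w * Num.sqrt n%:R) <= Phi (- (w - D * (w ^+ 2 + 1) * ln n%:R / Num.sqrt n%:R))].
Proof.
move=> M0; have K0' := K0; have L0' := L0.
have [C [tau0 [n1 [C0 t00 t01 /pgt_small hS]]]] := small_deviation K L M K0 L0 M0.
have [c c0 hc] := @Phi_incr R.
have [cl cl0 hcl] := @Phi_lower R.
have B0 : 0 < C / c by rewrite divr_gt0.
have eB : exists2 B : R, 0 < B & B = C / c by exists (C / c).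
have [B B0' eB'] := eB.
have e0 : 0 < (2 * B)^-1 by rewrite invr_gt0; lra.
have [n2 hn2] := ln_sqr_small _ e0.
have [tau [tp ta tb]] : exists tau : R, [/\ 0 < tau, tau <= tau0 & tau <= (6 * B)^-1].
  exists (Num.min tau0 (6 * B)^-1); split.
  - by rewrite lt_min t00 invr_gt0; lra.
  - by rewrite ge_min lexx.
  - by rewrite ge_min lexx orbT.
have [a1 [C4 [a10 a11 C40 hL]]] := large_lower K L K0 L0 M M0 tau tp.
have [C3 C30 eC3] : exists2 C3 : R, 0 <= C3 & C3 = (1 / 2 + L) * M.
  by exists ((1 / 2 + L) * M) => //; rewrite mulr_ge0//; lra.
have [D [D0 D1 D2 D3]] : exists D : R, [/\ 0 < D, B <= D, C4 <= D & 2 * (L + (C3 + `|ln cl| + 1) / tau) <= D].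
  exists (B + C4 + 2 * (L + (C3 + `|ln cl| + 1) / tau)).
  have : 0 <= 2 * (L + (C3 + `|ln cl| + 1) / tau).
    rewrite mulr_ge0// addr_ge0 ?(ltW L0)// divr_ge0 ?(ltW tp)//.
    by have := normr_ge0 (ln cl); lra.
  by set z := 2 * _; clearbody z; split; lra.
have [al [al0 al1 al2 al3]] : exists al : R, [/\ 0 < al, al <= a1, al <= K & 4 * L * al <= 1].
  exists (Num.min a1 (Num.min K (4 * L)^-1)); split.
  - by rewrite !lt_min a10 K0 invr_gt0; lra.
  - by rewrite ge_min lexx.
  - by rewrite !ge_min lexx !orbT.
  - by rewrite -ler_pdivlMl; [rewrite mulr1 !ge_min lexx !orbT|lra].
have [n3 hn3] := ex_nat_ge (((2 * (C3 + 1)) ^+ 3 / tau) ^+ 2).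
exists al, D, (maxn n1 (maxn n2 n3)); split => //; first lra.
move=> d T P F x v sys n w; rewrite !geq_max => /and3P[nn1 nn2 nn3] w0 wa.
have [l1 [x3 hl]] := hn2 n nn2.
have nr0 : 0 < n%:R :> R by apply: lt_le_trans x3.
have s0 : 0 < Num.sqrt (n%:R : R) by rewrite sqrtr_gt0.
have es : Num.sqrt (n%:R : R) ^+ 2 = n%:R by rewrite sqr_sqrtr ?ltW.
have [hw|hw] := leP (w ^+ 3) (tau * Num.sqrt n%:R).
  have hw' : w ^+ 3 <= tau0 * Num.sqrt n%:R.
    by apply: le_trans hw _; rewrite ler_wpM2r// ltW.
  have [h1 h2] := hS _ _ _ _ _ _ sys n w nn1 w0 hw'.
  have key : C / c * ((1 + w) * (w ^+ 2 + ln n%:R) / Num.sqrt n%:R) <= 1.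
    rewrite -eB'.
    have hcb := cube_log_bound _ _ w0 l1.
    have w3 : w ^+ 3 / Num.sqrt n%:R <= tau by rewrite ler_pdivrMr.
    move: s0 hcb w3 hl; set s := Num.sqrt _; set l := ln _ => s0 hcb w3 hl.
    have h : (1 + w) * (w ^+ 2 + l) / s <= 3 * (w ^+ 3 / s) + (1 + 2 * l ^+ 2) / s.
      have -> : 3 * (w ^+ 3 / s) + (1 + 2 * l ^+ 2) / s = (1 + 3 * w ^+ 3 + 2 * l ^+ 2) / s by ring.
      by rewrite ler_wpM2r// invr_ge0 ltW.
    apply: le_trans (_ : B * (B^-1) <= _); last by rewrite divff// gt_eqF.
    rewrite ler_wpM2l ?(ltW B0')//; move: tb hl; rewrite !invfM; lra.
  have BD : C / c <= D by rewrite -eB'.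
  have /andP[g1 _] := shift_small C c D w _ _ _ c0 C0 BD hc w0 l1 s0 key h1.
  by have /andP[_ g2] := shift_small C c D w _ _ _ c0 C0 BD hc w0 l1 s0 key h2.
have wa1 : w <= a1 * Num.sqrt n%:R by apply: le_trans wa _; rewrite ler_wpM2r// ltW.
split.
  apply: (shift_lower C4) => //; first by rewrite (le_trans _ l1).
  exact: (hL _ _ _ _ _ _ sys n w l1 x3 w0 wa1 (ltW hw)).
move: (ltW hw) => {}hw.
have ls : w / Num.sqrt n%:R <= al by rewrite ler_pdivrMr.
have l0 : 0 <= w / Num.sqrt n%:R by rewrite divr_ge0// ltW.
have hch := pge_chernoff P F x v M n (w / Num.sqrt n%:R) (w * Num.sqrt n%:R) sys l0
   (le_trans ls al2).
clear hS hc hL; have sn3 : (2 * (C3 + 1)) ^+ 3 / tau <= Num.sqrt n%:R.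
  rewrite -[leLHS]ger0_norm; last by rewrite divr_ge0 ?(ltW tp)// exprn_ge0// mulr_ge0// addr_ge0.
  by rewrite -sqrtr_sqr ler_sqrt// hn3.
have wC : 2 * (C3 + 1) <= w.
  apply: cube_le => //; apply: le_trans hw.
  by rewrite [leRHS]mulrC -ler_pdivrMr.
have l1' : w / Num.sqrt n%:R <= 1 by rewrite (le_trans ls)// (le_trans al1).
have sn : 1 + Num.sqrt n%:R <= n%:R :> R by move: es s0 x3; set s := Num.sqrt _; clearbody s; nra.
apply: (shift_upper L C3 tau cl) => //.
- rewrite ler_ln ?posrE ?ltr_pwDl//.
  apply: le_trans sn; rewrite lerD2l; move: l1'; by rewrite ler_pdivrMr// mul1r.
- apply: le_trans (_ : 4 * L * al * Num.sqrt n%:R <= _).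
    by rewrite -[leRHS]mulrA ler_wpM2l// mulr_ge0 ?(ltW L0).
  by rewrite ler_piMl// ltW.
apply: le_trans hch _; rewrite ler_expR.
move: s0 es ls l0 l1'; set s := Num.sqrt _ => s0 es ls l0 l1'.
rewrite eC3; set lam := w / s in ls l0 l1' *.
have ws : w = lam * s by rewrite /lam divfK// gt_eqF.
clearbody lam; rewrite -es.
have -> : L * (w ^+ 3 / s) = L * lam ^+ 3 * s ^+ 2 by rewrite ws; field; rewrite gt_eqF.
have : lam ^+ 2 / 2 + L * lam ^+ 3 <= 1 / 2 + L.
  apply: lerD; last by rewrite ler_piMr ?(ltW L0)// expr_le1.
  by rewrite ler_pM2r ?invr_gt0// expr_le1.
move=> /(ler_wpM2r (ltW M0)); rewrite ws; lra.
Qed.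

End tails.

Lemma md_sys_opp {d} {T : measurableType d} {R : realType} (P : probability T R) F x v (K L M : R) :
  md_sys P F x v K L M -> md_sys P F (fun k w => - x k w) v K L M.
Proof.
move=> [h1 h2 h3 h4 h5 h6 h7 h8 h9 h10]; split => //.
- by move=> k; apply: sm_opp.
- move=> k A FA; rewrite -h8//; apply: eq_integral => w _; by rewrite opprK.
- by move=> k A FA; rewrite -h9//; apply: eq_integral => w _; rewrite sqrrN.
- move=> k A FA; apply: le_trans (h10 k A FA); rewrite le_eqVlt; apply/orP; left; apply/eqP.
  by apply: eq_integral => w _; rewrite normrN.
Qed.

(** * Reduction of the hypotheses *)

Section truncation.
Context {R : realType}.
Variables (M : R) (M0 : 0 <= M).

Definition within (a : nat -> R) (k : nat) : R :=
  \1_(`[k.+1%:R - M, k.+1%:R + M]%classic) (\sum_(i < k.+1) a i).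

Fixpoint all_within (a : nat -> R) (k : nat) : R :=
  if k is k'.+1 then all_within a k' * within a k else within a 0%N.

(* From the first time the bound on the variance fails, the increments are replaced
   by 1, which keeps the bound; on a full set nothing changes. *)
Definition stopped (a : nat -> R) (k : nat) : R := all_within a k * a k + (1 - all_within a k).

Lemma withinE a k : within a k = ((`|\sum_(i < k.+1) a i - k.+1%:R| <= M)%R%:R : R).
Proof.
rewrite /within indicE; congr (nat_of_bool _)%:R.
apply/idP/idP.
  by rewrite inE/= in_itv /= ler_distl => /andP[-> ->].
by rewrite ler_distl inE/= in_itv.
Qed.

Lemma all_withinE a k :
  all_within a k = ([forall j : 'I_k.+1, (`|\sum_(i < j.+1) a i - j.+1%:R| <= M)%R]%:R : R).
Proof.
elim: k => [|k ih] /=.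
  rewrite withinE; congr (nat_of_bool _)%:R; apply/idP/forallP => [h j|/(_ ord0)//].
  by rewrite ord1.
rewrite ih withinE -natrM mulnb; congr (nat_of_bool _)%:R.
apply/andP/forallP => [[/forallP h1 h2] j|h].
  have [jk|] := ltnP j k.+1; first exact: (h1 (Ordinal jk)).
  by move=> kj; have -> : nat_of_ord j = k.+1 by apply/eqP; rewrite eqn_leq kj -ltnS ltn_ord.
split; last exact: (h ord_max).
by apply/forallP => j; exact: (h (widen_ord (leqnSn _) j)).
Qed.

Lemma stopped_dist a k : `|\sum_(i < k) stopped a i - k%:R| <= M.
Proof.
elim: k => [|k ih]; first by rewrite big_ord0 subrr normr0.
have := all_withinE a k; case: (boolP [forall j : 'I__, _]) => [/forallP h _|_ e].
  have -> : \sum_(i < k.+1) stopped a i = \sum_(i < k.+1) a i.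
    apply: eq_bigr => i _; rewrite /stopped all_withinE.
    suff -> : [forall j : 'I_i.+1, `|\sum_(i < j.+1) a i - j.+1%:R| <= M] by rewrite mul1r subrr addr0.
    apply/forallP => j; have jk : (j < k.+1)%N by apply: leq_trans (ltn_ord j) _; rewrite ltn_ord.
    exact: (h (Ordinal jk)).
  exact: (h ord_max).
rewrite big_ord_recr /= /stopped e mul0r add0r subr0 -[k.+1%:R]natr1 opprD addrACA subrr addr0.
exact: ih.
Qed.

Lemma stopped_ge0 a k : (forall i, 0 <= a i) -> 0 <= stopped a k.
Proof.
move=> a0; rewrite /stopped all_withinE; case: [forall j, _] => /=.
  by rewrite mul1r subrr addr0.
by rewrite mul0r add0r subr0.
Qed.

Lemma stopped_id (a : nat -> R) k : (forall j, `|\sum_(i < j.+1) a i - j.+1%:R| <= M) -> stopped a k = a k.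
Proof.
move=> h; rewrite /stopped all_withinE (_ : [forall j : 'I_k.+1, _] = true) ?mul1r ?subrr ?addr0//.
by apply/forallP.
Qed.

End truncation.

Section reduction.
Context {d : measure_display} {T : measurableType d} {R : realType}.
Variables (mu : probability T R) (F : nat -> set (set T)) (eta : nat -> T -> R) (K L M : R).
Hypotheses (L0 : 0 < L) (M0 : 0 < M).
Hypothesis FF : filtration F.
Hypothesis mdF : martingale_diff mu F eta.
Variables c v : nat -> T -> \bar R.
Hypothesis cv : forall i, (0 < i)%N ->
  is_cond_exp mu (F i.-1) (fun w => (`|eta i w| ^+ 3 * expR (K * `|eta i w|))%:E) (c i) /\
  is_cond_exp mu (F i.-1) (fun w => (eta i w ^+ 2)%:E) (v i) /\
  {ae mu, forall w, (c i w <= L%:E * v i w)%E}.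
Hypothesis vM : forall n, (0 < n)%N ->
  {ae mu, forall w, (`| \sum_(1 <= i < n.+1) v i w - (n%:R)%:E | <= M%:E)%E}.

Let sF k : sigma_algebra setT (F k). Proof. by case: FF. Qed.
Let mF k : F k `<=` measurable. Proof. by case: FF => _ []. Qed.
Let iF i j : (i <= j)%N -> F i `<=` F j. Proof. by case: FF => _ [_] [h _]; exact: h. Qed.

Let a k w := fine (v k.+1 w).
Let v' k w := stopped M (a ^~ w) k.

Let v_ge0 i w : (0 < i)%N -> (0 <= v i w)%E.
Proof. by move=> /cv[_] [[_] [h _] _]; exact: h. Qed.

Let sma k : sub_measurable (F k) (a k).
Proof.
move=> B mB; have [_ [[h _] _]] := cv k.+1 (ltn0Sn k).
by have := @fine_measurable R _ measurableT measurableT _ mB; rewrite setTI => /h.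
Qed.

Let sm_up i j (f : T -> R) : (i <= j)%N -> sub_measurable (F i) f -> sub_measurable (F j) f.
Proof. by move=> ij h B mB; apply: (iF _ _ ij); exact: h. Qed.

Let sm_within k : sub_measurable (F k) (fun w => within M (a ^~ w) k).
Proof.
apply: (sm_comp _ (fun w => \sum_(i < k.+1) a i w) (\1_(`[k.+1%:R - M, k.+1%:R + M]%classic))).
  by apply: measurable_indic.
by apply: (sm_sum _ (sF k)) => i ik; apply: (sm_up i).
Qed.

Let sm_all_within k : sub_measurable (F k) (fun w => all_within M (a ^~ w) k).
Proof.
elim: k => [|k ih]; first exact: sm_within.
apply: (sm_mul _ (sF k.+1)); last exact: sm_within.
exact: (sm_up k).
Qed.

Let smv k : sub_measurable (F k) (v' k).
Proof.
apply: (sm_add _ (sF k)); first exact: (sm_mul _ (sF k)).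
by apply: (sm_sub _ (sF k)) => //; exact: (sm_cst _ (sF k)).
Qed.

Let ae_v : {ae mu, forall w, forall k, v k.+1 w = (v' k w)%:E}.
Proof.
have h : {ae mu, forall w, forall n, (`| \sum_(1 <= i < n.+2) v i w - (n.+1%:R)%:E | <= M%:E)%E}.
  by apply: ae_foralln => n; exact: vM.
apply: filterS h => w h k.
have fs n : (\sum_(1 <= i < n.+2) v i w)%E \is a fin_num.
  have : (`| \sum_(1 <= i < n.+2) v i w - (n.+1%:R)%:E |)%E \is a fin_num.
    by rewrite ge0_fin_numE//; apply: le_lt_trans (h n) _; rewrite ltry.
  by rewrite abse_fin_num fin_numB => /andP[].
have fv i : v i.+1 w \is a fin_num.
  by have /sum_fin_numP/(_ i.+1) := fs i; apply => //; rewrite mem_index_iota ltnS leqnn.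
have va i : v i.+1 w = (a i w)%:E by rewrite /a fineK.
rewrite va /v' stopped_id// => j.
have := h j; rewrite big_add1 /= big_mkord.
rewrite (eq_bigr (fun i : 'I_j.+1 => (a i w)%:E)); last by move=> i _; exact: va.
by rewrite sumEFin -EFinD /= lee_fin.
Qed.

Let me_v i : (0 < i)%N -> measurable_fun setT (v i).
Proof. by move=> /cv[_] [[h _] _] _ B mB; rewrite setTI; apply: (mF i.-1); exact: h. Qed.

Let me_c i : (0 < i)%N -> measurable_fun setT (c i).
Proof. by move=> /cv[[h _] _] _ B mB; rewrite setTI; apply: (mF i.-1); exact: h. Qed.

Let me_v' k : measurable_fun setT (v' k).
Proof. exact: (sm_meas _ (mF k) _ (smv k)). Qed.

Lemma md_sys_of : md_sys mu F (fun k => eta k.+1) v' K L M.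
Proof.
split => //.
- by move=> k; exact: iF.
- by move=> k; have [] := mdF k.+1 (ltn0Sn k).
- by move=> k w; apply: stopped_ge0 => i; apply: fine_ge0; exact: v_ge0.
- by move=> k w; apply: stopped_dist; exact: ltW.
- move=> k A FA; have mA := mF _ _ FA.
  have [_ [ie /(_ A FA)]] := mdF k.+1 (ltn0Sn k).
  have ieA := integrableS measurableT mA (@subsetT _ _) ie.
  have fp := integrable_pos_fin_num mA ieA; have fn := integrable_neg_fin_num mA ieA.
  rewrite integralE => /eqP; rewrite sube_eq// ?add0e.
  move=> /eqP e; transitivity (\int[mu]_(x in A) (EFin \o eta k.+1)^\+%E x)%E.
    by apply: eq_integral => w _; rewrite funeposE /= EFin_max.
  rewrite [LHS]e; apply: eq_integral => w _.
  by rewrite funenegE /= EFin_max EFinN.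
- move=> k A FA; have mA := mF _ _ FA.
  have [_ [[_ [_ /(_ A FA) <-]] _]] := cv k.+1 (ltn0Sn k).
  apply: ae_eq_integral => //.
  + by apply: measurable_funTS; exact: me_v.
  + by apply: measurable_funTS; exact/measurable_EFinP.
  + by apply: filterS ae_v => w h _; exact: h.
- move=> k A FA; have mA := mF _ _ FA.
  have [[_ [c0 /(_ A FA) <-]] [_ cle]] := cv k.+1 (ltn0Sn k).
  apply: ae_ge0_le_integral => //.
  + by apply: measurable_funTS; exact: me_c.
  + by move=> w _; rewrite lee_fin mulr_ge0 ?(ltW L0)//; apply: stopped_ge0 => i; apply: fine_ge0; exact: v_ge0.
  + by apply: measurable_funTS; apply/measurable_EFinP; apply: measurable_funM.
  + apply: filterS2 ae_v cle => w hv hc _.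
    by apply: le_trans hc _; rewrite (hv k) EFinM.
Qed.

End reduction.

(** * The quantile coupling *)

Section quantile.
Context {R : realType}.
Variable Fn : R -> R.
Hypothesis Fn_mono : forall a b, a <= b -> Fn a <= Fn b.
Hypothesis Fn_up : forall p : R, p < 1 -> exists y, p <= Fn y.
Hypothesis Fn_lo : forall p : R, 0 < p -> exists y, Fn y < p.

Let has_lb (p : R) : 0 < p -> has_lbound [set y | p <= Fn y].
Proof.
move=> /Fn_lo[y yp]; exists y => z /= pz; rewrite leNgt; apply/negP => zy.
by have := le_lt_trans (Fn_mono _ _ (ltW zy)) yp; rewrite ltNge pz.
Qed.

Lemma quantile_lt (p y : R) : p < 1 -> quantile Fn p < y -> p <= Fn y.
Proof.
move=> p1 /inf_lt[|z /= pz zy]; first by have [z hz] := Fn_up _ p1; exists z.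
by apply: le_trans pz _; apply: Fn_mono; exact: ltW.
Qed.

Lemma quantile_gt (p y : R) : 0 < p -> y < quantile Fn p -> Fn y < p.
Proof.
move=> p0 yq; rewrite ltNge; apply/negP => pF.
by have := ge_inf (has_lb _ p0) pF; rewrite leNgt yq.
Qed.

Lemma quantile_le (p q : R) : 0 < p -> q < 1 -> p <= q -> quantile Fn p <= quantile Fn q.
Proof.
move=> p0 q1 pq; rewrite leNgt; apply/negP => /midf_lt[h1 h2].
have := quantile_lt _ _ q1 h1; have := quantile_gt _ _ p0 h2; lra.
Qed.

End quantile.

Section normal.
Context {R : realType}.

Lemma Phi_lt1 (x : R) : Phi x < 1.
Proof. by have := @Phi_gt0 R (- x); rewrite Phi_sym; lra. Qed.

Lemma Phi_surj (b : R) : 0 < b -> b < 1 -> exists z, Phi z = b.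
Proof.
move=> b0 b1; pose m := Num.min b (1 - b).
have m0 : 0 < m by rewrite lt_min b0; lra.
have mb : m <= b by rewrite ge_min lexx.
have mb' : m <= 1 - b by rewrite ge_min lexx orbT.
clearbody m; pose y := 2 / m.
have y0 : 0 < y by rewrite divr_gt0.
have ym : y * m = 2 by rewrite /y divfK// gt_eqF.
have hy : Phi (- y) <= m.
  apply: le_trans (Phi_tail _ (ltW y0)) _.
  rewrite (_ : - y ^+ 2 / 2 = - (y ^+ 2 / 2)); last by ring.
  rewrite expRN -[leRHS]invrK lef_pV2 ?posrE ?invr_gt0 ?expR_gt0//.
  apply: le_trans (expR_ge1Dx _).
  rewrite -[m^-1]mul1r ler_pdivrMr//; clearbody y; nra.
have [|z _ hz] := @IVT R Phi (- y) y b (ltac:(lra)) (continuous_subspaceT continuous_Phi).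
  have := Phi_sym (- y); rewrite opprK => e.
  have yy : Phi (- y) <= Phi y by apply: Phi_le; lra.
  by rewrite (min_idPl yy) (max_idPr yy) e; apply/andP; split; lra.
by exists z.
Qed.

Context {d : measure_display} {T : measurableType d}.
Variables (mu : probability T R) (Z : T -> R).
Hypothesis mZ : measurable_fun setT Z.
Hypothesis lawZ : forall A, measurable A -> mu (Z @^-1` A) = normal_prob 0 1 A.

Lemma normal_le z : mu [set w | Z w <= z] = (Phi z)%:E.
Proof.
have := lawZ `]-oo, z]%classic (measurable_itv _).
rewrite /Phi fineK; last exact: fin_num_measure.
by move=> <-; congr (mu _); apply/seteqP; split => w /=; rewrite in_itv.
Qed.

Lemma normal_gt z : mu [set w | z < Z w] = (Phi (- z))%:E.
Proof.
rewrite (_ : [set w | _] = ~` [set w | Z w <= z]); last first.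
  by apply/seteqP; split => w /=; [move=> h /(lt_le_trans h); rewrite ltxx|move/negP; rewrite -ltNge].
rewrite probability_setC; last first.
  have := mZ measurableT `]-oo, z]%classic (measurable_itv _); rewrite setTI.
  by rewrite (_ : _ @^-1` _ = [set w | Z w <= z])//; apply/seteqP; split => w /=; rewrite in_itv.
by rewrite normal_le Phi_sym EFinB.
Qed.

Let mPhi : measurable_fun setT (fun w => Phi (Z w)).
Proof. by apply: measurableT_comp => //; exact: measurable_Phi. Qed.

Lemma measurable_PhiZ_le b : measurable [set w | Phi (Z w) <= b].
Proof.
have := mPhi measurableT `]-oo, b]%classic (measurable_itv _); rewrite setTI.
by rewrite (_ : _ @^-1` _ = [set w | Phi (Z w) <= b])//; apply/seteqP; split => w /=; rewrite in_itv.
Qed.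

Lemma measurable_PhiZ_gt b : measurable [set w | b < Phi (Z w)].
Proof.
have := mPhi measurableT `]b, +oo[%classic (measurable_itv _); rewrite setTI.
by rewrite (_ : _ @^-1` _ = [set w | b < Phi (Z w)])//; apply/seteqP; split => w /=; rewrite in_itv/= andbT.
Qed.

Lemma PhiZ_le (b : R) : 0 < b -> (mu [set w | (Phi (Z w) <= b)%R] <= b%:E)%E.
Proof.
move=> b0; have [b1|b1] := leP 1 b.
  by apply: le_trans (probability_le1 _ (measurable_PhiZ_le b)) _; rewrite lee_fin.
have [z hz] := Phi_surj b b0 b1; rewrite -hz -normal_le le_eqVlt; apply/orP; left; apply/eqP.
congr (mu _); apply/seteqP; split => w /=; last exact: Phi_le.
by move=> h; rewrite leNgt; apply/negP => /Phi_lt; rewrite ltNge h.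
Qed.

Lemma PhiZ_gt (b : R) : 0 < b -> (mu [set w | (1 - b < Phi (Z w))%R] <= b%:E)%E.
Proof.
move=> b0; have [b1|b1] := leP 1 b.
  by apply: le_trans (probability_le1 _ (measurable_PhiZ_gt _)) _; rewrite lee_fin.
have [z hz] : exists z : R, Phi z = 1 - b by apply: Phi_surj; lra.
have e : b = Phi (- z) by rewrite Phi_sym hz; lra.
rewrite -hz e -normal_gt le_eqVlt; apply/orP; left; apply/eqP.
congr (mu _); apply/seteqP; split => w /=; last exact: Phi_lt.
by move=> h; rewrite ltNge; apply/negP => /Phi_le; rewrite leNgt h.
Qed.

End normal.

Lemma near_sqr {R : realType} (y e : R) : 0 <= e -> e <= 1 / 4 ->
  (y + e) ^+ 2 + 1 <= 3 / 2 * (y ^+ 2 + 1) /\ (y - e) ^+ 2 + 1 <= 3 / 2 * (y ^+ 2 + 1).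
Proof.
move=> e0 e1; have h0 := sqr_ge0 y.
have h1 := mulr_ge0 e0 (sqr_ge0 (y - 1)); have h2 := mulr_ge0 e0 (sqr_ge0 (y + 1)).
have h3 : e * (y ^+ 2 + 1) <= 1 / 4 * (y ^+ 2 + 1) by rewrite ler_wpM2r//; lra.
have h4 : e ^+ 2 <= 1 / 16 by nra.
by split; lra.
Qed.

Section coupling.
Context {R : realType} {d : measure_display} {T : measurableType d}.
Variables (mu : probability T R) (Z : T -> R).
Hypothesis mZ : measurable_fun setT Z.
Hypothesis lawZ : forall A, measurable A -> mu (Z @^-1` A) = normal_prob 0 1 A.
Variable Fn : R -> R.
Hypothesis Fn_mono : forall a b, a <= b -> Fn a <= Fn b.
Hypothesis Fn_up : forall p : R, p < 1 -> exists y, p <= Fn y.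
Hypothesis Fn_lo : forall p : R, 0 < p -> exists y, Fn y < p.

Let W w := quantile Fn (Phi (Z w)).

Lemma measurable_W : measurable_fun setT W.
Proof.
apply: (measurableT_comp (f := fun z => quantile Fn (Phi z))) => //.
apply: nondecreasing_measurable => // a b ab.
by apply: quantile_le => //; [exact: Phi_gt0|exact: Phi_lt1|exact: Phi_le].
Qed.

Lemma W_gt (a b : R) : 0 < b -> 1 - Fn a <= b -> (mu [set w | (a < W w)%R] <= b%:E)%E.
Proof.
move=> b0 hb; apply: le_trans (PhiZ_gt mu Z mZ lawZ b b0); apply: le_measure; rewrite ?inE.
- have := measurable_W measurableT `]a, +oo[%classic (measurable_itv _); rewrite setTI.
  by rewrite (_ : _ @^-1` _ = [set w | a < W w])//; apply/seteqP; split => w /=; rewrite in_itv/= andbT.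
- exact: (measurable_PhiZ_gt Z mZ).
move=> w /= h; have := quantile_gt Fn Fn_mono Fn_lo _ _ (Phi_gt0 (Z w)) h; lra.
Qed.

Lemma W_lt (a b : R) : 0 < b -> Fn a <= b -> (mu [set w | (W w < a)%R] <= b%:E)%E.
Proof.
move=> b0 hb; apply: le_trans (PhiZ_le mu Z mZ lawZ b b0); apply: le_measure; rewrite ?inE.
- have := measurable_W measurableT `]-oo, a[%classic (measurable_itv _); rewrite setTI.
  by rewrite (_ : _ @^-1` _ = [set w | W w < a])//; apply/seteqP; split => w /=; rewrite in_itv.
- exact: (measurable_PhiZ_le Z mZ).
move=> w /= h; have := quantile_lt Fn Fn_mono Fn_up _ _ (Phi_lt1 (Z w)) h; lra.
Qed.

(* The comparison is used at [W w + e] and [W w - e], where the quantile property gives strict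
   information; the factor 2 in the conclusion absorbs [e]. *)
Lemma W_close (al D q : R) w : 0 < al -> 0 < q -> 0 < D ->
  (forall y, `|y| <= 2 * al -> Phi (y - D * (y ^+ 2 + 1) * q) <= Fn y /\
     Fn y <= Phi (y + D * (y ^+ 2 + 1) * q)) ->
  `|W w| <= al -> `|W w - Z w| <= 2 * D * (W w ^+ 2 + 1) * q.
Proof.
move=> al0 q0 D0 h Wal.
have Dq : 0 < D * q by rewrite mulr_gt0.
pose e := Num.min al (Num.min (1 / 4) (D * q / 2)).
have e0 : 0 < e by rewrite !lt_min al0; apply/andP; split; lra.
have e1 : e <= al by rewrite ge_min lexx.
have e2 : e <= 1 / 4 by rewrite !ge_min lexx orbT.
have e3 : e <= D * q / 2 by rewrite !ge_min lexx !orbT.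
clearbody e.
have [p0 p1] : 0 < Phi (Z w) /\ Phi (Z w) < 1 by split; [exact: Phi_gt0|exact: Phi_lt1].
have inj a b : Phi a <= Phi b -> a <= b :> R.
  by move=> hab; rewrite leNgt; apply/negP => /Phi_lt; lra.
have up : Phi (Z w) <= Fn (W w + e) by apply: (quantile_lt Fn Fn_mono Fn_up) => //; rewrite -/(W w); lra.
have lo : Fn (W w - e) <= Phi (Z w).
  by apply: ltW; apply: (quantile_gt Fn Fn_mono Fn_lo) => //; rewrite -/(W w); lra.
move: Wal up lo; rewrite !ler_norml; set W0 := W w; clearbody W0 => /andP[Wa Wb] up lo.
have [_ g1] := h (W0 + e) ltac:(rewrite ler_norml; apply/andP; split; lra).
have [g2 _] := h (W0 - e) ltac:(rewrite ler_norml; apply/andP; split; lra).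
have k1 := inj _ _ (le_trans up g1); have k2 := inj _ _ (le_trans g2 lo).
have [b1 b2] := near_sqr W0 e (ltW e0) e2.
have b3 : e <= D * q * (W0 ^+ 2 + 1) / 2.
  by have := mulr_ge0 (ltW Dq) (sqr_ge0 W0); lra.
move: Dq b1 b2 b3 k1 k2; clear - e0 => Dq b1 b2 b3 k1 k2.
have c1 := ler_wpM2l (ltW Dq) b1; have c2 := ler_wpM2l (ltW Dq) b2.
by apply/andP; split; lra.
Qed.

End coupling.

Section coupling_tail.
Context {R : realType} {d : measure_display} {T : measurableType d}.
Variables (mu : probability T R) (Z : T -> R).
Hypothesis mZ : measurable_fun setT Z.
Hypothesis lawZ : forall A, measurable A -> mu (Z @^-1` A) = normal_prob 0 1 A.
Variable Fn : R -> R.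
Hypothesis Fn_mono : forall a b, a <= b -> Fn a <= Fn b.
Hypothesis Fn_up : forall p : R, p < 1 -> exists y, p <= Fn y.
Hypothesis Fn_lo : forall p : R, 0 < p -> exists y, Fn y < p.

Let W w := quantile Fn (Phi (Z w)).

Let mW : measurable_fun setT W := measurable_W Z mZ Fn Fn_mono Fn_up Fn_lo.

Let set_gt (f : T -> R) (a : R) : measurable_fun setT f -> measurable [set w | a < f w].
Proof.
move=> mf; have := mf measurableT `]a, +oo[%classic (measurable_itv _); rewrite setTI.
by rewrite (_ : _ @^-1` _ = [set w | a < f w])//; apply/seteqP; split => w /=; rewrite in_itv/= andbT.
Qed.

Let set_lt (f : T -> R) (a : R) : measurable_fun setT f -> measurable [set w | f w < a].
Proof.
move=> mf; have := mf measurableT `]-oo, a[%classic (measurable_itv _); rewrite setTI.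
by rewrite (_ : _ @^-1` _ = [set w | f w < a])//; apply/seteqP; split => w /=; rewrite in_itv.
Qed.

Let set_abs (f : T -> R) (a : R) : [set w | a < `|f w|] = [set w | a < f w] `|` [set w | f w < - a].
Proof.
apply/seteqP; split => w /=; rewrite ltr_normr.
  by rewrite [a < - _]ltrNr => /orP.
by move=> h; apply/orP; rewrite [a < - _]ltrNr.
Qed.

Lemma W_abs_gt (t b : R) : 0 < b -> 1 - Fn t <= b -> Fn (- t) <= b ->
  (mu [set w | (t < `|W w|)%R] <= (2 * b)%:E)%E.
Proof.
move=> b0 h1 h2; rewrite set_abs.
apply: le_trans (measureU2 _ _ _) _; [exact: set_gt|exact: set_lt|].
rewrite mulr_natl mulr2n EFinD; apply: leeD.
  exact: (W_gt mu Z mZ lawZ Fn Fn_mono Fn_up Fn_lo).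
exact: (W_lt mu Z mZ lawZ Fn Fn_mono Fn_up Fn_lo).
Qed.

Lemma Z_abs_gt (a : R) : 0 <= a -> (mu [set w | (a < `|Z w|)%R] <= (2 * expR (- a ^+ 2 / 2))%:E)%E.
Proof.
move=> a0; rewrite set_abs.
apply: le_trans (measureU2 _ _ _) _; [exact: set_gt|exact: set_lt|].
have ht := Phi_tail _ a0.
rewrite mulr_natl mulr2n EFinD; apply: leeD.
  apply: (@le_trans _ _ (Phi (- a))%:E); last by rewrite lee_fin.
  by rewrite -(normal_gt mu Z mZ lawZ).
apply: (@le_trans _ _ (mu [set w | Z w <= - a])).
  apply: le_measure; rewrite ?inE; [exact: set_lt| |by move=> w /ltW].
  have := mZ measurableT `]-oo, - a]%classic (measurable_itv _); rewrite setTI.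
  by rewrite (_ : _ @^-1` _ = [set w | Z w <= - a])//; apply/seteqP; split => w /=; rewrite in_itv.
by rewrite (normal_le mu Z lawZ) lee_fin.
Qed.

Variables (K L M al D s l lam : R).
Hypotheses (K0 : 0 < K) (L0 : 0 < L) (M0 : 0 < M) (al0 : 0 < al) (alK : al <= K)
  (alL : 4 * L * al <= 1) (al1 : al <= 1) (D0 : 0 < D) (s0 : 0 < s) (l1 : 1 <= l).
Hypothesis lK : 2 * (3 / 2 + L) <= Num.min K 1 * l.
Hypotheses (lam0 : 0 <= lam) (lam1 : lam <= 1 / 8) (lam2 : lam <= al ^+ 2 / 4)
  (lam3 : lam <= (16 * D)^-1).
Hypothesis Fch : forall k y : R, 0 <= k -> k <= K ->
  let b := expR (- (k * (y * s)) + (k ^+ 2 / 2 + L * k ^+ 3) * (s ^+ 2 + M)) in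
  1 - Fn y <= b /\ Fn (- y) <= b.
Hypothesis Fclose : forall w, `|W w| <= al * s -> s * `|W w - Z w| / l <= 2 * D * (W w ^+ 2 + 1).

Let C3 := (1 / 2 + L) * M.
Let A x := [set w | x < s * `|W w - Z w| / l].

Let mA x : measurable (A x).
Proof.
apply: set_gt; apply: measurable_funM => //; apply: measurable_funM => //.
by apply: measurableT_comp => //; exact: measurable_funB.
Qed.

Let C30 : 0 <= C3.
Proof. by rewrite /C3 mulr_ge0 ?(ltW M0)//; move: L0; lra. Qed.

Lemma close_tail_mid x : 4 * D <= x -> x <= s ^+ 2 ->
  (mu (A x) <= (2 * expR (C3 - lam * x))%:E)%E.
Proof.
move=> hD xs; have x0 : 0 < x by move: D0; lra.
have [t [t0 t1 t2 t3]] : exists t : R, [/\ 0 <= t, t <= al * s, t ^+ 2 <= x / (4 * D) & 4 * lam * x <= t ^+ 2].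
  have e0 : 0 <= x / (4 * D) by rewrite divr_ge0 ?(ltW x0)//; move: D0; lra.
  exists (Num.min (Num.sqrt (x / (4 * D))) (al * s)); split.
  - by rewrite le_min sqrtr_ge0 mulr_ge0 ?ltW.
  - by rewrite ge_min lexx orbT.
  - rewrite -[leRHS]sqr_sqrtr// ler_sqr ?nnegrE ?sqrtr_ge0 ?ge_min ?lexx//.
    by rewrite le_min sqrtr_ge0 mulr_ge0 ?ltW.
  - rewrite /Num.min; case: ifP => _.
      rewrite sqr_sqrtr// -mulrA [x / _]mulrC mulrA ler_wpM2r ?(ltW x0)//.
      move: lam3; rewrite !invfM; lra.
    rewrite exprMn; apply: ler_pM => //; first by rewrite mulr_ge0.
      exact: ltW.
    by move: lam2; lra.
have sle : t / s <= al by rewrite ler_pdivrMr.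
have sge : 0 <= t / s by rewrite divr_ge0 // ltW.
have [f1 f2] := Fch (t / s) t sge (le_trans sle alK).
have hb : expR (- (t / s * (t * s)) + ((t / s) ^+ 2 / 2 + L * (t / s) ^+ 3) * (s ^+ 2 + M)) <=
    expR (C3 - lam * x).
  rewrite ler_expR.
  have ts : t = t / s * s by rewrite divfK// gt_eqF.
  move: sle sge ts t3; move: (t / s) => k sle sge -> t3.
  have k1 : k <= 1 by move: al1; lra.
  have h1 : k ^+ 2 / 2 + L * k ^+ 3 <= 1 / 2 + L.
    apply: lerD; last by rewrite ler_piMr ?(ltW L0)// expr_le1.
    by rewrite ler_pM2r ?invr_gt0// expr_le1.
  have h2 := ler_wpM2r (ltW M0) h1.
  have h3 : L * k <= 1 / 4 by have := ler_wpM2l (ltW L0) sle; move: alL; lra.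
  have h4 := ler_wpM2r (sqr_ge0 (k * s)) h3.
  move: h2 h4 t3; rewrite /C3; lra.
apply: (@le_trans _ _ (mu [set w | (t < `|W w|)%R])); last first.
  apply: le_trans (W_abs_gt t _ (expR_gt0 _) f1 f2) _.
  by rewrite lee_fin ler_wpM2l.
apply: le_measure; rewrite ?inE; [exact: mA| |].
  by apply: set_gt; apply: measurableT_comp.
move=> w; rewrite /A /= => hx; rewrite ltNge; apply/negP => hW.
have := Fclose w (le_trans hW t1).
have : W w ^+ 2 <= t ^+ 2 by rewrite -[leLHS]real_normK ?num_real// ler_sqr ?nnegrE.
move: hx t2; rewrite ler_pdivlMr; last by move: D0; lra.
move: (s * _ / l) (W w ^+ 2) => u q hx h1 h2 h3.
have := ler_wpM2l (ltW D0) h2; move: hD D0; lra.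
Qed.

Lemma close_tail_far x : s ^+ 2 < x ->
  (mu (A x) <= (2 * expR (C3 - x) + 2 * expR (- (x / 8)))%:E)%E.
Proof.
move=> xs; have ss0 : 0 < s ^+ 2 by rewrite exprn_gt0.
have x0 : 0 < x by exact: lt_trans xs.
have l0 : 0 < l by move: l1; lra.
pose a := x * l / (2 * s).
have a0 : 0 <= a by rewrite divr_ge0 ?mulr_ge0 ?ltW.
have kap0 : 0 <= Num.min K 1 by rewrite le_min ler01 ltW.
have kapK : Num.min K 1 <= K by rewrite ge_min lexx.
have kap1 : Num.min K 1 <= 1 by rewrite ge_min lexx orbT.
have [f1 f2] := Fch (Num.min K 1) a kap0 kapK.
have hb : expR (- (Num.min K 1 * (a * s)) + (Num.min K 1 ^+ 2 / 2 + L * Num.min K 1 ^+ 3) * (s ^+ 2 + M)) <=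
    expR (C3 - x).
  rewrite ler_expR; move: lK kap0 kap1; move: (Num.min K 1) => k lk k0 k1.
  have -> : k * (a * s) = k * l * x / 2 by rewrite /a; field; rewrite gt_eqF.
  have h1 : k ^+ 2 / 2 + L * k ^+ 3 <= 1 / 2 + L.
    apply: lerD; last by rewrite ler_piMr ?(ltW L0)// expr_le1.
    by rewrite ler_pM2r ?invr_gt0// expr_le1.
  have h2 : (k ^+ 2 / 2 + L * k ^+ 3) * (s ^+ 2 + M) <= (1 / 2 + L) * (x + M).
    apply: ler_pM => //; last by rewrite lerD2r ltW.
    - by rewrite addr_ge0 ?mulr_ge0 ?exprn_ge0 ?divr_ge0 ?sqr_ge0 ?(ltW L0).
    - by rewrite addr_ge0 ?ltW.
  have h3 := ler_wpM2r (ltW x0) lk.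
  by move: h2 h3; rewrite /C3; lra.
have ha : expR (- a ^+ 2 / 2) <= expR (- (x / 8)).
  rewrite ler_expR.
  suff : x / 4 <= a ^+ 2 by lra.
  have -> : a ^+ 2 = x / 4 * (x / s ^+ 2 * l ^+ 2) by rewrite /a; field; rewrite gt_eqF.
  rewrite ler_peMr ?divr_ge0 ?(ltW x0)//.
  rewrite -[leLHS]mulr1; apply: ler_pM => //.
    by rewrite ler_pdivlMr// mul1r ltW.
  by rewrite expr_ge1// ltW.
apply: (@le_trans _ _ (mu ([set w | (a < `|W w|)%R] `|` [set w | (a < `|Z w|)%R]))).
  apply: le_measure; rewrite ?inE; [exact: mA| |].
    by apply: measurableU; apply: set_gt; apply: measurableT_comp.
  move=> w; rewrite /A /= => hx.
  have [h1|h1] := ltP a `|W w|; first by left.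
  right; rewrite ltNge; apply/negP => h2.
  have : s * `|W w - Z w| / l <= x.
    rewrite ler_pdivrMr// -ler_pdivlMl//; apply: le_trans (ler_normB _ _) _.
    have -> : s^-1 * (x * l) = a + a by rewrite /a; field; rewrite gt_eqF.
    exact: lerD.
  by rewrite leNgt hx.
apply: le_trans (measureU2 _ _ _) _; [by apply: set_gt; apply: measurableT_comp..|].
rewrite EFinD; apply: leeD.
  apply: le_trans (W_abs_gt a _ (expR_gt0 _) f1 f2) _.
  by rewrite lee_fin ler_wpM2l.
by apply: le_trans (Z_abs_gt _ a0) _; rewrite lee_fin ler_wpM2l.
Qed.

Lemma close_tail x : 0 <= x ->
  (mu (A x) <= (4 * expR (C3 + 4 * D) * expR (- (lam * x)))%:E)%E.
Proof.
move=> x0; rewrite -mulrA -expRD.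
have [hD|hD] := leP (4 * D) x; last first.
  apply: le_trans (probability_le1 _ (mA x)) _; rewrite lee_fin.
  have : lam * x <= 1 * (4 * D) by apply: ler_pM => //; [move: lam1; lra|exact: ltW].
  have := expR_ge1Dx (C3 + 4 * D + - (lam * x)); move: C30; lra.
have [xs|xs] := leP x (s ^+ 2).
  apply: le_trans (close_tail_mid x hD xs) _; rewrite lee_fin.
  have : expR (C3 - lam * x) <= expR (C3 + 4 * D + - (lam * x)).
    by rewrite ler_expR; move: D0; lra.
  have := expR_ge0 (C3 + 4 * D + - (lam * x)); lra.
apply: le_trans (close_tail_far x xs) _; rewrite lee_fin.
have h := ler_wpM2r x0 lam1.
have : expR (C3 - x) <= expR (C3 + 4 * D + - (lam * x)).
  by rewrite ler_expR; move: D0; lra.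
have : expR (- (x / 8)) <= expR (C3 + 4 * D + - (lam * x)).
  by rewrite ler_expR; move: D0 C30; lra.
lra.
Qed.

End coupling_tail.

Section distribution.
Context {R : realType} {d : measure_display} {T : measurableType d}.
Variables (mu : probability T R) (F : nat -> set (set T)) (eta : nat -> T -> R)
  (v : nat -> T -> R) (K L M : R).
Hypotheses (K0 : 0 < K) (L0 : 0 < L) (M0 : 0 < M).
Hypothesis sys : md_sys mu F (fun k => eta k.+1) v K L M.
Variable n : nat.
Hypothesis n0 : (0 < n)%N.

Local Notation x := (fun k => eta k.+1).
Local Notation mx := (fun k w => - eta k.+1 w).
Local Notation s := (Num.sqrt (n%:R : R)).

Let s0 : 0 < s. Proof. by rewrite sqrtr_gt0 ltr0n. Qed.

Let mxs : md_sys mu F mx v K L M := md_sys_opp mu F x v K L M sys.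

Let event y : [set w | (\sum_(1 <= i < n.+1) eta i w) / s <= y] = [set w | psum x n w <= y * s].
Proof.
by apply/seteqP; split => w /=; rewrite /psum big_add1 /= big_mkord ler_pdivrMr.
Qed.

Lemma distr_fn_compl y : distr_fn mu eta n y = 1 - pgt mu x n (y * s).
Proof.
have mg := meas_gt mu F x v K L M sys n (y * s).
rewrite /distr_fn /pgt event (_ : [set w | _ <= _] = ~` [set w | y * s < psum x n w]); last first.
  by apply/seteqP; split => w /=; [move=> h /(le_lt_trans h); rewrite ltxx|move/negP; rewrite -leNgt].
by rewrite probability_setC// fineB//; exact: fin_num_measure.
Qed.

Lemma distr_fn_opp y : distr_fn mu eta n (- y) = pge mu mx n (y * s).
Proof.
rewrite /distr_fn /pge event; congr (fine (mu _)); apply/seteqP; split => w /=.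
  by rewrite /psum sumrN lerNr mulNr.
by rewrite /psum sumrN lerNr mulNr.
Qed.

Lemma distr_fn_mono a b : a <= b -> distr_fn mu eta n a <= distr_fn mu eta n b.
Proof.
move=> ab; have h y := md_meas mxs _ _ (F_ge mu F mx v K L M mxs n (y * s)).
rewrite -[a]opprK -[b]opprK !distr_fn_opp /pge; apply: fine_le.
- by apply: fin_num_measure; exact: h.
- by apply: fin_num_measure; exact: h.
apply: le_measure; rewrite ?inE; [exact: h|exact: h|].
by move=> w /=; apply: le_trans; rewrite ler_pM2r// lerN2.
Qed.

Lemma distr_fn_tail (k y : R) : 0 <= k -> k <= K ->
  let b := expR (- (k * (y * s)) + (k ^+ 2 / 2 + L * k ^+ 3) * (s ^+ 2 + M)) in
  1 - distr_fn mu eta n y <= b /\ distr_fn mu eta n (- y) <= b.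
Proof.
move=> k0 kK b; have e : b = expR (- (k * (y * s)) + (k ^+ 2 / 2 + L * k ^+ 3) * (n%:R + M)).
  by rewrite /b sqr_sqrtr.
split; rewrite e.
  rewrite distr_fn_compl opprB addrC subrK.
  apply: le_trans (pgt_le_pge K L mu F x v M n _ sys) _.
  exact: (pge_chernoff K L L0 mu F x v M).
by rewrite distr_fn_opp; exact: (pge_chernoff K L L0 mu F mx v M).
Qed.

Let tail_small (e : R) : 0 < e -> exists y,
  expR (- (K * (y * s)) + (K ^+ 2 / 2 + L * K ^+ 3) * (s ^+ 2 + M)) < e.
Proof.
move=> e0; set c := (_ + L * _) * _.
exists ((c - ln e + 1) / (K * s)).
rewrite -[ltRHS]lnK ?posrE// ltr_expR.
have -> : K * ((c - ln e + 1) / (K * s) * s) = c - ln e + 1.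
  by field; rewrite !gt_eqF.
lra.
Qed.

Lemma distr_fn_up (p : R) : p < 1 -> exists y, p <= distr_fn mu eta n y.
Proof.
move=> p1; have [|y hy] := tail_small (1 - p); first lra.
by exists y; have [h _] := distr_fn_tail K y (ltW K0) (lexx K); lra.
Qed.

Lemma distr_fn_lo (p : R) : 0 < p -> exists y, distr_fn mu eta n y < p.
Proof.
move=> p0; have [y hy] := tail_small p p0.
by exists (- y); have [_ h] := distr_fn_tail K y (ltW K0) (lexx K); lra.
Qed.

Lemma distr_fn_close (al q D : R) :
  (forall F x v, md_sys mu F x v K L M -> forall w, 0 <= w -> w <= al * s ->
   Phi (- (w + D * (w ^+ 2 + 1) * q / s)) <= pgt mu x n (w * s) /\
   pge mu x n (w * s) <= Phi (- (w - D * (w ^+ 2 + 1) * q / s))) ->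
  forall y, `|y| <= al * s ->
    Phi (y - D * (y ^+ 2 + 1) * (q / s)) <= distr_fn mu eta n y /\
    distr_fn mu eta n y <= Phi (y + D * (y ^+ 2 + 1) * (q / s)).
Proof.
move=> h y ya; rewrite ![_ * (q / s)]mulrA.
have [y0|y0] := leP 0 y.
  rewrite ger0_norm// in ya.
  have [h1 h2] := h _ _ _ sys y y0 ya.
  have h3 := pgt_le_pge K L mu F x v M n (y * s) sys.
  by move: h1 h2; rewrite distr_fn_compl !Phi_sym; lra.
rewrite ltr0_norm// in ya; have y0' : 0 <= - y by lra.
have [h1 h2] := h _ _ _ mxs (- y) y0' ya.
have h3 := pgt_le_pge K L mu F mx v M n (- y * s) mxs.
rewrite -[in distr_fn _ _ _ _](opprK y) distr_fn_opp; move: h1 h2; rewrite sqrrN.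
rewrite opprD opprK => h1; rewrite opprB opprK addrC => h2; split => //.
exact: le_trans h1 h3.
Qed.

End distribution.

Theorem theorem2 (R : realType) (K L M : R) (hK : 0 < K) (hL : 0 < L)
  (hM : 0 < M) :
  exists (alpha D C lambda : R) (n0 : nat),
    0 < alpha /\ 0 < D /\ 0 < C /\ 0 < lambda /\
    forall (d : measure_display) (T : measurableType d)
      (mu : probability T R) (F : nat -> set (set T))
      (eta : nat -> T -> R) (Z : T -> R),
    filtration F ->
    martingale_diff mu F eta ->
    (exists c v : nat -> T -> \bar R,
       (forall i, (0 < i)%N ->
          is_cond_exp mu (F i.-1)
            (fun w => (`|eta i w| ^+ 3 * expR (K * `|eta i w|))%:E) (c i) /\
          is_cond_exp mu (F i.-1) (fun w => (eta i w ^+ 2)%:E) (v i) /\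
          {ae mu, forall w, (c i w <= L%:E * v i w)%E}) /\
       (forall n, (0 < n)%N ->
          {ae mu, forall w,
             (`| \sum_(1 <= i < n.+1) v i w - (n%:R)%:E | <= M%:E)%E})) ->
    measurable_fun setT Z ->
    (forall A, measurable A -> mu (Z @^-1` A) = normal_prob 0 1 A) ->
    forall n : nat, (n0 <= n)%N ->
      {ae mu, forall w, `|W mu eta Z n w| <= alpha * Num.sqrt (n%:R) ->
         Num.sqrt (n%:R) * `|W mu eta Z n w - Z w| / ln (n%:R)
           <= 2 * D * (W mu eta Z n w ^+ 2 + 1)} /\
      (forall x : R, 0 <= x ->
         (mu [set w | (Num.sqrt (n%:R) * `|W mu eta Z n w - Z w| / ln (n%:R) > x)%R]
           <= (C * expR (- (lambda * x)))%:E)%E).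
Proof.
have [al0 [D [n1 [al00 al01 D0 htails]]]] := tails K L hK hL M hM.
have [al [alP ala alK alL]] : exists al : R, [/\ 0 < al, 2 * al <= al0, al <= K & 4 * L * al <= 1].
  exists (Num.min (al0 / 2) (Num.min K (4 * L)^-1)); split.
  - by rewrite !lt_min hK divr_gt0// invr_gt0 mulr_gt0.
  - by rewrite mulrC -ler_pdivlMr// ge_min lexx.
  - by rewrite !ge_min lexx !orbT.
  - by rewrite -ler_pdivlMl ?mulr_gt0// mulr1 !ge_min lexx !orbT.
have al1 : al <= 1 by lra.
have [lam [lam0 lam1 lam2 lam3]] : exists lam : R,
    [/\ 0 < lam, lam <= 1 / 8, lam <= al ^+ 2 / 4 & lam <= (16 * D)^-1].
  exists (Num.min (1 / 8) (Num.min (al ^+ 2 / 4) (16 * D)^-1)); split.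
  - by rewrite !lt_min invr_gt0 !mulr_gt0// ?exprn_gt0//; lra.
  - by rewrite ge_min lexx.
  - by rewrite !ge_min lexx !orbT.
  - by rewrite !ge_min lexx !orbT.
have [n2 hn2] := ln_sqr_small (1 : R) ltr01.
have kap0 : 0 < Num.min K 1 by rewrite lt_min hK ltr01.
have [n3 hn3] := ex_nat_ge (expR (2 * (3 / 2 + L) / Num.min K 1)).
exists al, D, (4 * expR ((1 / 2 + L) * M + 4 * D)), lam, (maxn n1 (maxn n2 n3)).
split=> //; split=> //; split; first by rewrite mulr_gt0 ?expR_gt0.
split=> // d T mu F eta Z FF mdF [c [v [cv vM]]] mZ lawZ n.
rewrite !geq_max => /and3P[nn1 nn2 nn3].
have [l1 [x3 _]] := hn2 n nn2.
have n0 : (0 < n)%N by rewrite -(ltr0n R); lra.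
have s0 : 0 < Num.sqrt (n%:R : R) by rewrite sqrtr_gt0 ltr0n.
have lK : 2 * (3 / 2 + L) <= Num.min K 1 * ln n%:R.
  by rewrite -ler_pdivrMl// mulrC -[leLHS]expRK ler_ln ?posrE ?expR_gt0 ?ltr0n// hn3.
have sys := md_sys_of mu F eta K L M hL hM FF mdF c v cv vM.
set v' := (X in md_sys _ _ _ X _ _ _) in sys; clearbody v'.
have mono := distr_fn_mono mu F eta v' K L M sys n n0.
have up := distr_fn_up mu F eta v' K L M hK hL sys n n0.
have lo := distr_fn_lo mu F eta v' K L M hK hL sys n n0.
have tl := distr_fn_tail mu F eta v' K L M hL sys n n0.
have close := distr_fn_close mu F eta v' K L M sys n n0 al0 (ln n%:R) D
  (fun F x v h w => htails _ _ mu F x v h n w nn1).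
have q0 : 0 < ln n%:R / Num.sqrt (n%:R : R) by rewrite divr_gt0//; lra.
have Wclose w : `|W mu eta Z n w| <= al * Num.sqrt n%:R ->
    Num.sqrt n%:R * `|W mu eta Z n w - Z w| / ln n%:R <= 2 * D * (W mu eta Z n w ^+ 2 + 1).
  have as0 : 0 < al * Num.sqrt n%:R by rewrite mulr_gt0.
  move=> /(W_close Z (distr_fn mu eta n) mono up lo _ D _ w as0 q0 D0) h.
  rewrite ler_pdivrMr; last by lra.
  rewrite -ler_pdivlMl//; apply: le_trans (h _) _; last by rewrite le_eqVlt; apply/orP; left; apply/eqP; ring.
  by move=> y hy; apply: close; apply: le_trans hy _; rewrite mulrA ler_wpM2r// ltW.
split; first exact: aeW.
move=> x x0.
exact: (close_tail mu Z mZ lawZ (distr_fn mu eta n) mono up lo K L M al D (Num.sqrt n%:R)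
  (ln n%:R) lam hK hL hM alP alK alL al1 D0 s0 l1 lK (ltW lam0) lam1 lam2 lam3 tl Wclose).
Qed.
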